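(* Let $0<a<b$, $N\in\mathbb{N}$, $l=(l_1,\dots,l_N)$ with $0\le l_1<\dots<l_N\le 1$, and $\alpha=(\alpha_1,\dots,\alpha_N)\in(0,\infty)^N$ be such that $$f_{a,b,N,\alpha,l}(x):=\frac{\sqrt{(b-x)(x-a)}}{x}\sum_{k=1}^N\frac{\alpha_k}{x^{l_k}}\,1_{(a,b)}(x)$$ satisfies $\int_a^b f_{a,b,N,\alpha,l}(x)\,dx=1$. If a random variable $X$ has distribution $\mathrm{GPFP}(a,b,N,\alpha,l):=f_{a,b,N,\alpha,l}(x)\,dx$, then for every real $r\le -1$ the distribution of $X^r$ belongs to the class UI.
   Context: $X$ is a positive random variable; the distribution of $X^r$ is the push-forward of the distribution of $X$ under $x\mapsto x^r$. For a probability measure $\mu$ on $\mathbb{R}$ the Cauchy transform is $G_\mu(z)=\int_{\mathbb{R}}\frac{1}{z-x}\,d\mu(x)$, which is analytic on the upper half-plane $\mathbb{C}^+$. For every $\gamma>0$ there exist $\lambda,M,\delta>0$ such that $G_\mu$ is univalent (injective analytic) on $\Gamma_{\lambda,M}=\{z\in\mathbb{C}^+:\lambda|\mathrm{Re}(z)|<\mathrm{Im}(z),\ \mathrm{Im}(z)>M\}$ and $G_\mu(\Gamma_{\lambda,M})$ contains $\Lambda_{\gamma,\delta}=\{z\in\mathbb{C}^-:\gamma|\mathrm{Re}(z)|<-\mathrm{Im}(z),\ \mathrm{Im}(z)>-\delta\}$, where $\mathbb{C}^-$ is the lower half-plane. Hence a right inverse $G_\mu^{-1}$ is defined on $\Lambda_{\gamma,\delta}$.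 Class UI (Univalent Inverse Cauchy transform): $\mu$ belongs to UI if the right inverse $G_\mu^{-1}$, originally defined on a triangular domain $\Lambda_{\gamma,\delta}$, has a univalent analytic continuation to all of $\mathbb{C}^-$. *)

(* Defs.v *)
From HB Require Import structures.
From mathcomp Require Import all_boot all_order all_algebra.
From mathcomp Require Import complex.
From mathcomp Require Import all_classical all_reals all_analysis.
From mathcomp Require Import measurable_realfun.

Set Implicit Arguments.
Unset Strict Implicit.
Unset Printing Implicit Defensive.

Import Order.TTheory GRing.Theory Num.Theory.
Import numFieldNormedType.Exports.

Local Open Scope classical_set_scope.
Local Open Scope ring_scope.
Local Open Scope complex_scope.

Section ComplexDomains.
Variable R : realType.

Definition lower_half_plane : set R[i] := [set z | complex.Im z < 0].

Definition Gamma_dom (lambda M : R) : set R[i] :=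
  [set z | [/\ 0 < complex.Im z,
               lambda * `|complex.Re z| < complex.Im z & M < complex.Im z]].

Definition Lambda_dom (gamma delta : R) : set R[i] :=
  [set z | [/\ complex.Im z < 0,
               gamma * `|complex.Re z| < - complex.Im z &
               - delta < complex.Im z]].

(* [R[i]^o] is R[i] as a normed module over itself, so [derivable] along the
   direction 1 is complex differentiability.  [D] is meant to be open, in which
   case this is analyticity on [D]. *)
Definition analytic_on (D : set R[i]) (f : R[i]^o -> R[i]^o) : Prop :=
  forall z, D z -> derivable f z 1.

Definition univalent_on (D : set R[i]) (f : R[i] -> R[i]) : Prop :=
  analytic_on D f /\ {in D &, injective f}.

End ComplexDomains.

Section UnivalentInverseCauchy.
Variable R : realType.

(* The integral of the complex-valued function x |-> 1 / (z - x), taken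
   componentwise. *)
Definition cauchy_transform (mu : probability R R) (z : R[i]) : R[i] :=
  (\int[mu]_(x in setT) complex.Re ((z - x%:C)^-1)) +i*
  (\int[mu]_(x in setT) complex.Im ((z - x%:C)^-1)).

(* For every [mu] and [gamma] > 0 there are such [lambda], [M] and [delta]. *)
Definition inverse_domain (mu : probability R R) (gamma lambda M delta : R) :
    Prop :=
  [/\ 0 < gamma, 0 < lambda, 0 < M & 0 < delta] /\
  (univalent_on (Gamma_dom lambda M) (cauchy_transform mu) /\
   Lambda_dom gamma delta `<=` cauchy_transform mu @` Gamma_dom lambda M).

(* The last condition says that F coincides on the triangular domain with the
   inverse of the (injective) restriction of the Cauchy transform to
   [Gamma_dom lambda M].  By the identity theorem the choice of the parameters
   is immaterial. *)
Definition class_UI (mu : probability R R) : Prop :=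
  exists gamma lambda M delta : R,
    inverse_domain mu gamma lambda M delta /\
    exists F : R[i] -> R[i],
      univalent_on (@lower_half_plane R) F /\
      forall w, Lambda_dom gamma delta w ->
        Gamma_dom lambda M (F w) /\ cauchy_transform mu (F w) = w.

End UnivalentInverseCauchy.

Section GPFP.
Variable R : realType.

Definition gpfp_pdf (a b : R) (N : nat) (alpha l : 'I_N -> R) (x : R) : R :=
  Num.sqrt ((b - x) * (x - a)) / x *
  (\sum_(k < N) alpha k / x `^ l k) * \1_(`]a, b[%classic) x.

Definition gpfp (a b : R) (N : nat) (alpha l : 'I_N -> R) (A : set R) :
    \bar R :=
  (\int[lebesgue_measure]_(x in A) (gpfp_pdf a b alpha l x)%:E)%E.

End GPFP.

Section PowerRV.
Context d (T : measurableType d) (R : realType) (P : probability T R).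

Definition pow_RV (X : {RV P >-> R}) (r : R) : T -> R := fun t => X t `^ r.

Lemma measurable_pow_RV (X : {RV P >-> R}) (r : R) :
  measurable_fun [set: T] (pow_RV X r).
Proof. exact: (measurableT_comp (measurable_powR r)). Qed.

HB.instance Definition _ (X : {RV P >-> R}) (r : R) :=
  isMeasurableFun.Build _ _ _ _ (pow_RV X r) (measurable_pow_RV X r).

End PowerRV.

(* Main.v *)
Require Import Defs.
From HB Require Import structures.
From mathcomp Require Import all_boot all_order all_algebra.
From mathcomp Require Import complex.
From mathcomp Require Import all_classical all_reals all_analysis.
From mathcomp Require Import measurable_realfun ring lra.

Set Implicit Arguments.
Unset Strict Implicit.
Unset Printing Implicit Defensive.

Import Order.TTheory GRing.Theory Num.Theory.
Import numFieldNormedType.Exports.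

Local Open Scope classical_set_scope.
Local Open Scope ring_scope.
Import Normc.
Local Open Scope complex_scope.

(** The law of [X ^ r] has a density supported on the segment between
    [A = b ^ r] and [B = a ^ r]. With [phi x = x ^ r] and [q = - 1 / r], which lies
    between 0 and 1, this density is the restriction to the support of the function
    [gdens], which is analytic on the plane cut along the real half-lines outside
    of the support ([Dom]). Write [G] for the Cauchy transform of the law. By the
    Plemelj formula the function [Gh] equal to [G] on the upper half-plane and to
    [G - 2 pi i gdens] on the lower one extends analytically across the support.
    The theorem follows from the fact that [Gh] takes every value [w] of the lower
    half-plane exactly once on [Dom], with a nonzero derivative: the inverse of
    [Gh] is then the required univalent function, and it is an inverse of [G] where
    its values lie in the upper half-plane, that is, for small [w] in a cone.

    Analyticity across the support. For [z] on the support one writes [Gh] as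
    [gdens z] times an explicit logarithm minus the integral of the difference
    quotients [(gdens z - gdens y) / (z - y)]. The integral is differentiated with
    the help of second order estimates of [gdens] and of the Poisson kernel
    ([cder_I_cut]). Only one complex derivative is obtained there, and two
    elsewhere; the maximum principle [max_principle] is proved under this
    assumption, with a comparison function that has a kink along the real axis.

    Existence. The imaginary part of [Gh] has nonnegative lower limits at all the
    boundary points of [Dom] and at infinity ([Im_Gh_boundary], [Im_Gh_infty]). Here
    the hypotheses [r <= -1] and [0 <= l_k <= 1] enter: they confine the
    arguments of the terms of [gdens] ([Re_term_neg], [Re_gdens_infty]). The only
    exception is the origin approached from below, where [Gh] tends to infinity
    ([normc_Gh_zero]) and its imaginary part is unbounded below
    ([Im_Gh_unbounded]). If a value [w] were omitted, the maximum
    principle for [Im (1 / (w - Gh))] would bound the imaginary part of [Gh] below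
    ([Gh_surj]).

    Uniqueness. Let [xi] be the conformal map of [Dom] onto the upper half-plane
    which sends the lower side of the origin to infinity, [z0] a solution of
    [Gh z0 = w], and [x0 = xi z0]. Since [Gh] grows at most like [xi ^ 2] at the
    exceptional point, the imaginary part [V] of
    [(Gh - w) / ((xi - x0) (xi - conj x0)) + c / (xi - conj x0)] is bounded below
    near all the boundary points; with [c] equal to [- Im w / Im x0] its
    boundary values are nonnegative, except perhaps at the origin, at [A], at [B]
    and at [z0], which a barrier function takes care of. Hence [V] is
    nonnegative ([V_ge0]). At another solution, or at [z0] if the derivative vanished
    there, the first term would disappear and leave the negative imaginary part
    of the second ([Gh_uniq], [Gh_cder_neq0]). *)

(** * Complex numbers as pairs of real numbers *)

Section ComplexBasics.
Variable R : realType.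
Local Notation C := R[i].
Implicit Types (z w : C).
Local Notation Re := (@complex.Re R).
Local Notation Im := (@complex.Im R).

Lemma ReD z w : Re (z + w) = Re z + Re w. Proof. by case: z w => ? ? []. Qed.
Lemma ImD z w : Im (z + w) = Im z + Im w. Proof. by case: z w => ? ? []. Qed.
Lemma ReN z : Re (- z) = - Re z. Proof. by case: z. Qed.
Lemma ImN z : Im (- z) = - Im z. Proof. by case: z. Qed.
Lemma ReM z w : Re (z * w) = Re z * Re w - Im z * Im w.
Proof. by case: z w => ? ? []. Qed.
Lemma ImM z w : Im (z * w) = Re z * Im w + Im z * Re w.
Proof. by case: z w => ? ? []. Qed.
Lemma ReC (x : R) : Re x%:C = x. Proof. by []. Qed.
Lemma ImC (x : R) : Im x%:C = 0. Proof. by []. Qed.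
Lemma Rei : Re 'i = 0. Proof. by []. Qed.
Lemma Imi : Im 'i = 1. Proof. by []. Qed.
Lemma ReV z : Re z^-1 = Re z / (Re z ^+ 2 + Im z ^+ 2).
Proof. by case: z. Qed.
Lemma ImV z : Im z^-1 = - Im z / (Re z ^+ 2 + Im z ^+ 2).
Proof. by case: z => a b /=; rewrite mulNr. Qed.
Lemma ReJ z : Re (conjc z) = Re z. Proof. by case: z. Qed.
Lemma ImJ z : Im (conjc z) = - Im z. Proof. by case: z. Qed.
Lemma Re0 : Re 0 = 0. Proof. by []. Qed.
Lemma Im0 : Im 0 = 0. Proof. by []. Qed.
Lemma Re1 : Re 1 = 1. Proof. by []. Qed.
Lemma Im1 : Im 1 = 0. Proof. by []. Qed.
(** Without the rules for inverses, these equations reduce real and imaginary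
    parts to polynomials, which [ring] can compare. *)
Definition ReImE := (Rei, Imi, Re0, Im0, Re1, Im1, ReD, ImD, ReN, ImN, ReM, ImM,
  ReC, ImC, ReJ, ImJ).

Lemma complexP z w : Re z = Re w -> Im z = Im w -> z = w.
Proof. by case: z w => ? ? [? ?] /= -> ->. Qed.

Lemma normcE z : `|z| = (normc z)%:C.
Proof. by case: z. Qed.

Lemma normc_ge0 z : 0 <= normc z.
Proof. by case: z => ? ?; exact: sqrtr_ge0. Qed.

Lemma sqr_normcE z : normc z ^+ 2 = Re z ^+ 2 + Im z ^+ 2.
Proof. by case: z => a b; rewrite sqr_sqrtr// addr_ge0 ?sqr_ge0. Qed.

Lemma normcB z w : normc (z - w) = normc (w - z).
Proof. by rewrite -normcN opprB. Qed.

Lemma ler_normcB z w : normc (z - w) <= normc z + normc w.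
Proof. by rewrite (le_trans (le_normcD _ _))// normcN. Qed.

Lemma normc_tri (x y z : C) : normc (x - z) <= normc (x - y) + normc (y - z).
Proof. by rewrite -{1}(subrK y x) -addrA le_normcD. Qed.

Lemma ler_distc z w : normc z - normc w <= normc (z - w).
Proof. by rewrite lerBlDr -{1}(subrK w z) le_normcD. Qed.

Lemma ler_dist_normc z w : `|normc z - normc w| <= normc (z - w).
Proof.
by rewrite ler_norml ler_distc andbT lerNl opprB normcB ler_distc.
Qed.

Lemma normc_Re z : `|Re z| <= normc z.
Proof.
case: z => a b /=; rewrite -sqrtr_sqr ler_wsqrtr//.
by rewrite lerDl sqr_ge0.
Qed.

Lemma normc_Im z : `|Im z| <= normc z.
Proof.
case: z => a b /=; rewrite -sqrtr_sqr ler_wsqrtr//.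
by rewrite lerDr sqr_ge0.
Qed.

Lemma Re_le_normc z : Re z <= normc z.
Proof. exact: le_trans (ler_norm _) (normc_Re z). Qed.

Lemma Im_le_normc z : Im z <= normc z.
Proof. exact: le_trans (ler_norm _) (normc_Im z). Qed.

Lemma Im_ge_normc z : - normc z <= Im z.
Proof. by have := normc_Im z; rewrite ler_norml => /andP[]. Qed.

Lemma normc_real (x : R) : normc x%:C = `|x|.
Proof. by rewrite /= expr0n/= addr0 sqrtr_sqr. Qed.

Lemma normc_i : normc ('i : C) = 1.
Proof. by rewrite /= expr0n/= add0r expr1n sqrtr1. Qed.

Lemma normc_conj z : normc (conjc z) = normc z.
Proof. by case: z => a b /=; rewrite sqrrN. Qed.

Lemma normc_leD z : normc z <= `|Re z| + `|Im z|.
Proof.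
rewrite -ler_sqr ?nnegrE ?normc_ge0 ?addr_ge0//.
rewrite sqr_normcE sqrrD !real_normK ?num_real//.
by rewrite lerD2r lerDl mulrn_wge0// mulr_ge0.
Qed.

Lemma normc_eq0 z : (normc z == 0) = (z == 0).
Proof. by apply/eqP/eqP => [/eq0_normc//|->]; rewrite normc0. Qed.

Lemma normc_gt0 z : (0 < normc z) = (z != 0).
Proof. by rewrite lt0r normc_ge0 andbT normc_eq0. Qed.

Lemma normcX z n : normc (z ^+ n) = normc z ^+ n.
Proof. by elim: n => [|n ih]; rewrite ?expr0 ?normc1// !exprS normcM ih. Qed.

Lemma ReC_mul (x : R) z : Re (x%:C * z) = x * Re z.
Proof. by rewrite ReM ReC ImC mul0r subr0. Qed.
Lemma ImC_mul (x : R) z : Im (x%:C * z) = x * Im z.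
Proof. by rewrite ImM ReC ImC mul0r addr0. Qed.

Lemma mul_conjc z : z * conjc z = (normc z ^+ 2)%:C.
Proof. by rewrite sqr_normcE; apply: complexP; rewrite !ReImE; ring. Qed.

Lemma ReVn z : Re z^-1 = Re z / normc z ^+ 2.
Proof. by rewrite ReV sqr_normcE. Qed.
Lemma ImVn z : Im z^-1 = - Im z / normc z ^+ 2.
Proof. by rewrite ImV sqr_normcE. Qed.

(** * Topology and complex derivatives *)

Lemma nbhsC (z : C) (P : set C^o) :
  nbhs (z : C^o) P <-> exists2 d : R, 0 < d & forall y : C, normc (y - z) < d -> P y.
Proof.
split.
  move=> /nbhs_ballP[e/= e0 he].
  have e0' : 0 < Re e by move: e0; rewrite ltcE /= => /andP[].
  exists (Re e) => // y yz; apply: he; rewrite -ball_normE /= normcE.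
  move: e0; rewrite !ltcE /= => /andP[/eqP -> _]; rewrite eqxx /=.
  by rewrite -(normcN) opprB.
move=> [d d0 hd]; apply/nbhs_ballP; exists d%:C => /=; first by rewrite ltcR.
by move=> y; rewrite -ball_normE /= normcE ltcR => h; apply: hd; rewrite normcB.
Qed.

Lemma near_normc (z : C) (d : R) : 0 < d ->
  \forall y \near (z : C^o), normc ((y : C) - z) < d.
Proof. by move=> d0; apply/nbhsC; exists d. Qed.

(** A one-constructor predicate rather than a definition: the arrow hidden in
    the convergence of filters is thus never exposed to unification. *)
Variant clim (T : Type) (F : set_system T) (f : T -> C) (l : C) : Prop :=
  Clim of (f : T -> C^o) @ F --> (l : C^o).

Lemma climE (T : Type) (F : set_system T) (f : T -> C) (l : C) :
  clim F f l -> (f : T -> C^o) @ F --> (l : C^o).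
Proof. by case. Qed.

Section Clim.
Variables (T : Type) (F : set_system T).
Context {FF : Filter F}.
Implicit Types (f g : T -> C) (l k : C).

Lemma climP f l :
  clim F f l <-> forall e : R, 0 < e -> \forall x \near F, normc (f x - l) < e.
Proof.
split => [h e e0|h].
  by case: h => /(_ [set y | normc (y - l) < e]); apply; apply/nbhsC; exists e.
by split=> P /nbhsC[d d0 hd]; have := h d d0; apply: filterS => x; exact: hd.
Qed.

Lemma clim_Re f l : clim F f l -> (fun x => Re (f x)) @ F --> Re l.
Proof.
move/climP => h; apply/cvgrPdist_lt => e e0; apply: filterS (h e e0) => x.
by apply: le_lt_trans; rewrite -ReN -ReD -normcN opprB; exact: normc_Re.
Qed.

Lemma clim_Im f l : clim F f l -> (fun x => Im (f x)) @ F --> Im l.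
Proof.
move/climP => h; apply/cvgrPdist_lt => e e0; apply: filterS (h e e0) => x.
by apply: le_lt_trans; rewrite -ImN -ImD -normcN opprB; exact: normc_Im.
Qed.

Lemma clim_normc f l : clim F f l -> (fun x => normc (f x)) @ F --> normc l.
Proof.
move/climP => h; apply/cvgrPdist_lt => e e0; apply: filterS (h e e0) => x.
by apply: le_lt_trans; rewrite distrC; exact: ler_dist_normc.
Qed.

Lemma clim_ReIm f l : (fun x => Re (f x)) @ F --> Re l ->
  (fun x => Im (f x)) @ F --> Im l -> clim F f l.
Proof.
move=> /cvgrPdist_lt h1 /cvgrPdist_lt h2; apply/climP => e e0.
have e2 : 0 < e / 2 by rewrite divr_gt0.
near=> x.
apply: le_lt_trans (normc_leD _) _; rewrite (splitr e) ReD ReN ImD ImN ltrD//.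
  by rewrite distrC; near: x; exact: h1.
by rewrite distrC; near: x; exact: h2.
Unshelve. all: by end_near. Qed.

Lemma clim_real (f : T -> R) (l : R) : f @ F --> l -> clim F (fun x => (f x)%:C) l%:C.
Proof.
by move=> h; apply: clim_ReIm => //; exact: cvg_cst.
Qed.

Lemma clim_cst k : clim F (fun _ => k) k. Proof. by split; exact: cvg_cst. Qed.

Lemma climD f g l k : clim F f l -> clim F g k -> clim F (fun x => f x + g x) (l + k).
Proof. by move=> hf hg; split; exact: (@cvgD C C^o T F _ f g l k (climE hf) (climE hg)). Qed.

Lemma climN f l : clim F f l -> clim F (fun x => - f x) (- l).
Proof. by move=> hf; split; exact: (@cvgN C C^o T F _ f l (climE hf)). Qed.

Lemma climB f g l k : clim F f l -> clim F g k -> clim F (fun x => f x - g x) (l - k).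
Proof. by move=> hf hg; exact: climD hf (climN hg). Qed.

Lemma climM f g l k : clim F f l -> clim F g k -> clim F (fun x => f x * g x) (l * k).
Proof. by move=> hf hg; split; exact: (@cvgM C T F _ f g l k (climE hf) (climE hg)). Qed.

Lemma climV f l : l != 0 -> clim F f l -> clim F (fun x => (f x)^-1) l^-1.
Proof. by move=> l0 hf; split; exact: (@cvgV C T F _ f l l0 (climE hf)). Qed.

Lemma clim_near f g l : (\forall x \near F, f x = g x) -> clim F f l -> clim F g l.
Proof. by move=> fg [h]; split; apply: cvg_trans h; exact: near_eq_cvg. Qed.

End Clim.

Definition ccont (f : C -> C) z := clim (nbhs (z : C^o)) f (f z).

(** Caratheodory's form of complex differentiability: it makes the product,
    chain and quotient rules consequences of the continuity of the slope. *)
Definition cder (f : C -> C) z c := exists q : C -> C,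
  [/\ forall y, f y = f z + q y * (y - z), ccont q z & q z = c].

Lemma ccontD f g z : ccont f z -> ccont g z -> ccont (fun y => f y + g y) z.
Proof. exact: climD. Qed.
Lemma ccontN f z : ccont f z -> ccont (fun y => - f y) z.
Proof. exact: climN. Qed.
Lemma ccontB f g z : ccont f z -> ccont g z -> ccont (fun y => f y - g y) z.
Proof. exact: climB. Qed.
Lemma ccontM f g z : ccont f z -> ccont g z -> ccont (fun y => f y * g y) z.
Proof. exact: climM. Qed.
Lemma ccontV f z : f z != 0 -> ccont f z -> ccont (fun y => (f y)^-1) z.
Proof. exact: climV. Qed.
Lemma ccont_cst c z : ccont (fun _ => c) z. Proof. exact: clim_cst. Qed.
Lemma ccont_id z : ccont (fun y => y) z. Proof. by split; exact: cvg_id. Qed.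
Lemma clim_comp (T : Type) (F : set_system T) {FF : Filter F} (f : C -> C) (g : T -> C) l :
  clim F g l -> ccont f l -> clim F (fun y => f (g y)) (f l).
Proof. by move=> hg hf; split; apply: (@cvg_comp _ _ _ g f _ _ _ (climE hg) (climE hf)). Qed.
Lemma ccont_comp f g z : ccont g z -> ccont f (g z) -> ccont (fun y => f (g y)) z.
Proof. exact: clim_comp. Qed.
Lemma ccont_near f g z : (\forall y \near (z : C^o), f y = g y) ->
  ccont f z -> ccont g z.
Proof.
move=> fg hf; rewrite /ccont -(nbhs_singleton fg).
exact: clim_near hf.
Qed.

Lemma cder_ccont f z c : cder f z c -> ccont f z.
Proof.
move=> [q [hq cq _]]; apply: (@ccont_near (fun y => f z + q y * (y - z))).
  by near=> y; rewrite -hq.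
apply: ccontD; first exact: ccont_cst.
apply: ccontM => //.
by apply: ccontD; [exact: ccont_id|exact: ccont_cst].
Unshelve. all: by end_near. Qed.

(** The classical form, used where a derivative comes from an estimate rather
    than from the rules of calculus. *)
Lemma cder_eps f z c : cder f z c <->
  forall e : R, 0 < e -> \forall y \near (z : C^o),
    normc (f y - f z - c * (y - z)) <= e * normc (y - z).
Proof.
split.
  move=> [q [hq /climP cq <-]] e e0; apply: filterS (cq e e0) => y yz.
  rewrite (_ : _ - _ = (q y - q z) * (y - z)); last by rewrite (hq y); ring.
  rewrite normcM.
  by rewrite ler_wpM2r ?normc_ge0 ?ltW.
move=> h; pose q y := if y == z then c else (f y - f z) / (y - z).
have qz : q z = c by rewrite /q eqxx.
exists q; split=> //.
  move=> y; rewrite /q; case: eqP => [->|/eqP yz]; first by rewrite subrr mulr0 addr0.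
  by rewrite mulfVK ?subr_eq0// addrC subrK.
apply/climP => e e0; rewrite qz.
have e2 : 0 < e / 2 by rewrite divr_gt0.
apply: filterS (h _ e2) => y; rewrite /q; case: eqP => [_ _|/eqP yz hy].
  by rewrite subrr normc0.
have yz0 : y - z != 0 by rewrite subr_eq0.
have -> : (f y - f z) / (y - z) - c = (f y - f z - c * (y - z)) / (y - z) by field.
rewrite normcM normcV ltr_pdivrMr ?normc_gt0//.
apply: le_lt_trans hy _; rewrite ltr_pM2r ?normc_gt0// ltr_pdivrMr// mulr_natr mulr2n.
by rewrite ltrDl.
Qed.

Lemma cder_cst c z : cder (fun _ => c) z 0.
Proof. by exists (fun _ => 0); split=> [y||]; rewrite ?mul0r ?addr0//; exact: ccont_cst. Qed.
Lemma cder_id z : cder (fun y => y) z 1.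
Proof. by exists (fun _ => 1); split=> [y||]; rewrite ?mul1r ?[z + _]addrC ?subrK//; exact: ccont_cst. Qed.
Lemma cderD f g z c d : cder f z c -> cder g z d -> cder (fun y => f y + g y) z (c + d).
Proof.
move=> [p [hp cp pc]] [q [hq cq qc]]; exists (fun y => p y + q y); split.
- by move=> y; rewrite hp hq; ring.
- exact: ccontD.
- by rewrite pc qc.
Qed.
Lemma cderM f g z c d : cder f z c -> cder g z d ->
  cder (fun y => f y * g y) z (c * g z + f z * d).
Proof.
move=> hf hg; have cg := cder_ccont hg; case: hf hg => p [hp cp pc] [q [hq cq qc]].
exists (fun y => p y * g y + f z * q y); split.
- by move=> y; rewrite hp [X in _ * X = _]hq [X in _ + (_ * X + _) * _]hq; ring.
- by apply: ccontD; apply: ccontM => //; exact: ccont_cst.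
- by rewrite pc qc.
Qed.
Lemma cderN f z c : cder f z c -> cder (fun y => - f y) z (- c).
Proof.
move=> [p [hp cp pc]]; exists (fun y => - p y); split.
- by move=> y; rewrite hp; ring.
- exact: ccontN.
- by rewrite pc.
Qed.
Lemma cderB f g z c d : cder f z c -> cder g z d -> cder (fun y => f y - g y) z (c - d).
Proof. by move=> hf hg; exact: cderD hf (cderN hg). Qed.
Lemma cder_comp f g z c d : cder g z d -> cder f (g z) c ->
  cder (fun y => f (g y)) z (c * d).
Proof.
move=> hg; have cg := cder_ccont hg; case: hg => q [hq cq qd] [p [hp cp pc]].
exists (fun y => p (g y) * q y); split.
- by move=> y; rewrite hp [X in _ + _ * (X - _) = _]hq; ring.
- by apply: ccontM => //; exact: ccont_comp.
- by rewrite pc qd.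
Qed.
Lemma cder_inv z : z != 0 -> cder (fun y => y^-1) z (- (z^-1 * z^-1)).
Proof.
move=> z0.
have nz : \forall y \near (z : C^o), y != 0.
  have := near_normc z (_ : 0 < normc z); rewrite normc_gt0 => /(_ z0).
  by apply: filterS => y yz; apply/eqP => y0; move: yz; rewrite y0 sub0r normcN ltxx.
exists (fun y => if y == 0 then z^-1 * z^-1 else - (z^-1 * y^-1)); split; last first.
- by rewrite (negPf z0).
- apply: (@ccont_near (fun y => - (z^-1 * y^-1))).
    by apply: filterS nz => y /negPf ->.
  apply: ccontN; apply: ccontM; first exact: ccont_cst.
  by apply: ccontV => //; exact: ccont_id.
- move=> y; case: eqP => [->|/eqP y0].
    by rewrite invr0 sub0r; field.
  by field; rewrite z0 y0.
Qed.
Lemma cderV f z c : f z != 0 -> cder f z c ->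
  cder (fun y => (f y)^-1) z (- ((f z)^-1 * (f z)^-1) * c).
Proof. by move=> fz hf; apply: cder_comp => //; exact: cder_inv. Qed.

Lemma cder_near f g z c : (\forall y \near (z : C^o), f y = g y) ->
  cder f z c -> cder g z c.
Proof.
move=> fg /cder_eps h; apply/cder_eps => e e0.
rewrite -(nbhs_singleton fg); near=> y.
have -> : g y = f y by apply/esym; near: y.
by near: y; exact: h.
Unshelve. all: by end_near. Qed.

Lemma cder_derivable f z c : cder f z c -> derivable (f : C^o -> C^o) z 1.
Proof.
move=> [q [hq cq qc]].
apply/cvg_ex; exists (c : C^o).
have : (fun h : C^o => q (h + z) : C^o) @ (0 : C^o)^' --> (c : C^o).
  rewrite -qc; apply: (@cvg_comp _ _ _ (fun h : C^o => h + z) q _ (nbhs (z : C^o)) _ _ (climE cq)).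
  have h0 : (fun h : C^o => h + z) @ (0 : C^o) --> (z : C^o).
    have hz : clim (nbhs (0 : C^o)) (fun h => h + z) (0 + z).
      by apply: climD; [exact: ccont_id|exact: clim_cst].
    by rewrite add0r in hz; exact: climE hz.
  by apply: cvg_trans h0; apply: cvg_app; exact: cvg_within.
apply: cvg_trans; apply: near_eq_cvg.
near=> h.
have h0 : h != 0 by near: h; exact: nbhs_dnbhs_neq.
rewrite /= hq scaler1 [X in X - _]addrC addrK addrK.
by rewrite /GRing.scale/= mulrCA mulVf ?mulr1.
Unshelve. all: by end_near. Qed.

End ComplexBasics.

(** * Higher derivatives and divided differences *)

Section Smooth.
Variable R : realType.
Local Notation C := R[i].
Local Notation Re := (@complex.Re R).
Local Notation Im := (@complex.Im R).
Implicit Types (z w : C).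

(** Derivatives along the real line, in the same slope form as [cder], so that
    the chain rule mixes the two. *)
Definition rder (g : R -> C) (t : R) c := exists q : R -> C,
  [/\ forall s, g s = g t + q s * (s - t)%:C, clim (nbhs t) q (q t) & q t = c].

Lemma rder_Re g t c : rder g t c -> is_derive t 1 (fun s => Re (g s)) (Re c).
Proof.
move=> [q [hq cq <-]].
have H : (fun h => h^-1 *: (Re (g (h *: 1 + t)) - Re (g t))) @ 0^' --> Re (q t).
  have cq' : (fun h => Re (q (h + t))) @ (0 : R)^' --> Re (q t).
    apply: (@cvg_comp _ _ _ (fun h : R => h + t) (fun s => Re (q s)) _ (nbhs t)).
      have h0 : (fun h : R => h + t) @ (0 : R) --> t.
        rewrite -{2}(add0r t); apply: cvgD; [exact: cvg_id|exact: cvg_cst].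
      by apply: cvg_trans h0; apply: cvg_app; exact: cvg_within.
    exact: clim_Re cq.
  apply: cvg_trans cq'; apply: near_eq_cvg; near=> h.
  have h0 : h != 0 by near: h; exact: nbhs_dnbhs_neq.
  rewrite [h *: 1]mulr1 hq ReD [Re _ + _]addrC !addrK mulrC ReC_mul.
  by rewrite /GRing.scale/= mulrA mulVf ?mul1r.
apply: DeriveDef; first by apply/cvg_ex; exists (Re (q t)).
exact: cvg_lim H.
Unshelve. all: by end_near. Qed.

Lemma rder_Im g t c : rder g t c -> is_derive t 1 (fun s => Im (g s)) (Im c).
Proof.
move=> [q [hq cq hc]].
have -> : (fun s => Im (g s)) = (fun s => Re (- 'i * g s)).
  by apply/funext => s; rewrite ReM ReN ImN /=; ring.
have -> : Im c = Re (- 'i * c) by rewrite ReM ReN ImN /=; ring.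
apply: rder_Re; exists (fun s => - 'i * q s); split.
- by move=> s; rewrite [in LHS]hq; ring.
- by apply: climM => //; exact: clim_cst.
- by rewrite hc.
Qed.

Lemma rder_real (p : R -> R) (t c : R) : is_derive t 1 p c ->
  rder (fun s => (p s)%:C) t c%:C.
Proof.
move=> dp; pose q s := if s == t then c else (p s - p t) / (s - t).
have qE s : p s = p t + q s * (s - t).
  rewrite /q; case: eqP => [->|/eqP st]; first by rewrite subrr mulr0 addr0.
  by rewrite mulfVK ?subr_eq0// addrC subrK.
exists (fun s => (q s)%:C); split; last by rewrite /q eqxx.
- by move=> s; rewrite [in LHS]qE rmorphD rmorphM.
- apply: clim_real; rewrite {2}/q eqxx.
  have [/derivable_nbhsP hd <-] := dp.
  apply/cvgrPdist_lt => e e0.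
  have := dp.
  case=> /cvg_ex[l hl] dl.
  have lc : l = c by rewrite -dl; apply/esym; exact: cvg_lim hl.
  move/cvgrPdist_lt : hl => /(_ e e0).
  rewrite /dnbhs /within/= => /nbhs_ballP[d/= d0 hd'].
  apply/nbhs_ballP; exists d => // s /= sd.
  rewrite dl /q; case: eqP => [_|/eqP st]; first by rewrite subrr normr0.
  have := hd' (s - t); rewrite /ball/= sub0r normrN distrC => /(_ sd).
  rewrite subr_eq0 => /(_ st).
  by rewrite lc [_ *: 1]mulr1 subrK /GRing.scale/= mulrC.
Qed.

Lemma rder_comp (f : C -> C) (g : R -> C) t c d :
  rder g t d -> cder f (g t) c -> rder (fun s => f (g s)) t (c * d).
Proof.
move=> [q [hq cq <-]] [p [hp cp <-]].
have cg : clim (nbhs t) g (g t).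
  have h : clim (nbhs t) (fun s => g t + q s * (s - t)%:C) (g t + q t * (t - t)%:C).
    apply: climD; first exact: clim_cst.
    apply: climM => //; apply: clim_real; apply: cvgB; [exact: cvg_id|exact: cvg_cst].
  rewrite subrr mulr0 addr0 in h; apply: clim_near h; near=> s.
  by rewrite -hq.
exists (fun s => p (g s) * q s); split=> //.
- by move=> s; rewrite hp [X in _ + _ * (X - _) = _]hq; ring.
- by apply: climM => //; exact: clim_comp cg cp.
Unshelve. all: by end_near. Qed.

Lemma cder_line f z v t c : cder f (z + t%:C * v) c ->
  rder (fun s => f (z + s%:C * v)) t (c * v).
Proof.
move=> hf; apply: (@rder_comp f (fun s => z + s%:C * v)) => //.
exists (fun=> v); split => //; last exact: clim_cst.
by move=> s; rewrite rmorphB; ring.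
Qed.

(** The real mean value theorem, applied to the component of [f] in the
    direction of the total increment. *)
Lemma cder_mvt (f f' : C -> C) z1 z2 (M : R) :
  (forall t : R, 0 <= t <= 1 -> cder f (z1 + t%:C * (z2 - z1)) (f' (z1 + t%:C * (z2 - z1)))
     /\ normc (f' (z1 + t%:C * (z2 - z1))) <= M) ->
  normc (f z2 - f z1) <= M * normc (z2 - z1).
Proof.
move=> h; set u := conjc (f z2 - f z1).
pose g t := Re (u * f (z1 + t%:C * (z2 - z1))).
pose dg t := Re (u * (f' (z1 + t%:C * (z2 - z1)) * (z2 - z1))).
have hg (t : R) : 0 <= t <= 1 -> is_derive t 1 g (dg t).
  move=> t01; have [d _] := h t t01.
  have := rder_comp (cder_line d) (cderM (cder_cst u _) (cder_id _)).
  rewrite mul0r add0r mulr1; exact: rder_Re.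
have [c cin] : exists2 c, c \in `[0, 1] & g 1 - g 0 = dg c * (1 - 0).
  apply: MVT_segment => //.
    by move=> x; rewrite in_itv/= => /andP[x0 x1]; apply: hg; rewrite !ltW.
  apply: derivable_within_continuous => x; rewrite in_itv/= => x01.
  by have [] := hg x x01.
have e1 : z1 + 1%:C * (z2 - z1) = z2 by rewrite rmorph1; ring.
have e0 : z1 + 0%:C * (z2 - z1) = z1 by rewrite rmorph0; ring.
rewrite /g /dg subr0 mulr1 e1 e0 => hc.
have hn : Re (u * f z2) - Re (u * f z1) = normc (f z2 - f z1) ^+ 2.
  by rewrite -ReN -ReD -mulrN -mulrDr /u mulrC mul_conjc.
have [->|fz] := eqVneq (f z2 - f z1) 0.
  rewrite normc0 mulr_ge0 ?normc_ge0//.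
  have [] := h 0; first by rewrite lexx ler01.
  by move=> _; apply: le_trans; exact: normc_ge0.
have n0 : 0 < normc (f z2 - f z1) by rewrite normc_gt0.
rewrite -(ler_pM2l n0) -expr2 -hn hc; apply: le_trans (Re_le_normc _) _.
rewrite !normcM /u normc_conj ler_wpM2l ?normc_ge0// ler_wpM2r ?normc_ge0//.
by have [] := h c; first by move: cin; rewrite in_itv.
Qed.

(** [Cn n f z]: [f] is [n] times complex differentiable near [z], with
    continuous [n]-th derivative at [z]. *)
Fixpoint Cn (n : nat) (f : C -> C) z : Prop :=
  if n is m.+1 then
    exists f', (\forall y \near (z : C^o), cder f y (f' y)) /\ Cn m f' z
  else ccont f z.

Lemma Cn_ccont n f z : Cn n f z -> ccont f z.
Proof. by case: n => //= n [f' [/nbhs_singleton/cder_ccont]]. Qed.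

Lemma CnW n f z : Cn n.+1 f z -> Cn n f z.
Proof.
elim: n f => [|n ih] f [f' [hf hf']].
  exact: cder_ccont (nbhs_singleton hf).
by exists f'; split => //; exact: ih.
Qed.

Lemma Cn_cder n f z : Cn n.+1 f z -> exists c, cder f z c.
Proof. by move=> [f' [/nbhs_singleton hf _]]; exists (f' z). Qed.

Lemma nbhsC_nbhs z (P : set C^o) : nbhs (z : C^o) P ->
  \forall y \near (z : C^o), nbhs (y : C^o) P.
Proof.
move=> /nbhsC[d d0 hd]; apply/nbhsC; exists (d / 2); first by rewrite divr_gt0.
move=> y yz; apply/nbhsC; exists (d / 2); first by rewrite divr_gt0.
move=> x xy; apply: hd; rewrite -(subrK y x) -addrA.
by apply: le_lt_trans (le_normcD _ _) _; rewrite (splitr d) ltrD.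
Qed.

Lemma Cn_near n f g z : (\forall y \near (z : C^o), f y = g y) -> Cn n f z -> Cn n g z.
Proof.
case: n => [|n] fg; first exact: ccont_near.
move=> [f' [hf hf']]; exists f'; split => //.
apply: filterS2 (nbhsC_nbhs fg) hf => y; exact: cder_near.
Qed.

Lemma Cn_cst n c z : Cn n (fun _ => c) z.
Proof.
elim: n c => [|n ih] c; first exact: ccont_cst.
exists (fun _ => 0); split; last exact: ih.
by near=> y; exact: cder_cst.
Unshelve. all: by end_near. Qed.

Lemma Cn_id n z : Cn n (fun y => y) z.
Proof.
case: n => [|n]; first exact: ccont_id.
exists (fun _ => 1); split; last exact: Cn_cst.
by near=> y; exact: cder_id.
Unshelve. all: by end_near. Qed.

Lemma CnD n f g z : Cn n f z -> Cn n g z -> Cn n (fun y => f y + g y) z.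
Proof.
elim: n f g => [|n ih] f g; first exact: ccontD.
move=> [f' [hf hf']] [g' [hg hg']]; exists (fun y => f' y + g' y); split.
  by apply: filterS2 hf hg => y; exact: cderD.
exact: ih.
Qed.

Lemma CnN n f z : Cn n f z -> Cn n (fun y => - f y) z.
Proof.
elim: n f => [|n ih] f; first exact: ccontN.
move=> [f' [hf hf']]; exists (fun y => - f' y); split.
  by apply: filterS hf => y; exact: cderN.
exact: ih.
Qed.

Lemma CnB n f g z : Cn n f z -> Cn n g z -> Cn n (fun y => f y - g y) z.
Proof. by move=> hf hg; apply: CnD => //; exact: CnN. Qed.

Lemma CnM n f g z : Cn n f z -> Cn n g z -> Cn n (fun y => f y * g y) z.
Proof.
elim: n f g => [|n ih] f g; first exact: ccontM.
move=> hf0 hg0; have hf1 := CnW hf0; have hg1 := CnW hg0.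
move: hf0 hg0 => [f' [hf hf']] [g' [hg hg']].
exists (fun y => f' y * g y + f y * g' y); split.
  by apply: filterS2 hf hg => y; exact: cderM.
by apply: CnD; exact: ih.
Qed.

Lemma Cn_comp n f g z : Cn n g z -> Cn n f (g z) -> Cn n (fun y => f (g y)) z.
Proof.
elim: n f g => [|n ih] f g; first exact: ccont_comp.
move=> hg0 [f' [hf hf']]; have hg1 := CnW hg0.
have cg := Cn_ccont hg0; move: hg0 => [g' [hg hg']].
exists (fun y => f' (g y) * g' y); split; last first.
  by apply: CnM => //; exact: ih.
have hf2 : \forall y \near (z : C^o), cder f (g y) (f' (g y)) by case: cg => /(_ _ hf).
by apply: filterS2 hg hf2 => y; exact: cder_comp.
Qed.

Lemma Cn_inv0 n z : z != 0 -> Cn n (fun y => y^-1) z.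
Proof.
elim: n => [|n ih] z0; first by apply: ccontV => //; exact: ccont_id.
exists (fun y => - (y^-1 * y^-1)); split; last by apply: CnN; apply: CnM; exact: ih.
have := near_normc z (_ : 0 < normc z); rewrite normc_gt0 => /(_ z0).
apply: filterS => y yz; apply: cder_inv; apply/eqP => y0.
by move: yz; rewrite y0 sub0r normcN ltxx.
Qed.

Lemma CnV n f z : f z != 0 -> Cn n f z -> Cn n (fun y => (f y)^-1) z.
Proof. by move=> fz hf; apply: Cn_comp => //; exact: Cn_inv0. Qed.

Lemma Cn_sum n (I : Type) (r : seq I) (F : I -> C -> C) z :
  (forall i, Cn n (F i) z) -> Cn n (fun y => \sum_(i <- r) F i y) z.
Proof.
move=> h; elim: r => [|i r ih].
  by apply: Cn_near (Cn_cst n 0 z); near=> y; rewrite big_nil.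
apply: Cn_near (CnD (h i) ih); near=> y; by rewrite big_cons.
Unshelve. all: by end_near. Qed.

Lemma normc_segment z y (d : R) (t : R) : normc (y - z) < d -> 0 <= t <= 1 ->
  normc (z + t%:C * (y - z) - z) < d.
Proof.
move=> yd /andP[t0 t1]; rewrite addrC addKr normcM normc_real ger0_norm//.
by apply: le_lt_trans yd; rewrite ler_piMl// normc_ge0.
Qed.

Lemma normc_segment2_le z z1 z2 (m t : R) : normc (z1 - z) <= m -> normc (z2 - z) <= m ->
  0 <= t <= 1 -> normc (z1 + t%:C * (z2 - z1) - z) <= m.
Proof.
move=> h1 h2 /andP[t0 t1].
have -> : z1 + t%:C * (z2 - z1) - z = (1 - t)%:C * (z1 - z) + t%:C * (z2 - z).
  by rewrite rmorphB rmorph1; ring.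
apply: le_trans (le_normcD _ _) _; rewrite !normcM !normc_real !ger0_norm ?subr_ge0//.
have : (1 - t) * normc (z1 - z) <= (1 - t) * m by rewrite ler_wpM2l ?subr_ge0.
have : t * normc (z2 - z) <= t * m by rewrite ler_wpM2l.
lra.
Qed.

Lemma normc_segment2 z z1 z2 (d t : R) : normc (z1 - z) < d -> normc (z2 - z) < d ->
  0 <= t <= 1 -> normc (z1 + t%:C * (z2 - z1) - z) < d.
Proof.
move=> h1 h2 t01.
apply: (@le_lt_trans _ _ (Num.max (normc (z1 - z)) (normc (z2 - z)))).
  by apply: normc_segment2_le => //; rewrite le_max lexx ?orbT.
by rewrite gt_max h1.
Qed.

(** The mean value inequality applied to the remainder, the derivative of which
    is small by the differentiability of [f']. *)
Lemma Cn_taylor2 f z : Cn 2 f z -> exists c1 c2, cder f z c1 /\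
  forall e : R, 0 < e -> \forall y \near (z : C^o),
    normc (f y - f z - c1 * (y - z) - c2 * (y - z) ^+ 2) <= e * normc (y - z) ^+ 2.
Proof.
move=> [f' [hf [f'' [hf' _]]]].
exists (f' z), (f'' z / 2); split; first exact: nbhs_singleton hf.
move=> e e0.
have /cder_eps/(_ e e0) h2 := nbhs_singleton hf'.
have [d d0 hd] := (nbhsC _ _).1 (filterI hf h2).
apply/nbhsC; exists d => // y yd.
pose r y := f y - f' z * (y - z) - f'' z / 2 * (y - z) ^+ 2.
have ry : r y - r z = f y - f z - f' z * (y - z) - f'' z / 2 * (y - z) ^+ 2.
  by rewrite /r; ring.
rewrite -ry expr2 mulrA.
apply: (@cder_mvt r (fun y => f' y - f' z - f'' z * (y - z))) => t t01.
have hd' := normc_segment yd t01.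
have [h1 h3] := hd _ hd'; split.
  set x := z + _ * _ in h1 *.
  have k1 := cderB (cder_id x) (cder_cst z x).
  have k2 := cderM (cder_cst (f' z) x) k1.
  have k3 := cderM (cder_cst (f'' z / 2) x) (cderM k1 k1).
  have := cderB (cderB h1 k2) k3.
  have -> : f' x - f' z - f'' z * (x - z) = f' x - (0 * (x - z) + f' z * (1 - 0)) -
    (0 * ((x - z) * (x - z)) + f'' z / 2 * ((1 - 0) * (x - z) + (x - z) * (1 - 0))).
    by field.
  by apply: cder_near; near=> w; rewrite /r expr2.
apply: le_trans h3 _; rewrite ler_wpM2l ?(ltW e0)//.
rewrite addrC addKr normcM normc_real.
by case/andP: t01 => t0 t1; rewrite ger0_norm// ler_piMl// normc_ge0.
Unshelve. all: by end_near. Qed.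

Lemma ccont_bounded f z : ccont f z -> \forall y \near (z : C^o), normc (f y) <= normc (f z) + 1.
Proof.
move=> /climP /(_ 1 ltr01); apply: filterS => y /ltW h.
by rewrite -lerBlDl; apply: le_trans h; exact: ler_distc.
Qed.

Lemma Cn_lip n f z : Cn n.+1 f z -> exists2 L : R, 0 < L &
  exists2 d : R, 0 < d & forall x y, normc (x - z) < d -> normc (y - z) < d ->
    normc (f x - f y) <= L * normc (x - y).
Proof.
move=> [f' [hf hf']].
have cb := ccont_bounded (Cn_ccont hf').
have [d d0 hd] := (nbhsC _ _).1 (filterI hf cb).
exists (normc (f' z) + 1); first by rewrite ltr_wpDl ?normc_ge0.
exists d => // x y xd yd; apply: (@cder_mvt f f') => t t01.
by have [] := hd _ (normc_segment2 yd xd t01).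
Qed.

(** A symmetric, division-free form of: the second divided difference of [f]
    at [z0, z, y] is bounded near [z0]. *)
Lemma Cn_divdiff2 f z0 : Cn 2 f z0 -> exists2 M : R, 0 < M & exists c, exists2 d : R, 0 < d &
  [/\ cder f z0 c,
   (forall z, normc (z - z0) < d ->
      normc (f z - f z0 - c * (z - z0)) <= M * normc (z - z0) ^+ 2) &
   (forall z y, normc (z - z0) < d -> normc (y - z0) < d ->
    normc ((f z - f z0 - c * (z - z0)) * (y - z0) - (f y - f z0 - c * (y - z0)) * (z - z0))
     <= M * (normc (z - z0) * normc (y - z0) * normc (z - y)))].
Proof.
move=> [f' [hf hf2]].
have [L L0 [d1 d10 hL]] := @Cn_lip 0 f' z0 hf2.
have [d2 d20 hd2] := (nbhsC _ _).1 hf.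
pose d := Num.min d1 d2.
have dd1 z : normc (z - z0) < d -> normc (z - z0) < d1 by rewrite /d lt_min => /andP[].
have dd2 z : normc (z - z0) < d -> normc (z - z0) < d2 by rewrite /d lt_min => /andP[].
pose r z := f z - f z0 - f' z0 * (z - z0).
pose r' z := f' z - f' z0.
have hr z : normc (z - z0) < d -> cder r z (r' z).
  move=> zd; have h1 := hd2 z (dd2 _ zd).
  have k2 := cderM (cder_cst (f' z0) z) (cderB (cder_id z) (cder_cst z0 z)).
  have := cderB (cderB h1 (cder_cst (f z0) z)) k2.
  by have -> : r' z = f' z - 0 - (0 * (z - z0) + f' z0 * (1 - 0)); rewrite // /r'; ring.
have hr' z : normc (z - z0) < d -> normc (r' z) <= L * normc (z - z0).
  by move=> zd; apply: hL; rewrite ?subrr ?normc0 ?dd1.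
have hr2 z : normc (z - z0) < d -> normc (r z) <= L * normc (z - z0) ^+ 2.
  move=> zd; have := @cder_mvt r r' z0 z (L * normc (z - z0)).
  rewrite [r z0](_ : _ = 0) ?subr0; last by rewrite /r !subrr mulr0 subr0.
  rewrite -mulrA -expr2; apply=> t t01; have zd' := normc_segment zd t01.
  split; first exact: hr.
  apply: le_trans (hr' _ zd') _; rewrite ler_wpM2l ?(ltW L0)//.
  rewrite addrC addKr normcM normc_real.
  by case/andP: t01 => t0 t1; rewrite ger0_norm// ler_piMl// normc_ge0.
have hr3 z y (m : R) : normc (z - z0) < d -> normc (y - z0) < d ->
    normc (z - z0) <= m -> normc (y - z0) <= m ->
    normc (r z - r y) <= L * m * normc (z - y).
  move=> zd yd zm ym; apply: (@cder_mvt r r') => t t01.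
  have xd := normc_segment2 yd zd t01.
  split; first exact: hr.
  apply: le_trans (hr' _ xd) _; rewrite ler_wpM2l ?(ltW L0)//.
  exact: normc_segment2_le.
have d0 : 0 < d by rewrite /d lt_min d10.
exists (4 * L); first by rewrite mulr_gt0.
exists (f' z0), d => //; split.
- by apply: hd2; rewrite subrr normc0.
- move=> z zd; apply: le_trans (hr2 _ zd) _; rewrite ler_wpM2r ?exprn_ge0 ?normc_ge0//; lra.
- suff main z y : normc (z - z0) < d -> normc (y - z0) < d ->
      normc (y - z0) <= normc (z - z0) ->
      normc (r z * (y - z0) - r y * (z - z0))
      <= 4 * L * (normc (z - z0) * normc (y - z0) * normc (z - y)).
    move=> z y zd yd; have [le|/ltW le] := lerP (normc (y - z0)) (normc (z - z0)).
      exact: main.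
    have -> : forall u v w x : C, u * v - w * x = - (w * x - u * v) by move=> *; ring.
    rewrite normcN; apply: le_trans (main y z yd zd le) _.
    by rewrite (normcB y z) le_eqVlt; apply/orP; left; apply/eqP; ring.
  move=> zd yd le.
  have rz := hr2 _ zd; have ry := hr2 _ yd.
  have rzy := hr3 z y _ zd yd (lexx _) le.
  have n0 := normc_ge0 (y - z0); have n1 := normc_ge0 (z - y).
  have nz0 := normc_ge0 (z - z0).
  have tri : normc (z - z0) <= normc (z - y) + normc (y - z0).
    by rewrite -{1}(subrK y z) -addrA le_normcD.
  have -> : r z * (y - z0) - r y * (z - z0) = (r z - r y) * (y - z0) - r y * (z - y).
    by ring.
  apply: le_trans (ler_normcB _ _) _; rewrite !normcM.
  have k1 : normc (r z - r y) * normc (y - z0) <=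
     L * (normc (z - z0) * normc (y - z0) * normc (z - y)).
    rewrite [X in _ <= X](_ : _ = L * normc (z - z0) * normc (z - y) * normc (y - z0)); last by ring.
    by rewrite ler_wpM2r.
  have k2 : normc (r y) * normc (z - y) <=
     L * (normc (z - z0) * normc (y - z0) * normc (z - y)).
    rewrite !mulrA ler_wpM2r//; apply: le_trans ry _.
    by rewrite expr2 mulrA ler_wpM2r// ler_wpM2l// ltW.
  have : 0 <= L * (normc (z - z0) * normc (y - z0) * normc (z - y)).
    by rewrite mulr_ge0 ?(ltW L0)// !mulr_ge0.
  lra.
Qed.

(** The error of the linear approximation in [z] of the difference quotient
    [(f z - f y) / (z - y)], where [rz] and [ry] are the second order remainders
    of [f] at [z0]. For [y] within the distance [rho] of [z0] the bound is a multiple of a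
    Poisson kernel, the integral of which does not depend on [rho]; for the
    other [y] it is of second order in [z - z0]. *)
Lemma divdiff_near (z z0 y rz ry : C) (M rho : R) : 0 < M -> 0 < rho ->
  z0 - y != 0 -> z - y != 0 -> normc (y - z0) < rho ->
  normc (rz * (y - z0) - ry * (z - z0)) <=
    M * (normc (z - z0) * normc (y - z0) * normc (z - y)) ->
  normc ry <= M * normc (y - z0) ^+ 2 ->
  normc ((rz * (z0 - y) ^+ 2 - ry * (z - z0) ^+ 2) / ((z0 - y) ^+ 2 * (z - y))) <=
    2 * M * normc (z - z0) * (2 * rho) * (rho / (normc (y - z0) ^+ 2 + rho ^+ 2)).
Proof.
move=> M0 rho0 y0 y1 yr k1 k2; have h0 := normc_ge0 (z - z0).
have yz0 : 0 < normc (z0 - y) by rewrite normc_gt0.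
have yz1 : 0 < normc (z - y) by rewrite normc_gt0.
rewrite normcM normcV normcM normcX ler_pdivrMr ?mulr_gt0 ?exprn_gt0//.
have -> : rz * (z0 - y) ^+ 2 - ry * (z - z0) ^+ 2 =
  (y - z0) * (rz * (y - z0) - ry * (z - z0)) - ry * (z - z0) * (z - y) by ring.
rewrite (normcB z0 y) in yz0 *.
set n := normc (y - z0) in k1 k2 yz0 yr *; set m := normc (z - y) in k1 yz1 *.
set h := normc (z - z0) in k1 h0 *.
apply: (@le_trans _ _ (2 * M * h * (n ^+ 2 * m))).
  apply: le_trans (ler_normcB _ _) _; rewrite !normcM -/n -/m -/h.
  have t1 : n * normc (rz * (y - z0) - ry * (z - z0)) <= n * (M * (h * n * m)).
    by rewrite ler_wpM2l ?(ltW yz0).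
  have t2 : normc ry * h * m <= M * n ^+ 2 * h * m.
    by rewrite ler_wpM2r ?(ltW yz1)// ler_wpM2r.
  by rewrite expr2 in t2 *; clear -t1 t2; lra.
rewrite ler_wpM2r ?mulr_ge0 ?exprn_ge0 ?(ltW yz0) ?(ltW yz1)//.
rewrite -[leLHS]mulr1 -[leRHS]mulrA ler_wpM2l ?mulr_ge0 ?(ltW M0)//.
rewrite mulrA ler_pdivlMr; last by rewrite addr_gt0// exprn_gt0.
have : n ^+ 2 < rho ^+ 2 by rewrite ltr_sqr ?nnegrE ?(ltW yz0) ?(ltW rho0).
rewrite !expr2; clear; lra.
Qed.

Lemma divdiff_far (z z0 y rz ry : C) (M K rho : R) : 0 < M -> 0 <= K -> 0 < rho ->
  z0 - y != 0 -> z - y != 0 -> rho <= normc (y - z0) -> normc (z - z0) < rho / 2 ->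
  normc rz <= M * normc (z - z0) ^+ 2 -> normc ry <= K ->
  normc ((rz * (z0 - y) ^+ 2 - ry * (z - z0) ^+ 2) / ((z0 - y) ^+ 2 * (z - y))) <=
    (M * 2 / rho + K * 2 / rho ^+ 3) * normc (z - z0) ^+ 2.
Proof.
move=> M0 K0 rho0 y0 y1 yr zr k1 k2; have h0 := normc_ge0 (z - z0).
have yz0 : 0 < normc (z0 - y) by rewrite normc_gt0.
have yz1 : 0 < normc (z - y) by rewrite normc_gt0.
rewrite (normcB y z0) in yr.
have zy : rho / 2 <= normc (z - y).
  have := normc_tri z0 z y; rewrite (normcB z0 z); clear -yr zr; lra.
have -> : (rz * (z0 - y) ^+ 2 - ry * (z - z0) ^+ 2) / ((z0 - y) ^+ 2 * (z - y)) =
   rz / (z - y) - ry * (z - z0) ^+ 2 / ((z0 - y) ^+ 2 * (z - y)).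
  by field; rewrite y0 y1.
apply: le_trans (ler_normcB _ _) _; rewrite [leRHS]mulrDl lerD//.
  rewrite normcM normcV ler_pdivrMr//; apply: le_trans k1 _.
  have t : 1 <= 2 / rho * normc (z - y).
    by rewrite mulrAC ler_pdivlMr// mul1r; clear -zy; lra.
  have := ler_wpM2l (mulr_ge0 (ltW M0) (exprn_ge0 2 h0)) t; rewrite mulr1; clear; lra.
rewrite normcM normcV normcM normcX normcM normcX ler_pdivrMr ?mulr_gt0 ?exprn_gt0//.
have t1 : rho ^+ 3 / 2 <= normc (z0 - y) ^+ 2 * normc (z - y).
  rewrite exprSr -mulrA ler_pM ?exprn_ge0 ?divr_ge0 ?(ltW rho0)//.
  by rewrite ler_sqr ?nnegrE ?(ltW rho0)// ?(ltW yz0).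
have t2 : 1 <= 2 / rho ^+ 3 * (normc (z0 - y) ^+ 2 * normc (z - y)).
  by rewrite mulrAC ler_pdivlMr ?exprn_gt0// mul1r; clear -t1; lra.
have t3 : normc ry * normc (z - z0) ^+ 2 <= K * normc (z - z0) ^+ 2.
  by rewrite ler_wpM2r ?exprn_ge0.
apply: le_trans t3 _.
have := ler_wpM2l (mulr_ge0 K0 (exprn_ge0 2 h0)) t2; rewrite mulr1; clear; lra.
Qed.

End Smooth.

(** * Exponential, logarithm and principal powers *)

HB.lock Definition cexp {R : realType} (z : R[i]) : R[i] :=
  (expR (complex.Re z))%:C * (cos (complex.Im z) +i* sin (complex.Im z)).

Section ExpLog.
Variable R : realType.
Local Notation C := R[i].
Local Notation Re := (@complex.Re R).
Local Notation Im := (@complex.Im R).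
Implicit Types (z w : C).

Lemma Re_cexp z : Re (cexp z) = expR (Re z) * cos (Im z).
Proof. by rewrite cexp.unlock ReC_mul. Qed.
Lemma Im_cexp z : Im (cexp z) = expR (Re z) * sin (Im z).
Proof. by rewrite cexp.unlock ImC_mul. Qed.

Lemma cexpD z w : cexp (z + w) = cexp z * cexp w.
Proof.
by apply: complexP; rewrite !ReImE !(Re_cexp, Im_cexp) ReD ImD expRD (cosD, sinD);
   ring.
Qed.

Lemma cexp_real (x : R) : cexp x%:C = (expR x)%:C.
Proof.
by apply: complexP; rewrite (Re_cexp, Im_cexp) !ReImE ?cos0 ?sin0 ?mulr1 ?mulr0.
Qed.

Lemma cexp0 : cexp (0 : C) = 1.
Proof. by rewrite -[X in cexp X]/(0%:C) cexp_real expR0. Qed.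

Lemma cexpN z : cexp (- z) = (cexp z)^-1.
Proof.
have h : cexp z * cexp (- z) = 1 by rewrite -cexpD subrr cexp0.
have z0 : cexp z != 0.
  by apply/eqP => z0; move: h; rewrite z0 mul0r => /eqP; rewrite eq_sym oner_eq0.
by apply: (mulfI z0); rewrite h divff.
Qed.

Lemma normc_cexp z : normc (cexp z) = expR (Re z).
Proof.
apply/eqP; rewrite -(@eqrXn2 _ 2)// ?normc_ge0 ?expR_ge0//; apply/eqP.
by rewrite sqr_normcE Re_cexp Im_cexp !exprMn -mulrDr cos2Dsin2 mulr1.
Qed.

Lemma cexp_neq0 z : cexp z != 0.
Proof. by rewrite -normc_gt0 normc_cexp expR_gt0. Qed.

Lemma real_slope (p : R -> R) (t c : R) : is_derive t 1 p c ->
  exists q : R -> R, [/\ forall s, p s = p t + q s * (s - t),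
    q @ t --> c & q t = c].
Proof.
move=> /rder_real[q [hq cq qc]]; exists (fun s => Re (q s)); split.
- move=> s; have := congr1 Re (hq s).
  by rewrite ReD ReM !ReC ImC mulr0 subr0.
- have h : (fun s => Re (q s)) @ t --> Re (q t) by exact: clim_Re cq.
  by rewrite qc in h.
- by rewrite qc.
Qed.

Lemma cder_slope f (q : C -> C) z : (\forall y \near (z : C^o), f y = f z + q y * (y - z)) ->
  ccont q z -> cder f z (q z).
Proof.
move=> hq cq; exists (fun y => if y == z then q z else (f y - f z) / (y - z)).
split; last by rewrite eqxx.
- move=> y; case: eqP => [->|/eqP yz]; first by rewrite subrr mulr0 addr0.
  by rewrite mulfVK ?subr_eq0// addrC subrK.
- apply: ccont_near cq; apply: filterS hq => y hy; case: eqP => [->//|/eqP yz].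
  by rewrite hy; field; rewrite subr_eq0.
Qed.

Lemma cder_cexp0 : cder (@cexp R) 0 1.
Proof.
have [qe [he ce qe0]] := real_slope (is_derive_expR (0 : R)).
have [qc [hc cc qc0]] := real_slope (is_derive_cos (0 : R)).
have [qs [hs cs qs0]] := real_slope (is_derive_sin (0 : R)).
rewrite expR0 in he ce qe0; rewrite sin0 oppr0 in hc cc qc0.
rewrite cos0 sin0 in hs cs qs0; rewrite cos0 in hc.
pose rem z : C := (Re z)%:C * ((qe (Re z) - 1)%:C) +
  (Im z)%:C * ((expR (Re z))%:C * ((qc (Im z))%:C + 'i * (qs (Im z))%:C) - 'i).
have remE z : cexp z = 1 + z + rem z.
  have h1 := he (Re z); have h2 := hc (Im z); have h3 := hs (Im z).
  rewrite !subr0 add0r in h1 h2 h3.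
  apply: complexP; rewrite ?Re_cexp ?Im_cexp /rem !ReImE ?h2 ?h3; last by ring.
  by rewrite h1; ring.
apply/cder_eps => e e0.
have lim : clim (nbhs (0 : C^o)) (fun z => (normc ((qe (Re z) - 1)%:C : C) +
   normc ((expR (Re z))%:C * ((qc (Im z))%:C + 'i * (qs (Im z))%:C) - 'i : C))%:C) 0.
  have cRe : (fun z : C^o => Re z) @ (0 : C^o) --> (0 : R) by exact: clim_Re (ccont_id 0).
  have cIm : (fun z : C^o => Im z) @ (0 : C^o) --> (0 : R) by exact: clim_Im (ccont_id 0).
  have k1 : clim (nbhs (0 : C^o)) (fun z => (qe (Re z) - 1)%:C) (1 - 1)%:C.
    apply: clim_real; apply: cvgB; last exact: cvg_cst.
    exact: (@cvg_comp _ _ _ (fun z : C^o => Re z) qe _ _ _ cRe ce).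
  have k2 : clim (nbhs (0 : C^o)) (fun z => (expR (Re z))%:C) (expR 0)%:C.
    apply: clim_real.
    exact: (@cvg_comp _ _ _ (fun z : C^o => Re z) expR _ _ _ cRe (@continuous_expR R 0)).
  have k3 : clim (nbhs (0 : C^o)) (fun z => (qc (Im z))%:C) 0%:C.
    apply: clim_real.
    exact: (@cvg_comp _ _ _ (fun z : C^o => Im z) qc _ _ _ cIm cc).
  have k4 : clim (nbhs (0 : C^o)) (fun z => (qs (Im z))%:C) 1%:C.
    apply: clim_real.
    exact: (@cvg_comp _ _ _ (fun z : C^o => Im z) qs _ _ _ cIm cs).
  have k5 : clim (nbhs (0 : C^o)) (fun z => (expR (Re z))%:C *
     ((qc (Im z))%:C + 'i * (qs (Im z))%:C) - 'i) ((expR 0)%:C * (0%:C + 'i * 1%:C) - 'i).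
    apply: climB; last exact: clim_cst.
    by apply: climM => //; apply: climD => //; apply: climM => //; exact: clim_cst.
  rewrite -[X in clim _ _ X]/(0%:C); apply: clim_real.
  have -> : (0 : R) = normc ((1 - 1)%:C : C) +
      normc ((expR 0)%:C * (0%:C + 'i * 1%:C) - 'i : C).
    by rewrite expR0 subrr rmorph1 rmorph0 mulr1 mul1r add0r subrr normc0 addr0.
  by apply: cvgD; [exact: clim_normc k1|exact: clim_normc k5].
move/climP/(_ e e0) : lim; apply: filterS => z.
rewrite subr0 [X in X < _ -> _]normc_real => hz.
rewrite ![z - 0]subr0 (_ : cexp z - _ - _ = rem z); last by rewrite remE cexp0; ring.
apply: le_trans (le_normcD _ _) _; rewrite !normcM.
apply: (@le_trans _ _ (normc z * (normc ((qe (Re z) - 1)%:C : C) +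
   normc ((expR (Re z))%:C * ((qc (Im z))%:C + 'i * (qs (Im z))%:C) - 'i : C)))).
  rewrite [X in _ <= X]mulrDr !normc_real; apply: lerD; apply: ler_wpM2r; rewrite ?normr_ge0 ?normc_ge0//.
    exact: normc_Re.
  exact: normc_Im.
rewrite mulrC ler_wpM2r ?normc_ge0//.
by apply: le_trans (ltW hz); exact: ler_norm.
Qed.

Lemma cder_cexp z : cder cexp z (cexp z).
Proof.
have h0 := cder_cexp0; rewrite -(subrr z) in h0.
have h1 := cder_comp (cderB (cder_id z) (cder_cst z z)) h0.
have := cderM (cder_cst (cexp z) z) h1.
rewrite mul0r add0r subr0 !mulr1; apply: cder_near; near=> y.
by rewrite -cexpD addrC subrK.
Unshelve. all: by end_near. Qed.

Lemma Cn_cexp n z : Cn n cexp z.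
Proof.
elim: n => [|n ih]; first exact: cder_ccont (cder_cexp z).
by exists cexp; split => //; near=> y; exact: cder_cexp.
Unshelve. all: by end_near. Qed.

(** The half-angle formula is smooth on the whole cut plane. *)
Definition Arg z : R := 2 * atan (Im z / (Re z + normc z)).

Definition Log z : C := ln (normc z) +i* Arg z.

(** The plane cut along the closed negative half-axis. *)
Definition slit z := 0 < Re z + normc z.

Lemma slitP z : slit z <-> Im z <> 0 \/ 0 < Re z.
Proof.
rewrite /slit; split => [h|[h|h]].
- have [h0|h0] := eqVneq (Im z) 0; last by left; exact/eqP.
  right; rewrite ltNge; apply/negP => hr; move: h.
  have -> : normc z = - Re z; last by rewrite subrr ltxx.
  apply/eqP; rewrite -(@eqrXn2 _ 2)// ?normc_ge0 ?oppr_ge0//.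
  by rewrite sqr_normcE h0 expr0n/= addr0 sqrrN.
- have : `|Re z| < normc z.
    rewrite -ltr_sqr ?nnegrE ?normc_ge0// sqr_normcE real_normK ?num_real// ltrDl.
    by rewrite lt0r sqr_ge0 andbT sqrf_eq0; exact/eqP.
  by rewrite ltr_norml => /andP[]; lra.
- by have := normc_ge0 z; lra.
Qed.

Lemma slit_neq0 z : slit z -> z != 0.
Proof. by move=> h; apply/eqP => z0; move: h; rewrite /slit z0 normc0 addr0 ltxx. Qed.

Lemma slit_normc z : slit z -> 0 < normc z.
Proof. by move/slit_neq0; rewrite normc_gt0. Qed.

Lemma slit_real (x : R) : 0 < x -> slit x%:C.
Proof. by move=> x0; apply/slitP; right. Qed.

Lemma cos_sin_Arg z : slit z ->
  cos (Arg z) = Re z / normc z /\ sin (Arg z) = Im z / normc z.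
Proof.
move=> zs; have n0 := slit_normc zs; have d0 : 0 < Re z + normc z := zs.
set n := normc z in n0 d0 *.
have hn : n ^+ 2 = Re z ^+ 2 + Im z ^+ 2 by rewrite sqr_normcE.
have n0' : n != 0 by rewrite gt_eqF.
have d0' : Re z + n != 0 by rewrite gt_eqF.
rewrite /Arg -/n; set t := Im z / (Re z + n).
have t2 : 1 + t ^+ 2 = 2 * n / (Re z + n).
  have hIm : Im z ^+ 2 = n ^+ 2 - Re z ^+ 2 by rewrite hn; ring.
  by rewrite /t expr_div_n hIm; field.
have c2 : cos (atan t) ^+ 2 = (Re z + n) / (2 * n).
  rewrite cos_atan exprVn sqr_sqrtr ?addr_ge0 ?sqr_ge0// t2.
  by rewrite invf_div.
have cn0 : cos (atan t) != 0.
  apply/eqP => c0; move: c2; rewrite c0 expr0n/= => /esym/eqP.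
  by rewrite mulf_eq0 invr_eq0 mulf_eq0 (negPf d0') (negPf n0') pnatr_eq0.
have sE : sin (atan t) = t * cos (atan t).
  by rewrite -{2}(atanK t) /tan mulfVK.
rewrite mulr_natl; split.
  by rewrite cos_mulr2n c2 -mulr_natl; field.
rewrite sin_mulr2n sE mulrCA -expr2 c2 -mulr_natl /t.
by field; rewrite d0' n0'.
Qed.

Lemma LogK z : slit z -> cexp (Log z) = z.
Proof.
move=> zs; have [hc hs] := cos_sin_Arg zs; have n0 := slit_normc zs.
apply: complexP; rewrite ?Re_cexp ?Im_cexp /= lnK ?posrE// ?hc ?hs.
  by rewrite mulrC divfK// gt_eqF.
by rewrite mulrC divfK// gt_eqF.
Qed.

Lemma Arg_bounds z : - pi < Arg z < pi.
Proof.
have := atan_gtNpi2 (Im z / (Re z + normc z)).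
have := atan_ltpi2 (Im z / (Re z + normc z)).
by rewrite /Arg; lra.
Qed.

Lemma atan_gt0 (x : R) : 0 < x -> 0 < atan x.
Proof. by move=> x0; rewrite -(@atan0 R) lt_atan. Qed.

Lemma Arg_gt0 z : 0 < Im z -> 0 < Arg z.
Proof.
move=> h; have zs : slit z by apply/slitP; left; apply/eqP; rewrite gt_eqF.
by rewrite /Arg mulr_gt0// atan_gt0// divr_gt0.
Qed.

Lemma ArgJ z : Arg (conjc z) = - Arg z.
Proof. by rewrite /Arg ReJ ImJ normc_conj mulNr atanN mulrN. Qed.

Lemma Arg_lt0 z : Im z < 0 -> Arg z < 0.
Proof.
by move=> h; have := @Arg_gt0 (conjc z); rewrite ImJ ArgJ !oppr_gt0; exact.
Qed.

Lemma Arg_real (x : R) : Arg x%:C = 0.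
Proof. by rewrite /Arg mul0r atan0 mulr0. Qed.

Lemma Log_real (x : R) : 0 < x -> Log x%:C = (ln x)%:C.
Proof. by move=> x0; rewrite /Log Arg_real normc_real gtr0_norm. Qed.

Lemma cexpK w : - pi < Im w < pi -> slit (cexp w) /\ Log (cexp w) = w.
Proof.
move=> /andP[w1 w2].
set h := Im w / 2.
have h1 : - (pi / 2) < h by rewrite /h; lra.
have h2 : h < pi / 2 by rewrite /h; lra.
have ch : 0 < cos h by apply: cos_gt0_pihalf; rewrite h1.
have wE : Im w = h *+ 2 by rewrite /h -mulr_natr divfK// pnatr_eq0.
have cE : 1 + cos (Im w) = 2 * cos h ^+ 2 by rewrite wE cos_mulr2n; ring.
have ch2 : 0 < cos h ^+ 2 by rewrite exprn_gt0.
have e0 := expR_gt0 (Re w).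
have dE : Re (cexp w) + normc (cexp w) = expR (Re w) * (2 * cos h ^+ 2).
  by rewrite Re_cexp normc_cexp -cE; ring.
split; first by rewrite /slit dE !mulr_gt0.
apply: complexP => /=; first by rewrite normc_cexp expRK.
rewrite /Arg dE Im_cexp wE sin_mulr2n.
have -> : expR (Re w) * ((cos h * sin h) *+ 2) / (expR (Re w) * (2 * cos h ^+ 2)) = tan h.
  by rewrite /tan -mulr_natl; field; rewrite !gt_eqF.
by rewrite tanK ?mulr_natl// in_itv/= h1.
Qed.

Lemma Log_uniq z w : - pi < Im w < pi -> cexp w = z -> Log z = w.
Proof. by move=> /cexpK[_ h] <-. Qed.

Lemma ccont_Log z : slit z -> ccont Log z.
Proof.
move=> zs; have n0 := slit_normc zs.
have cn : (fun y : C^o => normc y) @ (z : C^o) --> normc z by exact: clim_normc (ccont_id z).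
have cr : (fun y : C^o => Re y) @ (z : C^o) --> Re z by exact: clim_Re (ccont_id z).
have ci : (fun y : C^o => Im y) @ (z : C^o) --> Im z by exact: clim_Im (ccont_id z).
apply: clim_ReIm => /=.
  exact: (@cvg_comp _ _ _ (fun y : C^o => normc y) (@ln R) _ _ _ cn (continuous_ln n0)).
rewrite /Arg; apply: cvgM; first exact: cvg_cst.
apply: (@cvg_comp _ _ _ (fun y : C^o => Im y / (Re y + normc y)) (@atan R)); last exact: continuous_atan.
by apply: cvgM => //; apply: cvgV; [rewrite gt_eqF//|apply: cvgD].
Qed.

Lemma slit_near z : slit z -> \forall y \near (z : C^o), slit y.
Proof.
move=> zs.
have cn : (fun y : C^o => normc y) @ (z : C^o) --> normc z by exact: clim_normc (ccont_id z).
have cr : (fun y : C^o => Re y) @ (z : C^o) --> Re z by exact: clim_Re (ccont_id z).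
have {}cn : (fun y : C^o => Re y + normc y) @ (z : C^o) --> Re z + normc z by apply: (cvgD cr cn).
exact: (cvgr_gt (Re z + normc z) cn).
Qed.

Lemma ccont_neq0 f z : ccont f z -> f z != 0 -> \forall y \near (z : C^o), f y != 0.
Proof.
move=> /climP h fz; have := h (normc (f z)); rewrite normc_gt0 => /(_ fz).
apply: filterS => y hy; apply/eqP => y0.
by move: hy; rewrite y0 sub0r normcN ltxx.
Qed.

(** A continuous local inverse of a function with nonzero derivative is
    differentiable. *)
Lemma cder_inverse (f g : C -> C) z c : ccont g z -> cder f (g z) c -> c != 0 ->
  (\forall y \near (z : C^o), f (g y) = y) -> cder g z c^-1.
Proof.
move=> cg [q [hq cq qc]] c0 fg.
have fgz : f (g z) = z := nbhs_singleton fg.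
have cqg : ccont (fun y => q (g y)) z by exact: ccont_comp.
have qn0 : q (g z) != 0 by rewrite qc.
rewrite -qc; apply: (@cder_slope g (fun y => (q (g y))^-1)); last exact: ccontV.
have near0 : \forall y \near (z : C^o), q (g y) != 0.
  exact: (ccont_neq0 cqg).
apply: filterS2 fg near0 => y hy qy0.
rewrite -[in y - z]hy -[in X in _ - X]fgz (hq (g y)) [in f _ + _]addrC addrK.
by rewrite mulKf// addrC subrK.
Qed.

Lemma cder_Log z : slit z -> cder Log z z^-1.
Proof.
move=> zs; have := @cder_inverse cexp Log z (cexp (Log z)) (ccont_Log zs) (cder_cexp _) (cexp_neq0 _).
rewrite LogK//; apply; apply: filterS (slit_near zs) => y; exact: LogK.
Qed.

Lemma Cn_Log n z : slit z -> Cn n Log z.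
Proof.
case: n => [|n] zs; first exact: ccont_Log.
exists (fun y => y^-1); split; last by apply: Cn_inv0; exact: slit_neq0.
by apply: filterS (slit_near zs) => y; exact: cder_Log.
Qed.

Definition cpow z (c : R) := cexp (c%:C * Log z).

Lemma Cn_cpow n c z : slit z -> Cn n (fun y => cpow y c) z.
Proof.
move=> zs; apply: Cn_comp; last exact: Cn_cexp.
by apply: CnM; [exact: Cn_cst|exact: Cn_Log].
Qed.

Lemma cpow_real (x c : R) : 0 < x -> cpow x%:C c = (x `^ c)%:C.
Proof.
by move=> x0; rewrite /cpow Log_real// -rmorphM cexp_real /powR gt_eqF.
Qed.

Lemma normc_cpow z c : slit z -> normc (cpow z c) = normc z `^ c.
Proof.
by move=> zs; rewrite normc_cexp ReC_mul /= /powR gt_eqF// slit_normc.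
Qed.

Lemma Re_cpow z c : slit z -> Re (cpow z c) = normc z `^ c * cos (c * Arg z).
Proof.
by move=> zs; rewrite -normc_cpow// Re_cexp normc_cexp ImC_mul.
Qed.

Lemma Im_cpow z c : slit z -> Im (cpow z c) = normc z `^ c * sin (c * Arg z).
Proof.
by move=> zs; rewrite -normc_cpow// Im_cexp normc_cexp ImC_mul.
Qed.

Lemma cpowD z c d : cpow z (c + d) = cpow z c * cpow z d.
Proof. by rewrite /cpow -cexpD rmorphD mulrDl. Qed.

Lemma cpow1 z : slit z -> cpow z 1 = z.
Proof. by move=> zs; rewrite /cpow rmorph1 mul1r LogK. Qed.

Lemma cpowN z c : cpow z (- c) = (cpow z c)^-1.
Proof. by rewrite /cpow -cexpN rmorphN mulNr. Qed.

Lemma cpowN1 z : slit z -> cpow z (-1) = z^-1.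
Proof. by move=> zs; rewrite cpowN cpow1. Qed.

Definition csqrt z := cpow z 2^-1.

Lemma sqr_csqrt z : slit z -> csqrt z ^+ 2 = z.
Proof.
move=> zs; rewrite expr2 -cpowD (_ : 2^-1 + 2^-1 = 1) ?cpow1//; lra.
Qed.

Lemma Re_csqrt_gt0 z : slit z -> 0 < Re (csqrt z).
Proof.
move=> zs; rewrite Re_cpow// mulr_gt0 ?powR_gt0 ?slit_normc//.
by apply: cos_gt0_pihalf; have := Arg_bounds z; lra.
Qed.

Lemma normc_csqrt2 z : slit z -> normc (csqrt z) ^+ 2 = normc z.
Proof. by move=> zs; rewrite -normcX sqr_csqrt. Qed.

Lemma cexp_ipi : @cexp R ('i * pi%:C) = -1.
Proof.
apply: complexP; rewrite ?Re_cexp ?Im_cexp !ReImE !(mul0r, mulr0, mul1r, mulr1, add0r, addr0, subr0) ?expR0 ?cospi ?sinpi; lra.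
Qed.

Lemma LogN_pos z : 0 < Im z -> Log (- z) = Log z - 'i * pi%:C.
Proof.
move=> h; have zs : slit z by apply/slitP; left; apply/eqP; rewrite gt_eqF.
apply: Log_uniq.
  rewrite !ReImE /= !(mul0r, mulr0, mul1r, mulr1, add0r, addr0, subr0).
  by have := Arg_bounds z; have := Arg_gt0 h; have := @pi_gt0 R; lra.
by rewrite cexpD cexpN cexp_ipi LogK// invrN1 mulrN1.
Qed.

Lemma LogN_neg z : Im z < 0 -> Log (- z) = Log z + 'i * pi%:C.
Proof.
move=> h; have := @LogN_pos (- z); rewrite ImN oppr_gt0 opprK => /(_ h) ->.
by rewrite subrK.
Qed.

Lemma Arg_le z (a : R) : 0 < Im z -> 0 <= a -> Arg z <= Arg (z - a%:C).
Proof.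
move=> h a0; rewrite /Arg ler_pM2l//.
have e1 : Im (z - a%:C) = Im z by rewrite !ReImE subr0.
have e2 : Re (z - a%:C) = Re z - a by rewrite !ReImE.
have zs : slit z by apply/slitP; left; apply/eqP; rewrite gt_eqF.
have zas : slit (z - a%:C) by apply/slitP; left; apply/eqP; rewrite e1 gt_eqF.
apply: le_atan; rewrite e1 ler_pM2l// lef_pV2 ?posrE//.
rewrite e2; have := ler_normcB z a%:C; rewrite normc_real ger0_norm//; lra.
Qed.

Lemma cos_ge_half (x : R) : - (pi / 4) <= x <= pi / 4 -> 2^-1 <= cos x.
Proof.
move=> /andP[x1 x2]; have pi0 := @pi_gt0 R.
have k0 : 0 <= cos x by apply: cos_ge0_pihalf; apply/andP; lra.
have : 0 <= cos (x *+ 2) by apply: cos_ge0_pihalf; apply/andP; rewrite (mulr2n x); lra.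
rewrite cos_mulr2n => k4.
by rewrite -ler_sqr ?nnegrE// expr2; move: k4; rewrite -mulr_natr; lra.
Qed.

Lemma normc_ipi : normc ('i * pi%:C : C) = pi.
Proof. by rewrite normcM normc_i normc_real mul1r gtr0_norm// pi_gt0. Qed.

Lemma normc2 : normc (2 : C) = 2.
Proof. by rewrite (_ : 2 = 2%:C) ?normc_real ?ger0_norm// rmorph_nat. Qed.

Lemma normc_Log_le z : normc (Log z) <= `|ln (normc z)| + pi.
Proof.
apply: le_trans (normc_leD _) _; rewrite lerD2l /=.
by have /andP[h1 h2] := Arg_bounds z; rewrite ler_norml; apply/andP; lra.
Qed.

End ExpLog.

(** * Maximum and minimum modulus principles *)

Section MaxPrinciple.
Variable R : realType.
Local Notation C := R[i].
Local Notation Re := (@complex.Re R).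
Local Notation Im := (@complex.Im R).
Implicit Types (z w : C).

Lemma bounded_closed_compact (S : set C^o) (M : R) :
  (forall z, S z -> normc z <= M) -> closed S -> compact S.
Proof.
move=> SM cS.
pose K : set (R * R) := `[- M, M] `*` `[- M, M].
pose j (p : R * R) : C^o := p.1 +i* p.2.
have cK : compact K by apply: compact_setX; exact: segment_compact.
have cj : continuous j.
  move=> p; have h : clim (nbhs p) j (j p).
    by apply: clim_ReIm => /=; [exact: cvg_fst|exact: cvg_snd].
  exact: climE h.
have cjK : compact (j @` K).
  by apply: continuous_compact => //; exact: continuous_subspaceT.
apply: (subclosed_compact cS cjK) => z Sz.
exists (Re z, Im z); last by case: z {Sz}.
have := SM z Sz; have := normc_Re z; have := normc_Im z.
rewrite !ler_norml => /andP[? ?] /andP[? ?] ?.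
by split; rewrite /= in_itv /=; apply/andP; split; lra.
Qed.

(** [v] is locally the real part of a twice differentiable function, except
    perhaps on the real axis, where one complex derivative is enough. *)
Definition harmonic_at (v : C -> R) z := exists f : C -> C,
  (\forall y \near (z : C^o), v y = Re (f y)) /\
  (Cn 2 f z \/ Im z = 0 /\ exists c, cder f z c).

Lemma harmonic_at_continuous v z : harmonic_at v z ->
  v @ nbhs (z : C^o) --> v z.
Proof.
move=> [f [vf hf]].
have cf : ccont f z.
  by case: hf => [/Cn_ccont//|[_ [c]]]; exact: cder_ccont.
have h : (fun y : C^o => Re (f y)) @ nbhs (z : C^o) --> Re (f z) by exact: clim_Re cf.
apply/cvgrPdist_lt => e e0; move/cvgrPdist_lt : h => /(_ e e0) h.
apply: (@filterS2 _ (nbhs (z : C^o)) _ _ _ _ _ vf h) => y vy.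
by rewrite vy (nbhs_singleton vf).
Qed.

(** The first term is strictly subharmonic; the second one has a kink across the
    real axis, where functions will only be known to be once differentiable. *)
Definition bump z : R := normc z ^+ 2 + `|Im z|.

Lemma bump_ge0 z : 0 <= bump z.
Proof. by rewrite addr_ge0 ?sqr_ge0. Qed.

Lemma bump_le z (M : R) : normc z <= M -> bump z <= M ^+ 2 + M.
Proof.
move=> zM; have n0 := normc_ge0 z; have := normc_Im z.
have : normc z ^+ 2 <= M ^+ 2 by rewrite ler_sqr ?nnegrE// (le_trans n0).
rewrite /bump; lra.
Qed.

Lemma bump_continuous z : bump @ nbhs (z : C^o) --> bump z.
Proof.
have cn : (fun y : C^o => normc y) @ nbhs (z : C^o) --> normc z by exact: clim_normc (ccont_id z).
have ci : (fun y : C^o => Im y) @ nbhs (z : C^o) --> Im z by exact: clim_Im (ccont_id z).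
by apply: cvgD; [exact: (cvgM cn cn)|exact: cvg_norm].
Qed.

(** At a point of twice differentiability, the values in the directions
    [1], [-1], ['i] and [- 'i] are added: the first and second order terms of a
    harmonic function cancel, and those of [bump] do not. At a
    point of the real axis the kink of [bump] dominates the error of the first
    order expansion in the directions ['i] and [- 'i]. *)
Lemma harmonic_no_min v z (e : R) : 0 < e -> harmonic_at v z ->
  ~ \forall y \near (z : C^o), v z - e * bump z <= v y - e * bump y.
Proof.
move=> e0 [f [vf hf]] mn.
have vz := nbhs_singleton vf.
have e2 : 0 < e / 2 by rewrite divr_gt0.
case: hf => [hf|[Imz [c hc]]].
- have [c1 [c2 [_ ht]]] := Cn_taylor2 hf.
  have [d d0 hd] := (nbhsC _ _).1 (filterI (filterI vf mn) (ht _ e2)).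
  pose t := d / 2; have t0 : 0 < t by rewrite divr_gt0.
  have key (u : C) : normc u = 1 -> Re (f z) - e * bump z <=
      Re (f z) + t * Re (c1 * u) + t ^+ 2 * Re (c2 * u ^+ 2) + e / 2 * t ^+ 2
      - e * bump (z + t%:C * u).
    move=> u1; have yz : (z + t%:C * u) - z = t%:C * u by rewrite addrC addKr.
    have ny : normc (t%:C * u) = t by rewrite normcM u1 normc_real mulr1 gtr0_norm.
    have [] := hd (z + t%:C * u); first by rewrite yz ny /t; lra.
    rewrite yz ny => -[vy my] ty.
    have := le_trans (Re_le_normc _) ty.
    have -> : Re (f (z + t%:C * u) - f z - c1 * (t%:C * u) - c2 * (t%:C * u) ^+ 2) =
      Re (f (z + t%:C * u)) - Re (f z) - t * Re (c1 * u) - t ^+ 2 * Re (c2 * u ^+ 2).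
      by rewrite !expr2 !ReImE; ring.
    move: my; rewrite vy vz; lra.
  have n1 : normc (1 : C) = 1 by exact: normc1.
  have := key 1 n1; have := key (-1); rewrite normcN => /(_ n1).
  have := key 'i (normc_i R); have := key (- 'i); rewrite normcN => /(_ (normc_i R)).
  rewrite /bump !sqr_normcE !expr2 !ReImE.
  rewrite !(mulr0, mulr1, mul0r, mul1r, subr0, addr0, sub0r, add0r, mulrN, oppr0, mulrNN, opprK).
  have t2 : 0 < t * t by rewrite mulr_gt0.
  have := ler_normD (Im z + t) (Im z - t).
  have -> : Im z + t + (Im z - t) = 2 * Im z by ring.
  rewrite normrM (ger0_norm (ler0n _ 2)).
  set n := `|Im z|; set n' := `|Im z + t|; set n'' := `|Im z - t|.
  move=> hn k1 k2 k3 k4.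
  have : e * (n' + n'' - 2 * n) >= 0 by rewrite mulr_ge0 ?(ltW e0)//; lra.
  have : 0 < e * (t * t) by rewrite mulr_gt0.
  lra.
- move/cder_eps/(_ _ e2) : hc => ht.
  have [d d0 hd] := (nbhsC _ _).1 (filterI (filterI vf mn) ht).
  pose t := d / 2; have t0 : 0 < t by rewrite divr_gt0.
  have key (u : C) : normc u = 1 -> Re (f z) - e * bump z <=
      Re (f z) + t * Re (c * u) + e / 2 * t - e * bump (z + t%:C * u).
    move=> u1; have yz : (z + t%:C * u) - z = t%:C * u by rewrite addrC addKr.
    have ny : normc (t%:C * u) = t by rewrite normcM u1 normc_real mulr1 gtr0_norm.
    have [] := hd (z + t%:C * u); first by rewrite yz ny /t; lra.
    rewrite yz ny => -[vy my] ty.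
    have := le_trans (Re_le_normc _) ty.
    have -> : Re (f (z + t%:C * u) - f z - c * (t%:C * u)) =
      Re (f (z + t%:C * u)) - Re (f z) - t * Re (c * u).
      by rewrite !ReImE; ring.
    move: my; rewrite vy vz; lra.
  have := key 'i (normc_i R); have := key (- 'i); rewrite normcN => /(_ (normc_i R)).
  rewrite /bump !sqr_normcE !expr2 !ReImE Imz.
  rewrite !(mulr0, mulr1, mul0r, mul1r, subr0, addr0, sub0r, add0r, mulrN, oppr0, mulrNN, opprK).
  rewrite normrN normr0 (gtr0_norm t0).
  have : 0 < e * (t * t) by rewrite !mulr_gt0.
  have : 0 < e * t by rewrite mulr_gt0.
  lra.
Qed.

(** If [v] had a negative value, [v - e * bump] would attain a minimum for a
    small [e], because the set where [v] is below a negative constant is compact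
    by the boundary hypotheses. *)
Theorem max_principle (U : set C) (v : C -> R) :
  (forall z, U z -> \forall y \near (z : C^o), U y) ->
  (forall z, U z -> harmonic_at v z) ->
  (forall e, ~ U e -> forall eta : R, 0 < eta ->
     \forall y \near (e : C^o), U y -> - eta < v y) ->
  (forall eta : R, 0 < eta -> exists M : R, forall z, U z -> M < normc z -> - eta < v z) ->
  forall z, U z -> 0 <= v z.
Proof.
move=> oU hv bU iU z0 Uz0; rewrite leNgt; apply/negP => vz0.
pose eta := - v z0 / 2.
have eta0 : 0 < eta by rewrite /eta; lra.
have [M0 hM0] := iU eta eta0.
pose M := Num.max M0 1.
have M1 : 1 <= M by rewrite le_max lexx orbT.
pose S : set C^o := [set z | U z /\ v z <= - eta].
have SM z : S z -> normc z <= M.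
  move=> [Uz vz]; rewrite leNgt; apply/negP => Mz.
  have : - eta < v z by apply: hM0 => //; apply: le_lt_trans Mz; rewrite le_max lexx.
  by rewrite ltNge vz.
have cv z : U z -> v @ nbhs (z : C^o) --> v z.
  by move=> Uz; exact: harmonic_at_continuous (hv z Uz).
have cS : closed S.
  rewrite -[S]setCK; apply: open_closedC; rewrite openE => e nSe; rewrite /interior.
  have [Ue|nUe] := pselect (U e); last first.
    by apply: filterS (bU e nUe eta eta0) => y hy [Uy vy]; have := hy Uy; rewrite ltNge vy.
  have ve : - eta < v e by rewrite ltNge; apply/negP => ve; exact: nSe.
  by apply: filterS (cvgr_gt _ (cv e Ue) _ ve) => y hy [_ vy]; move: hy; rewrite ltNge vy.
have kS := bounded_closed_compact SM cS.
pose D := M ^+ 2 + M + 1.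
have D0 : 0 < D by rewrite /D; have := sqr_ge0 M; lra.
pose eps := eta / D.
have eps0 : 0 < eps by rewrite divr_gt0.
pose F (z : C^o) : R := v z - eps * bump z.
have S0 : S z0 by split => //; rewrite /eta; lra.
have cF : {within S, continuous F}.
  apply: continuous_in_subspaceT => z /set_mem[Uz _].
  have h : (fun y => eps * bump y) @ nbhs (z : C^o) --> eps * bump z.
    by apply: cvgM; [exact: cvg_cst|exact: bump_continuous].
  exact: (cvgB (cv z Uz) h).
have S0' : S !=set0 by exists z0.
have [z1 S1 hmin] := compact_EVT_min S0' kS cF.
have [U1 v1] : U z1 /\ v z1 < - eta.
  move/set_mem : S1 => S1; have [U1 _] := S1; split=> //.
  have := hmin z0 (mem_set S0); rewrite /F.
  have := mulr_ge0 (ltW eps0) (bump_ge0 z0).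
  have : eps * bump z1 < eps * D.
    by rewrite ltr_pM2l//; have := bump_le (SM _ S1); rewrite /D; lra.
  have -> : eps * D = eta by rewrite /eps divfK// gt_eqF.
  by rewrite /eta; lra.
apply: (harmonic_no_min eps0 (hv z1 U1)).
have h1 : \forall y \near (z1 : C^o), v y < - eta.
  exact: (cvgr_lt (v z1) (cv z1 U1)).
apply: filterS2 (oU z1 U1) h1 => y Uy vy.
by apply: (hmin y); apply: mem_set; split => //; exact: ltW.
Qed.

(** The regularity of the continued Cauchy transform: twice differentiable off the
    real axis, and once on the support. *)
Definition smooth_at (f : C -> C) z := Cn 2 f z \/ Im z = 0 /\ exists c, cder f z c.

Lemma smooth_at_ccont f z : smooth_at f z -> ccont f z.
Proof. by case=> [/Cn_ccont//|[_ [c]]]; exact: cder_ccont. Qed.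

Lemma smooth_at_cder f z : smooth_at f z -> exists c, cder f z c.
Proof. by case=> [/Cn_cder//|[_]]. Qed.

(** Minimum modulus principle: if [w] were not attained, the modulus of the
    inverse of [f - w] would be larger at the centre than on the circle. *)
Lemma attained_in_ball f z0 (rho m : R) w : 0 < rho ->
  (forall z, normc (z - z0) <= rho -> smooth_at f z) ->
  (forall z, normc (z - z0) = rho -> m <= normc (f z - w)) ->
  normc (f z0 - w) < m -> exists2 z, normc (z - z0) < rho & f z = w.
Proof.
move=> rho0 hf hm hz0; apply: contrapT => hn.
have m0 : 0 < m by apply: le_lt_trans hz0; exact: normc_ge0.
have fw z : normc (z - z0) <= rho -> f z - w != 0.
  rewrite le_eqVlt => /orP[/eqP/hm h|h].
    by rewrite -normc_gt0; exact: lt_le_trans h.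
  by apply/eqP => /eqP; rewrite subr_eq0 => /eqP fz; apply: hn; exists z.
pose h z := (f z - w)^-1.
have hz0' : h z0 != 0 by rewrite invr_eq0 fw// subrr normc0 ltW.
pose u := conjc (h z0) / (normc (h z0))%:C.
have u1 : normc u = 1.
  by rewrite normcM normcV normc_conj normc_real ger0_norm ?normc_ge0// divff// normc_eq0.
have nz : normc (z0 - z0) < rho by rewrite subrr normc0.
have shf z : normc (z - z0) <= rho -> smooth_at (fun y => u * h y) z.
  move=> zr; case: (hf z zr) => [h2|[i0 [c hc]]].
    left; apply: CnM; first exact: Cn_cst.
    by apply: CnV; [exact: fw|apply: CnB => //; exact: Cn_cst].
  right; split => //; eexists; apply: cderM; first exact: cder_cst.
  by apply: cderV; [exact: fw|apply: cderB; [exact: hc|exact: cder_cst]].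
pose v z := m^-1 - Re (u * h z).
suff : 0 <= v z0.
  apply/negP; rewrite -ltNge /v subr_lt0.
  have -> : u * h z0 = (normc (h z0))%:C.
    rewrite /u mulrAC [_ * h z0]mulrC mul_conjc -rmorphV ?unitfE ?normc_eq0//.
    by rewrite -rmorphM expr2 mulfK// normc_eq0.
  rewrite ReC /h normcV ltf_pV2 ?posrE// normc_gt0 fw//; exact: ltW.
apply: (@max_principle [set z | normc (z - z0) < rho]) => //=.
- move=> z zr; have d0 : 0 < rho - normc (z - z0) by rewrite subr_gt0.
  apply: filterS (near_normc z d0) => y yz.
  by have := normc_tri y z z0; rewrite /=; lra.
- move=> z zr; exists (fun y => m^-1%:C - u * h y); split.
    by near=> y; rewrite ReD ReN.
  case: (shf z (ltW zr)) => [k|[k0 [c k]]].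
    by left; apply: CnB => //; exact: Cn_cst.
  by right; split=> //; exists (0 - c); apply: cderB => //; exact: cder_cst.
- move=> e /negP; rewrite -leNgt le_eqVlt => /orP[/eqP er|er] eta eta0; last first.
    have d0 : 0 < normc (e - z0) - rho by rewrite subr_gt0.
    apply: filterS (near_normc e d0) => y ye yr; exfalso.
    have := normc_tri e y z0; rewrite (normcB e y); lra.
  have /smooth_at_ccont/climP/(_ _ eta0) := shf e (eq_ind_r (fun x => x <= rho) (lexx _) (esym er)).
  apply: filterS => y hy _.
  have := hm e (esym er) => hme.
  have : Re (u * h e) <= m^-1.
    apply: le_trans (Re_le_normc _) _; rewrite normcM u1 mul1r normcV lef_pV2 ?posrE//.
    exact: lt_le_trans hme.
  have := Re_le_normc (u * h y - u * h e); rewrite ReD ReN /v; lra.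
- move=> eta eta0; exists (normc z0 + rho) => z zr.
  have := le_normcD (z - z0) z0; rewrite subrK; lra.
Unshelve. all: by end_near. Qed.

End MaxPrinciple.

(** * Integrals of bounded complex functions *)

Section Density.
Context d (T : measurableType d) (R : realType).
Variable mu : {sigma_finite_measure set T -> \bar R}.

(** The density is almost everywhere the Radon-Nikodym derivative, for which the
    change of variables is known. *)
Lemma Rintegral_density (nu : probability T R) (f : T -> R) (h : T -> R) (K : R) :
  (forall x, 0 <= f x) -> measurable_fun setT f ->
  (forall A, measurable A -> nu A = (\int[mu]_(x in A) (f x)%:E)%E) ->
  measurable_fun setT h -> (forall x, `|h x| <= K) ->
  \int[nu]_(x in setT) h x = \int[mu]_(x in setT) (h x * f x).
Proof.
move=> f0 mf nuE mh hK.
have numu : nu `<< mu.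
  apply/null_content_dominatesP => A mA A0; rewrite nuE//.
  by apply: null_set_integral => //; apply/measurable_EFinP; exact: measurable_funTS.
have fint : mu.-integrable setT (EFin \o f).
  apply/integrableP; split; first exact/measurable_EFinP.
  under eq_integral do rewrite /= ger0_norm//.
  by rewrite -nuE// probability_setT ltry.
pose cnu : {charge set T -> \bar R} := charge_of_finite_measure nu.
have numu' : cnu `<< mu by [].
have RNint := @Radon_Nikodym_integrable _ _ R cnu mu numu'.
have RNf : ae_eq mu setT (Radon_Nikodym cnu mu) (EFin \o f).
  apply: integral_ae_eq => //; first exact/measurable_EFinP.
  by move=> E _ mE; rewrite -(@Radon_Nikodym_integral _ _ R cnu mu E numu')//= nuE.
have hint : nu.-integrable setT (EFin \o h).
  apply: measurable_bounded_integrable => //; first by rewrite fin_num_fun_lty.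
  exists K; split; first by rewrite num_real.
  by move=> M KM x _; apply: le_trans (hK x) (ltW KM).
congr fine.
rewrite -(@Radon_Nikodym_change_of_variables _ _ R nu mu numu)//=.
apply: ae_eq_integral => //.
- apply: emeasurable_funM; first exact/measurable_EFinP.
  exact: measurable_int RNint.
- by apply/measurable_EFinP; exact: measurable_funM.
- apply: filterS RNf => x /(_ I) /= -> _; by rewrite EFinM.
Qed.

End Density.

Section ComplexIntegral.
Variable R : realType.
Local Notation C := R[i].
Local Notation Re := (@complex.Re R).
Local Notation Im := (@complex.Im R).
Local Notation mu := (@lebesgue_measure R).
Variables a b : R.
Hypothesis ab : a < b.
Local Notation D := `]a, b[%classic.
Implicit Types (g h : R -> C).

Definition cmeas h := measurable_fun D (fun x => Re (h x)) /\
  measurable_fun D (fun x => Im (h x)).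

Lemma eq_cmeas g h : (forall x, D x -> g x = h x) -> cmeas g -> cmeas h.
Proof.
by move=> gh [m1 m2]; split; [apply: eq_measurable_fun m1|apply: eq_measurable_fun m2] => x /set_mem Dx; rewrite gh.
Qed.

Lemma cmeas_cst c : cmeas (fun _ => c). Proof. by split; exact: measurable_cst. Qed.

Lemma cmeas_real (k : R -> R) : measurable_fun D k -> cmeas (fun x => (k x)%:C).
Proof. by move=> mk; split => //; exact: measurable_cst. Qed.

Lemma cmeasD g h : cmeas g -> cmeas h -> cmeas (fun x => g x + h x).
Proof.
move=> [g1 g2] [h1 h2]; split.
  by under [X in measurable_fun _ X]eq_fun do rewrite ReD; exact: measurable_funD.
by under [X in measurable_fun _ X]eq_fun do rewrite ImD; exact: measurable_funD.
Qed.

Lemma cmeasM g h : cmeas g -> cmeas h -> cmeas (fun x => g x * h x).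
Proof.
move=> [g1 g2] [h1 h2]; split.
  under [X in measurable_fun _ X]eq_fun do rewrite ReM.
  by apply: measurable_funB; exact: measurable_funM.
under [X in measurable_fun _ X]eq_fun do rewrite ImM.
by apply: measurable_funD; exact: measurable_funM.
Qed.

Lemma cmeasN g : cmeas g -> cmeas (fun x => - g x).
Proof.
move=> mg; apply: (@eq_cmeas (fun x => (-1) * g x)); first by move=> x _; rewrite mulN1r.
exact: cmeasM (cmeas_cst _) mg.
Qed.

Lemma cmeasB g h : cmeas g -> cmeas h -> cmeas (fun x => g x - h x).
Proof. by move=> mg mh; exact: cmeasD mg (cmeasN mh). Qed.

Lemma cmeasV g : cmeas g -> cmeas (fun x => (g x)^-1).
Proof.
move=> [g1 g2].
have m : measurable_fun D (fun x => (Re (g x) ^+ 2 + Im (g x) ^+ 2)^-1).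
  have -> : (fun x => (Re (g x) ^+ 2 + Im (g x) ^+ 2)^-1) =
            (fun x => (Re (g x) ^+ 2 + Im (g x) ^+ 2) `^ (-1)).
    by apply/funext => x; rewrite powR_inv1// addr_ge0 ?sqr_ge0.
  apply: (measurableT_comp (measurable_powR (-1))).
  by apply: measurable_funD; exact: measurable_funX.
split.
  by under [X in measurable_fun _ X]eq_fun do rewrite ReV; exact: measurable_funM.
under [X in measurable_fun _ X]eq_fun do rewrite ImV.
by apply: measurable_funM => //; exact: measurable_funN.
Qed.

(** Bounded measurable functions form an algebra that is stable under inversion
    away from zero and contains all the integrands below. *)
Definition bm h := cmeas h /\ exists K : R, forall x, D x -> normc (h x) <= K.

Lemma bm_cst c : bm (fun _ => c).
Proof. by split; [exact: cmeas_cst|exists (normc c)]. Qed.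

Lemma bmD g h : bm g -> bm h -> bm (fun x => g x + h x).
Proof.
move=> [mg [K hK]] [mh [L hL]]; split; first exact: cmeasD.
exists (K + L) => x Dx; apply: le_trans (le_normcD _ _) _.
by rewrite lerD ?hK ?hL.
Qed.

Lemma bmM g h : bm g -> bm h -> bm (fun x => g x * h x).
Proof.
move=> [mg [K hK]] [mh [L hL]]; split; first exact: cmeasM.
by exists (K * L) => x Dx; rewrite normcM ler_pM ?normc_ge0 ?hK ?hL.
Qed.

Lemma bmN g : bm g -> bm (fun x => - g x).
Proof.
move=> [mg [K hK]]; split; first exact: cmeasN.
by exists K => x Dx; rewrite normcN hK.
Qed.

Lemma bmB g h : bm g -> bm h -> bm (fun x => g x - h x).
Proof. by move=> mg mh; exact: bmD mg (bmN mh). Qed.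

Lemma bmV g (c : R) : 0 < c -> bm g -> (forall x, D x -> c <= normc (g x)) ->
  bm (fun x => (g x)^-1).
Proof.
move=> c0 [mg _] gc; split; first exact: cmeasV.
exists c^-1 => x Dx; rewrite normcV lef_pV2 ?posrE ?gc//.
exact: lt_le_trans (gc x Dx).
Qed.

Lemma bmX g n : bm g -> bm (fun x => g x ^+ n).
Proof.
move=> hg; elim: n => [|n ih].
  have [m [K hK]] := bm_cst 1; split; last by exists K => x Dx; rewrite expr0; exact: hK Dx.
  by apply: eq_cmeas m => x _; rewrite expr0.
have [m [K hK]] := bmM hg ih; split; last by exists K => x Dx; rewrite exprS hK.
by apply: eq_cmeas m => x _; rewrite exprS.
Qed.

Lemma eq_bm g h : (forall x, D x -> g x = h x) -> bm g -> bm h.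
Proof.
move=> gh [m [K hK]]; split; first exact: eq_cmeas m.
by exists K => x Dx; rewrite -gh// hK.
Qed.

Lemma bm_real (k : R -> R) (K : R) : measurable_fun D k ->
  (forall x, D x -> `|k x| <= K) -> bm (fun x => (k x)%:C).
Proof.
move=> mk hK; split; first exact: cmeas_real.
by exists K => x Dx; rewrite normc_real hK.
Qed.

Lemma bounded_integrable (k : R -> R) (K : R) : measurable_fun D k ->
  (forall x, D x -> `|k x| <= K) -> mu.-integrable D (EFin \o k).
Proof.
move=> mk hK; apply: measurable_bounded_integrable => //.
  by rewrite /= lebesgue_measure_itv/= lte_fin ab -EFinB ltry.
exists K; split; first by rewrite num_real.
by move=> M KM x Dx; apply: le_trans (hK x Dx) (ltW KM).
Qed.

Lemma bm_Re_integrable h : bm h -> mu.-integrable D (EFin \o (fun x => Re (h x))).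
Proof.
move=> [[m1 m2] [K hK]]; apply: (@bounded_integrable _ K) => // x Dx.
by apply: le_trans (hK x Dx); exact: normc_Re.
Qed.

Lemma bm_Im_integrable h : bm h -> mu.-integrable D (EFin \o (fun x => Im (h x))).
Proof.
move=> [[m1 m2] [K hK]]; apply: (@bounded_integrable _ K) => // x Dx.
by apply: le_trans (hK x Dx); exact: normc_Im.
Qed.

Definition cint h : C :=
  (\int[mu]_(x in D) Re (h x)) +i* (\int[mu]_(x in D) Im (h x)).

Lemma eq_cint g h : (forall x, D x -> g x = h x) -> cint g = cint h.
Proof.
move=> gh; rewrite /cint; congr Complex; apply: eq_Rintegral => x /set_mem Dx;
  by rewrite gh.
Qed.

Lemma cintD g h : bm g -> bm h -> cint (fun x => g x + h x) = cint g + cint h.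
Proof.
move=> hg hh; apply: complexP => /=.
  under eq_Rintegral do rewrite ReD.
  by rewrite RintegralD//; exact: bm_Re_integrable.
under eq_Rintegral do rewrite ImD.
by rewrite RintegralD//; exact: bm_Im_integrable.
Qed.

Lemma cintZ c h : bm h -> cint (fun x => c * h x) = c * cint h.
Proof.
move=> hh.
have hr := bm_Re_integrable hh; have hi := bm_Im_integrable hh.
have Z (k : R) (p : R -> R) : mu.-integrable D (EFin \o p) ->
    mu.-integrable D (EFin \o (fun x => k * p x)).
  move=> hp; rewrite (_ : EFin \o _ = fun x => (k%:E * (EFin \o p) x)%E)//.
  exact: integrableZl.
apply: complexP; rewrite ?ReM ?ImM /=.
  under eq_Rintegral do rewrite ReM.
  by rewrite RintegralB ?RintegralZl//; exact: Z.
under eq_Rintegral do rewrite ImM.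
by rewrite RintegralD ?RintegralZl//; exact: Z.
Qed.

Lemma cintN h : bm h -> cint (fun x => - h x) = - cint h.
Proof.
move=> hh; rewrite -[RHS]mulN1r -cintZ//; apply: eq_cint => x _.
by rewrite mulN1r.
Qed.

Lemma cintB g h : bm g -> bm h -> cint (fun x => g x - h x) = cint g - cint h.
Proof.
by move=> hg hh; rewrite cintD ?cintN//; exact: bmN.
Qed.

(** The factor 2 comes from the separate treatment of the two components. *)
Lemma normc_cint h (k : R -> R) (K : R) : bm h -> measurable_fun D k ->
  (forall x, D x -> normc (h x) <= k x) -> (forall x, D x -> k x <= K) ->
  normc (cint h) <= 2 * \int[mu]_(x in D) k x.
Proof.
move=> hh mk hk kK.
have ik : mu.-integrable D (EFin \o k).
  apply: (@bounded_integrable _ K) => // x Dx.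
  by rewrite ger0_norm ?kK// (le_trans (normc_ge0 _) (hk x Dx)).
have aux (p : R -> R) : mu.-integrable D (EFin \o p) ->
    (forall x, D x -> `|p x| <= k x) -> `|\int[mu]_(x in D) p x| <= \int[mu]_(x in D) k x.
  move=> ip pk; apply: le_trans (le_normr_Rintegral _ ip) _ => //.
  apply: le_Rintegral => //.
  by have := integrable_abse ip; apply: eq_integrable.
apply: le_trans (normc_leD _) _; rewrite mulr_natl mulr2n lerD//=.
  apply: aux; first exact: bm_Re_integrable.
  by move=> x Dx; apply: le_trans (hk x Dx); exact: normc_Re.
apply: aux; first exact: bm_Im_integrable.
by move=> x Dx; apply: le_trans (hk x Dx); exact: normc_Im.
Qed.

Lemma normc_cint_cst h (K : R) : bm h -> (forall x, D x -> normc (h x) <= K) ->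
  normc (cint h) <= 2 * (b - a) * K.
Proof.
move=> hh hK; apply: le_trans (normc_cint hh (measurable_cst K) hK _) _.
  by move=> x _; exact: lexx.
rewrite Rintegral_cst//= lebesgue_measure_itv/= lte_fin ab -EFinB/=; lra.
Qed.

End ComplexIntegral.

(** * Real powers *)

Section RealPowers.
Variable R : realType.
Implicit Types x y p : R.

Lemma ltr_powRN x y p : p < 0 -> 0 < x -> x < y -> y `^ p < x `^ p.
Proof.
move=> p0 x0 xy; rewrite -(opprK p) powRN [ltRHS]powRN.
have y0 : 0 < y := lt_trans x0 xy.
rewrite ltf_pV2 ?posrE ?powR_gt0//; apply: gt0_ltr_powR; rewrite ?oppr_gt0//.
- by rewrite nnegrE ltW.
- by rewrite nnegrE ltW.
Qed.

Lemma ler_powRN x y p : p <= 0 -> 0 < x -> x <= y -> y `^ p <= x `^ p.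
Proof.
move=> p0 x0 xy; have [->|p1] := eqVneq p 0; first by rewrite !powRr0.
have [->//|yx] := eqVneq x y.
by apply/ltW/ltr_powRN => //; rewrite lt_neqAle ?p1 ?yx.
Qed.

Lemma powR_le1DV x p : 0 < x -> -1 <= p <= 0 -> x `^ p <= 1 + x^-1.
Proof.
move=> x0 /andP[p1 p0].
have xi : 0 < x^-1 by rewrite invr_gt0.
have [x1|x1] := lerP 1 x.
  have := ler_powR x1 p0; rewrite powRr0; lra.
have : x `^ p <= x `^ (-1) by apply: ger_powR => //; rewrite x0 ltW.
rewrite powR_inv1 ?(ltW x0)//; lra.
Qed.

End RealPowers.

(** * The density of the power and its continuation *)

Section Setup.
Variable R : realType.
Local Notation C := R[i].
Local Notation Re := (@complex.Re R).
Local Notation Im := (@complex.Im R).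
Variables (a b : R) (N : nat) (l alpha : 'I_N -> R) (r : R).
Hypothesis ha : 0 < a.
Hypothesis hab : a < b.
Hypothesis hl01 : forall k, 0 <= l k <= 1.
Hypothesis halpha : forall k, 0 < alpha k.
Hypothesis hr : r <= -1.
Implicit Types (z w : C) (x : R).

Definition expo := - r^-1.
Local Notation q := expo.
(** [zeta] below extends the inverse of this map to the cut plane. *)
Definition phi x := x `^ r.
(** Minus the derivative of [phi]. *)
Definition wt x := - r * x `^ (r - 1).
Definition endA := b `^ r.
Definition endB := a `^ r.
Local Notation A := endA.
Local Notation B := endB.

Definition zeta z := cpow z (- q).
Definition rootS z := csqrt (b%:C - zeta z) * csqrt (zeta z - a%:C).
(** The density of the power [x `^ r] extended to complex arguments. *)
Definition gdens z :=
  q%:C * (z^-1 * rootS z * \sum_(k < N) (alpha k)%:C * cpow z (q * l k)).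

(** The plane cut along the real axis outside of the support of the power. *)
Definition Dom z := Im z <> 0 \/ A < Re z < B.

Lemma hb : 0 < b. Proof. exact: lt_trans hab. Qed.
Lemma r_neg : r < 0. Proof. by move: hr; lra. Qed.
Lemma r_neq0 : r != 0. Proof. by rewrite lt_eqF// r_neg. Qed.
Lemma q_gt0 : 0 < q. Proof. by rewrite /expo oppr_gt0 invr_lt0 r_neg. Qed.
Lemma q_le1 : q <= 1.
Proof.
rewrite /expo -invrN invf_le1 ?oppr_gt0 ?r_neg//; move: hr; lra.
Qed.
Lemma rq : r * - q = 1. Proof. by rewrite /expo opprK divff// r_neq0. Qed.

Lemma A_gt0 : 0 < A. Proof. by rewrite powR_gt0// hb. Qed.
Lemma A_lt_B : A < B. Proof. exact: ltr_powRN r_neg ha hab. Qed.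
Lemma B_gt0 : 0 < B. Proof. exact: lt_trans A_gt0 A_lt_B. Qed.

Lemma phi_gt0 x : 0 < x -> 0 < phi x. Proof. exact: powR_gt0. Qed.

Lemma phi_range x : a < x < b -> A < phi x < B.
Proof.
move=> /andP[ax xb]; have x0 := lt_trans ha ax.
by rewrite /phi !ltr_powRN// r_neg.
Qed.

Lemma phiK x : 0 < x -> phi x `^ (- q) = x.
Proof. by move=> x0; rewrite /phi -powRrM rq powRr1// ltW. Qed.

Lemma powqK y : 0 < y -> phi (y `^ (- q)) = y.
Proof. by move=> y0; rewrite /phi -powRrM mulrC rq powRr1// ltW. Qed.

Lemma powq_range y : A < y < B -> a < y `^ (- q) < b.
Proof.
move=> /andP[Ay yB]; have y0 := lt_trans A_gt0 Ay.
have q0 : - q < 0 by rewrite oppr_lt0 q_gt0.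
have <- : B `^ (- q) = a by exact: phiK.
have <- : A `^ (- q) = b by apply: phiK; exact: hb.
by rewrite !ltr_powRN// A_gt0.
Qed.

Lemma Dom_slit z : Dom z -> slit z.
Proof.
move=> [h|/andP[h _]]; apply/slitP; [by left|right].
exact: lt_trans A_gt0 h.
Qed.

Lemma Dom_open z : Dom z -> \forall y \near (z : C^o), Dom y.
Proof.
have ci : (fun y : C^o => Im y) @ nbhs (z : C^o) --> Im z by exact: clim_Im (ccont_id z).
have cr : (fun y : C^o => Re y) @ nbhs (z : C^o) --> Re z by exact: clim_Re (ccont_id z).
move=> [/eqP h|/andP[h1 h2]].
  have cn : (fun y : C^o => `|Im y|) @ nbhs (z : C^o) --> `|Im z| by exact: cvg_norm.
  have n0 : 0 < `|Im z| by rewrite normr_gt0.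
  have k : \forall y \near (z : C^o), 0 < `|Im y| by exact: (cvgr_gt `|Im z| cn).
  by apply: filterS k => y; rewrite normr_gt0 => /eqP; left.
have k1 : \forall y \near (z : C^o), A < Re y by exact: (cvgr_gt (Re z) cr).
have k2 : \forall y \near (z : C^o), Re y < B by exact: (cvgr_lt (Re z) cr).
by apply: filterS2 k1 k2 => y y1 y2; right; rewrite y1.
Qed.

Lemma zeta_real x : 0 < x -> zeta x%:C = (x `^ (- q))%:C.
Proof. exact: cpow_real. Qed.

Lemma zeta_phi x : 0 < x -> zeta (phi x)%:C = x%:C.
Proof. by move=> x0; rewrite zeta_real ?phiK// phi_gt0. Qed.

Lemma slit_Im z : Im z != 0 -> slit z.
Proof. by move=> h; apply/slitP; left; exact/eqP. Qed.

Lemma slit_pos z : 0 < Im z -> slit z.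
Proof. by move=> h; apply: slit_Im; rewrite gt_eqF. Qed.

Lemma slit_neg z : Im z < 0 -> slit z.
Proof. by move=> h; apply: slit_Im; rewrite lt_eqF. Qed.

Lemma Im_zeta_lt0 z : 0 < Im z -> Im (zeta z) < 0.
Proof.
move=> h; have zs := slit_pos h.
rewrite Im_cpow// mulNr sinN mulrN oppr_lt0 mulr_gt0 ?powR_gt0 ?slit_normc//.
apply: sin_gt0_pi; have := Arg_gt0 h; have := Arg_bounds z.
have := q_gt0; have := q_le1 => q1 q0 /andP[_ A1] A0.
rewrite mulr_gt0//=; apply: le_lt_trans A1; rewrite ler_piMl// ltW//.
Qed.

Lemma Im_zeta_gt0 z : Im z < 0 -> 0 < Im (zeta z).
Proof.
move=> h; have zs := slit_neg h.
rewrite Im_cpow// mulr_gt0 ?powR_gt0 ?slit_normc//.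
rewrite mulNr -mulrN; apply: sin_gt0_pi; have := Arg_lt0 h; have := Arg_bounds z.
have := q_gt0; have := q_le1 => q1 q0 /andP[A1 _] A0.
rewrite (mulr_gt0 q0) ?(oppr_gt0 (Arg z))//=.
apply: (@le_lt_trans _ _ (- Arg z)); last lra.
by rewrite ler_piMl// oppr_ge0 ltW.
Qed.

Lemma zeta_slit z : Dom z -> slit (b%:C - zeta z) /\ slit (zeta z - a%:C).
Proof.
move=> Dz.
have [z0|z0] := eqVneq (Im z) 0.
  case: Dz => [/eqP|h]; first by rewrite z0 eqxx.
  have zE : z = (Re z)%:C by apply: complexP => //=.
  have z1 : 0 < Re z by case/andP: h => h _; exact: lt_trans A_gt0 h.
  rewrite zE zeta_real//; have /andP[h1 h2] := powq_range h.
  by split; apply/slitP; right; rewrite !ReImE subr_gt0.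
suff h : Im (zeta z) != 0.
  by split; apply: slit_Im; rewrite !ReImE ?sub0r ?oppr0 ?addr0 ?oppr_eq0.
have [h|h] : Im z < 0 \/ 0 < Im z by apply/orP; rewrite -neq_lt.
  by rewrite gt_eqF// Im_zeta_gt0.
by rewrite lt_eqF// Im_zeta_lt0.
Qed.

Lemma Cn_zeta n z : slit z -> Cn n zeta z.
Proof. exact: Cn_cpow. Qed.

Lemma Cn_csqrt n z : slit z -> Cn n (@csqrt R) z.
Proof. exact: Cn_cpow. Qed.

Lemma Cn_rootS n z : Dom z -> Cn n rootS z.
Proof.
move=> Dz; have zs := Dom_slit Dz; have [s1 s2] := zeta_slit Dz.
apply: CnM; apply: Cn_comp.
- by apply: CnB; [exact: Cn_cst|exact: Cn_zeta].
- exact: Cn_csqrt.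
- by apply: CnB; [exact: Cn_zeta|exact: Cn_cst].
- exact: Cn_csqrt.
Qed.

Definition gsum z := \sum_(k < N) (alpha k)%:C * cpow z (q * l k).

Lemma Cn_gsum n z : slit z -> Cn n gsum z.
Proof.
by move=> zs; apply: Cn_sum => k; apply: CnM; [exact: Cn_cst|exact: Cn_cpow].
Qed.

Lemma Cn_gdens n z : Dom z -> Cn n gdens z.
Proof.
move=> Dz; have zs := Dom_slit Dz.
apply: CnM; first exact: Cn_cst.
apply: CnM; last exact: Cn_gsum.
by apply: CnM; [exact: Cn_inv0 (slit_neq0 zs)|exact: Cn_rootS].
Qed.

(** The density on the support, as a function of [x] in the interval
    from [a] to [b]. *)
Definition greal x : R := q * (phi x)^-1 * (Num.sqrt (b - x) * Num.sqrt (x - a)) *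
  \sum_(k < N) alpha k * x `^ (- l k).

Lemma csqrt_real x : 0 < x -> csqrt x%:C = (Num.sqrt x)%:C.
Proof. by move=> x0; rewrite /csqrt cpow_real// powR12_sqrt// ltW. Qed.

Lemma gdens_phi x : a < x < b -> gdens (phi x)%:C = (greal x)%:C.
Proof.
move=> /andP[ax xb]; have x0 := lt_trans ha ax.
rewrite /gdens /rootS zeta_phi// -!rmorphB !csqrt_real ?subr_gt0//.
have -> : \sum_(k < N) (alpha k)%:C * cpow (phi x)%:C (q * l k) =
  (\sum_(k < N) alpha k * x `^ (- l k))%:C.
  rewrite rmorph_sum; apply: eq_bigr => k _.
  rewrite cpow_real ?phi_gt0// -rmorphM /phi -powRrM; congr ((_ * _ `^ _)%:C).
  have /(congr1 (fun u => - u)) := rq; rewrite mulrN opprK => e.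
  by rewrite mulrA e mulN1r.
have -> : (phi x)%:C^-1 = ((phi x)^-1)%:C :> C by rewrite fmorphV.
by rewrite -!rmorphM /greal !mulrA.
Qed.

Lemma gpfp_pdfE x : a < x < b -> gpfp_pdf a b alpha l x = greal x * wt x.
Proof.
move=> /andP[ax xb]; have x0 := lt_trans ha ax.
rewrite /gpfp_pdf indicE mem_set; last by rewrite /= in_itv/= ax.
rewrite mulr1 sqrtrM ?subr_ge0 ?ltW//.
have -> : \sum_(k < N) alpha k / x `^ l k = \sum_(k < N) alpha k * x `^ (- l k).
  by apply: eq_bigr => k _; rewrite powRN.
rewrite /greal /wt /phi powRB ?(gt_eqF x0) ?implybT// powRr1 ?(ltW x0)//.
have p0 : x `^ r != 0 by rewrite gt_eqF// powR_gt0.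
have e : q * r = -1 by rewrite -[LHS]opprK -mulNr mulrC rq.
have -> : q = - r^-1 by [].
by field; rewrite p0 r_neq0 gt_eqF.
Qed.

Lemma wt_gt0 x : 0 < x -> 0 < wt x.
Proof. by move=> x0; rewrite mulr_gt0 ?powR_gt0// oppr_gt0 r_neg. Qed.

Lemma sum_powR_ge0 x (e : 'I_N -> R) : 0 <= \sum_(k < N) alpha k * x `^ e k.
Proof. by apply: sumr_ge0 => k _; rewrite mulr_ge0 ?powR_ge0 ?ltW. Qed.

Lemma greal_ge0 x : 0 <= greal x.
Proof.
by rewrite /greal !mulr_ge0 ?sqrtr_ge0 ?sum_powR_ge0 ?invr_ge0 ?powR_ge0// ltW ?q_gt0.
Qed.

Local Notation D := `]a, b[%classic.

Lemma inD x : D x = (a < x < b). Proof. by rewrite /= in_itv. Qed.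

Lemma measurable_powRD p (E : set R) : measurable_fun E (fun x : R => x `^ p).
Proof. exact: measurable_funS (measurable_powR p). Qed.

Lemma measurable_phi (E : set R) : measurable_fun E phi.
Proof. exact: measurable_powRD. Qed.

Lemma measurable_wt (E : set R) : measurable_fun E wt.
Proof. by apply: measurable_funM => //; exact: measurable_powRD. Qed.

Lemma measurable_sqrtr (E : set R) (f : R -> R) : measurable_fun E f ->
  measurable_fun E (fun x => Num.sqrt (f x)).
Proof.
move=> mf; apply: measurableT_comp => //.
by apply: continuous_measurable_fun; exact: sqrt_continuous.
Qed.

Lemma measurable_sum_powR (e : 'I_N -> R) (E : set R) :
  measurable_fun E (fun x => \sum_(k < N) alpha k * x `^ e k).
Proof.
apply: measurable_sum => k; apply: measurable_funM => //; exact: measurable_powRD.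
Qed.

Lemma measurable_greal (E : set R) : measurable_fun E greal.
Proof.
apply: measurable_funM; last exact: measurable_sum_powR.
apply: measurable_funM.
  apply: measurable_funM => //.
  have -> : (fun x => (phi x)^-1) = (fun x => (phi x) `^ (-1)).
    by apply/funext => x; rewrite powR_inv1// powR_ge0.
  apply: (measurableT_comp (measurable_powR (-1))); exact: measurable_phi.
by apply: measurable_funM; apply: measurable_sqrtr; apply: measurable_funB.
Qed.

Lemma gpfp_pdf0 x : ~~ (a < x < b) -> gpfp_pdf a b alpha l x = 0.
Proof.
by move=> h; rewrite /gpfp_pdf indicE memNset ?mulr0// inD; exact/negP.
Qed.

Lemma gpfp_pdf_ge0 x : 0 <= gpfp_pdf a b alpha l x.
Proof.
have [h|h] := boolP (a < x < b); last by rewrite gpfp_pdf0.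
rewrite gpfp_pdfE// mulr_ge0 ?greal_ge0// ltW// wt_gt0//.
by case/andP: h => h _; exact: lt_trans ha h.
Qed.

Lemma measurable_gpfp_pdf : measurable_fun setT (gpfp_pdf a b alpha l).
Proof.
have -> : gpfp_pdf a b alpha l = (fun x => greal x * wt x * \1_D x).
  apply/funext => x; have [h|h] := boolP (a < x < b).
    by rewrite gpfp_pdfE// indicE mem_set ?mulr1// inD.
  by rewrite gpfp_pdf0// indicE memNset ?mulr0// inD; exact/negP.
apply: measurable_funM; last exact: measurable_indic.
by apply: measurable_funM; [exact: measurable_greal|exact: measurable_wt].
Qed.

Lemma phi_le x : a < x < b -> phi x <= B.
Proof. by move=> /phi_range/andP[_ /ltW]. Qed.

Lemma wt_le x : a < x < b -> wt x <= wt a.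
Proof.
move=> /andP[ax xb]; rewrite ler_pM2l ?oppr_gt0 ?r_neg//.
by apply: ler_powRN; rewrite ?ltW//; move: hr; lra.
Qed.

Definition alphas := \sum_(k < N) alpha k.
Lemma alphas_ge0 : 0 <= alphas. Proof. by apply: sumr_ge0 => k _; rewrite ltW. Qed.

Definition gbound := q * A^-1 * (b - a) * (alphas * (1 + a^-1)).

Lemma greal_le x : a < x < b -> greal x <= gbound.
Proof.
move=> xab; have /andP[ax xb] := xab; have x0 := lt_trans ha ax.
have /andP[A1 _] := phi_range xab.
rewrite /greal /gbound.
have k1 : (phi x)^-1 <= A^-1 by rewrite lef_pV2 ?posrE ?ltW ?A_gt0 ?phi_gt0.
have k2 : Num.sqrt (b - x) * Num.sqrt (x - a) <= b - a.
  have e : Num.sqrt (b - a) * Num.sqrt (b - a) = b - a.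
    by rewrite -expr2 sqr_sqrtr// subr_ge0 ltW.
  rewrite -e ler_pM ?sqrtr_ge0// ler_wsqrtr//; lra.
have k3 : \sum_(k < N) alpha k * x `^ (- l k) <= alphas * (1 + a^-1).
  rewrite mulr_suml; apply: ler_sum => k _.
  rewrite ler_wpM2l ?(ltW (halpha k))//.
  have /andP[l0 l1] := hl01 k.
  apply: (@le_trans _ _ (1 + x^-1)).
    by apply: powR_le1DV => //; apply/andP; lra.
  by rewrite lerD2l lef_pV2 ?posrE// ltW.
have q0 := q_gt0.
rewrite ler_pM// ?sum_powR_ge0// ?mulr_ge0 ?sqrtr_ge0 ?invr_ge0 ?(ltW q0) ?powR_ge0//.
rewrite ler_pM ?mulr_ge0 ?sqrtr_ge0 ?invr_ge0 ?(ltW q0) ?powR_ge0//.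
by rewrite ler_wpM2l ?(ltW q0).
Qed.

Lemma bm_phi : bm a b (fun x => (phi x)%:C).
Proof.
apply: (@bm_real _ _ _ _ B); first exact: measurable_phi.
by move=> x; rewrite inD => /phi_le h; rewrite ger0_norm// powR_ge0.
Qed.

Lemma bm_wt : bm a b (fun x => (wt x)%:C).
Proof.
apply: (@bm_real _ _ _ _ (wt a)); first exact: measurable_wt.
move=> x; rewrite inD => h; rewrite ger0_norm ?wt_le//.
by rewrite ltW// wt_gt0//; case/andP: h => h _; exact: lt_trans ha h.
Qed.

Lemma bm_greal : bm a b (fun x => (greal x)%:C).
Proof.
apply: (@bm_real _ _ _ _ gbound); first exact: measurable_greal.
by move=> x; rewrite inD => h; rewrite ger0_norm ?greal_ge0// greal_le.
Qed.

Lemma normc_rootS z : Dom z -> normc (rootS z) ^+ 2 =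
  normc (b%:C - zeta z) * normc (zeta z - a%:C).
Proof.
by move=> /zeta_slit[s1 s2]; rewrite normcM exprMn !normc_csqrt2.
Qed.

Lemma normc_zeta z : slit z -> normc (zeta z) = normc z `^ (- q).
Proof. exact: normc_cpow. Qed.

Lemma normc_rootS_le z : Dom z -> normc (rootS z) <= b + normc (zeta z).
Proof.
move=> Dz; have z0 := normc_ge0 (zeta z); have b0 := hb.
rewrite -ler_sqr ?nnegrE ?normc_ge0 ?addr_ge0 ?(ltW b0)// normc_rootS// expr2.
rewrite ler_pM ?normc_ge0//; apply: le_trans (ler_normcB _ _) _.
  by rewrite normc_real gtr0_norm.
by rewrite normc_real gtr0_norm// addrC lerD2r ltW.
Qed.

Lemma normc_gdens_le z : Dom z ->
  normc (gdens z) <= q * alphas * (b + 1) * (1 + (normc z)^-1) ^+ 2.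
Proof.
move=> Dz; have zs := Dom_slit Dz; have n0 := slit_normc zs.
have q0 := q_gt0; have q1 := q_le1; have b0 := hb.
set n := normc z in n0 *.
have i0 : 0 < n^-1 by rewrite invr_gt0.
have k1 : normc (rootS z) <= (b + 1) * (1 + n^-1).
  apply: le_trans (normc_rootS_le Dz) _; rewrite normc_zeta//.
  have : n `^ (- q) <= 1 + n^-1 by apply: powR_le1DV => //; apply/andP; lra.
  have : 0 <= b * n^-1 by rewrite mulr_ge0 ?ltW.
  lra.
have k2 : normc (z^-1 * gsum z) <= alphas * (1 + n^-1).
  rewrite /gsum mulr_sumr /alphas mulr_suml.
  have -> : \sum_(k < N) z^-1 * ((alpha k)%:C * cpow z (q * l k)) =
     \sum_(k < N) (alpha k)%:C * cpow z (q * l k - 1).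
    apply: eq_bigr => k _; rewrite cpowD cpowN1//; ring.
  elim/big_ind2 : _ => [|x1 x2 y1 y2 h1 h2|k _].
  - by rewrite normc0.
  - by apply: le_trans (le_normcD _ _) _; exact: lerD.
  - rewrite normcM normc_real ger0_norm ?(ltW (halpha k))// normc_cpow//.
    rewrite ler_wpM2l ?(ltW (halpha k))//; apply: powR_le1DV => //.
    have /andP[l0 l1] := hl01 k.
    have : 0 <= q * l k by rewrite mulr_ge0 ?(ltW q0).
    have : q * l k <= q by rewrite ler_piMr ?(ltW q0).
    by move=> ? ?; apply/andP; lra.
have -> : gdens z = q%:C * ((z^-1 * gsum z) * rootS z) by rewrite /gdens /gsum; ring.
rewrite normcM normc_real (gtr0_norm q0) normcM.
have -> : q * alphas * (b + 1) * (1 + n^-1) ^+ 2 =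
  q * ((alphas * (1 + n^-1)) * ((b + 1) * (1 + n^-1))) by ring.
by rewrite ler_wpM2l ?(ltW q0)// ler_pM ?normc_ge0.
Qed.

(** * The Cauchy transform *)

Definition kern z x : C := (z - (phi x)%:C)^-1.
Definition dens x : R := greal x * wt x.
(** The Cauchy transform of the power, as an integral over the support of the
    original variable. *)
Definition G z : C := cint a b (fun x => (dens x)%:C * kern z x).

Definition away z (c : R) := forall x, a < x < b -> c <= normc (z - (phi x)%:C).

Lemma bm_dens : bm a b (fun x => (dens x)%:C).
Proof.
apply: (@eq_bm _ _ _ (fun x => (greal x)%:C * (wt x)%:C)); last exact: bmM bm_greal bm_wt.
by move=> x _; rewrite -rmorphM.
Qed.

Lemma dens_ge0 x : a < x < b -> 0 <= dens x.
Proof.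
move=> /andP[ax _]; rewrite mulr_ge0 ?greal_ge0// ltW// wt_gt0//.
exact: lt_trans ha ax.
Qed.

Lemma wt_ge0 x : a < x < b -> 0 <= wt x.
Proof. by move=> /andP[ax _]; rewrite ltW// wt_gt0// (lt_trans ha ax). Qed.

Lemma dens_le x : a < x < b -> dens x <= gbound * wt a.
Proof. by move=> h; rewrite ler_pM ?greal_ge0 ?wt_ge0 ?greal_le ?wt_le. Qed.

Lemma bm_kern z (c : R) : 0 < c -> away z c -> bm a b (kern z).
Proof.
move=> c0 zc; apply: (@bmV _ _ _ _ c) => //; exact: bmB (bm_cst _ _ _) bm_phi.
Qed.

Lemma bm_densX z (c : R) n : 0 < c -> away z c ->
  bm a b (fun x => (dens x)%:C * kern z x ^+ n).
Proof. by move=> c0 zc; apply: bmM bm_dens (bmX n (bm_kern c0 zc)). Qed.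

Lemma bm_densK z (c : R) : 0 < c -> away z c ->
  bm a b (fun x => (dens x)%:C * kern z x).
Proof. by move=> c0 zc; apply: bmM bm_dens (bm_kern c0 zc). Qed.

Lemma away_Im z : away z `|Im z|.
Proof.
move=> x _; have := normc_Im (z - (phi x)%:C).
by rewrite !ReImE subr0.
Qed.

Lemma away_near z (c : R) : 0 < c -> away z c ->
  \forall y \near (z : C^o), away y (c / 2).
Proof.
move=> c0 zc; have c2 : 0 < c / 2 by rewrite divr_gt0.
apply: filterS (near_normc z c2) => y yz x hx.
have := zc x hx; have := normc_tri z y (phi x)%:C; rewrite (normcB z y); lra.
Qed.

Lemma normc_kern z (c : R) x : 0 < c -> away z c -> a < x < b -> normc (kern z x) <= c^-1.
Proof.
move=> c0 zc hx; rewrite /kern normcV lef_pV2 ?posrE ?zc//.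
exact: lt_le_trans (zc x hx).
Qed.

Lemma away_neq0 z (c : R) x : 0 < c -> away z c -> a < x < b -> z - (phi x)%:C != 0.
Proof. by move=> c0 zc hx; rewrite -normc_gt0; exact: lt_le_trans (zc x hx). Qed.

Lemma kernB z y (c : R) x : 0 < c -> away z c -> away y c -> a < x < b ->
  kern y x - kern z x = - (y - z) * kern z x * kern y x.
Proof.
move=> c0 zc yc hx; have := away_neq0 c0 zc hx; have := away_neq0 c0 yc hx.
by rewrite /kern => h1 h2; field; rewrite h1 h2.
Qed.

(** Differentiation under the integral sign, from a uniform quadratic bound
    on the error of the linear approximation of the integrand. *)
Lemma cder_cint (k : C -> R -> C) (k' : R -> C) z (M : R) :
  (\forall y \near (z : C^o), bm a b (k y)) -> bm a b k' ->
  (\forall y \near (z : C^o), forall x, a < x < b ->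
     normc (k y x - k z x - k' x * (y - z)) <= M * normc (y - z) ^+ 2) ->
  cder (fun y => cint a b (k y)) z (cint a b k').
Proof.
move=> bk bk' hM; have bkz : bm a b (k z) := nbhs_singleton bk.
apply/cder_eps => e e0.
pose M' := 2 * (b - a) * `|M| + 1.
have M0 : 0 < M'.
  by rewrite /M' ltr_wpDl// mulr_ge0// mulr_ge0// subr_ge0 ltW.
have d0 : 0 < e / M' by rewrite divr_gt0.
apply: filterS3 bk hM (near_normc z d0) => y bky hy yz.
have -> : cint a b (k y) - cint a b (k z) - cint a b k' * (y - z) =
   cint a b (fun x => k y x - k z x - (y - z) * k' x).
  rewrite !cintB ?cintZ//; last 2 first.
  - by apply: bmB.
  - by apply: bmM => //; exact: bm_cst.
  by rewrite [_ * (y - z)]mulrC.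
apply: (@le_trans _ _ (2 * (b - a) * (`|M| * normc (y - z) ^+ 2))).
  apply: normc_cint_cst => //.
    by apply: bmB; [exact: bmB|apply: bmM => //; exact: bm_cst].
  move=> x; rewrite inD => hx; rewrite [(y - z) * _]mulrC.
  apply: le_trans (hy x hx) _; rewrite ler_wpM2r ?exprn_ge0 ?normc_ge0//.
  exact: ler_norm.
rewrite expr2 !mulrA; apply: ler_wpM2r; first exact: normc_ge0.
have : M' * normc (y - z) <= e by rewrite -ler_pdivlMl// mulrC ltW.
have := normc_ge0 (y - z); rewrite /M'; lra.
Qed.

Definition Gp n z : C := cint a b (fun x => (dens x)%:C * kern z x ^+ n).

Lemma cder_G z (c : R) : 0 < c -> away z c -> cder G z (- Gp 2 z).
Proof.
move=> c0 zc; have c2 : 0 < c / 2 by rewrite divr_gt0.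
have zc2 : away z (c / 2) by move=> x hx; apply: le_trans (zc x hx); lra.
have -> : - Gp 2 z = cint a b (fun x => - ((dens x)%:C * kern z x ^+ 2)).
  by rewrite (cintN hab (bm_densX 2 c0 zc)).
pose M := gbound * wt a * (c / 2)^-1 ^+ 3.
apply: (@cder_cint (fun y x => (dens x)%:C * kern y x) _ z M).
- by apply: filterS (away_near c0 zc) => y; exact: bm_densK.
- by apply: bmN; exact: bm_densX c0 zc.
apply: filterS (away_near c0 zc) => y yc x hx.
have kB := kernB c2 zc2 yc hx.
set u := kern z x in kB *; set v := kern y x in kB *; set h := y - z in kB *.
have -> : (dens x)%:C * v - (dens x)%:C * u - - ((dens x)%:C * u ^+ 2) * h =
    (dens x)%:C * (u ^+ 2 * v) * h ^+ 2.
  have e1 : v - u + u ^+ 2 * h = u ^+ 2 * v * h ^+ 2.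
    rewrite kB.
    have -> : - h * u * v + u ^+ 2 * h = - h * u * (v - u) by ring.
    by rewrite kB; ring.
  by rewrite -[RHS]mulrA -e1; ring.
rewrite normcM normcX ler_wpM2r ?exprn_ge0 ?normc_ge0//.
rewrite normcM normc_real ger0_norm ?dens_ge0// /M ler_pM ?dens_ge0 ?normc_ge0 ?dens_le//.
rewrite normcM normcX [leRHS]exprSr ler_pM ?exprn_ge0 ?normc_ge0 ?normc_kern//.
by rewrite ler_pXn2r ?nnegrE ?normc_ge0 ?normc_kern ?invr_ge0 ?(ltW c2).
Qed.

Lemma cder_Gp2 z (c : R) : 0 < c -> away z c -> cder (Gp 2) z (- 2 * Gp 3 z).
Proof.
move=> c0 zc; have c2 : 0 < c / 2 by rewrite divr_gt0.
have zc2 : away z (c / 2) by move=> x hx; apply: le_trans (zc x hx); lra.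
have -> : - 2 * Gp 3 z = cint a b (fun x => - 2 * ((dens x)%:C * kern z x ^+ 3)).
  by rewrite (cintZ hab _ (bm_densX 3 c0 zc)).
pose K := (c / 2)^-1.
have K0 : 0 < K by rewrite invr_gt0.
pose M := gbound * wt a * (K ^+ 3 * (3 * K)).
apply: (@cder_cint (fun y x => (dens x)%:C * kern y x ^+ 2) _ z M).
- by apply: filterS (away_near c0 zc) => y; exact: bm_densX.
- by apply: bmM; [exact: bm_cst|exact: bm_densX c0 zc].
apply: filterS (away_near c0 zc) => y yc x hx.
have kB := kernB c2 zc2 yc hx.
set u := kern z x in kB *; set v := kern y x in kB *; set h := y - z in kB *.
have -> : (dens x)%:C * v ^+ 2 - (dens x)%:C * u ^+ 2 -
    (- 2 * ((dens x)%:C * u ^+ 3)) * h =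
    (dens x)%:C * (u ^+ 2 * v * (v + 2 * u)) * h ^+ 2.
  have e1 : v ^+ 2 - u ^+ 2 + 2 * u ^+ 3 * h = u ^+ 2 * v * (v + 2 * u) * h ^+ 2.
    have -> : v ^+ 2 - u ^+ 2 + 2 * u ^+ 3 * h = (v - u) * (v + u) + 2 * u ^+ 3 * h by ring.
    rewrite kB.
    have -> : - h * u * v * (v + u) + 2 * u ^+ 3 * h = - h * u * (v - u) * (v + 2 * u) by ring.
    by rewrite kB; ring.
  by rewrite -[RHS]mulrA -e1; ring.
rewrite normcM normcX ler_wpM2r ?exprn_ge0 ?normc_ge0//.
rewrite normcM normc_real ger0_norm ?dens_ge0// /M ler_pM ?dens_ge0 ?normc_ge0 ?dens_le//.
have u1 : normc u <= K by exact: normc_kern.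
have v1 : normc v <= K by exact: normc_kern.
rewrite normcM ler_pM ?normc_ge0//.
  rewrite normcM normcX [leRHS]exprSr ler_pM ?exprn_ge0 ?normc_ge0//.
  by rewrite ler_pXn2r ?nnegrE ?normc_ge0 ?(ltW K0).
apply: le_trans (le_normcD _ _) _; rewrite mulr_natl mulr2n.
have := le_normcD u u; lra.
Qed.

Lemma ccont_Gp3 z (c : R) : 0 < c -> away z c -> ccont (Gp 3) z.
Proof.
move=> c0 zc; have c2 : 0 < c / 2 by rewrite divr_gt0.
have zc2 : away z (c / 2) by move=> x hx; apply: le_trans (zc x hx); lra.
pose K := (c / 2)^-1.
have K0 : 0 < K by rewrite invr_gt0.
pose M := 2 * (b - a) * (gbound * wt a * (K * K * (3 * K ^+ 2))) + 1.
have gb0 : 0 <= gbound * wt a.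
  have m : a < (a + b) / 2 < b by have := hab; lra.
  by apply: le_trans (dens_le m); exact: dens_ge0.
have M0 : 0 < M.
  have k1 : 0 <= 2 * (b - a) by rewrite mulr_ge0// subr_ge0 ltW.
  have k2 : 0 <= K * K * (3 * K ^+ 2) by rewrite !mulr_ge0 ?exprn_ge0 ?(ltW K0).
  by rewrite /M ltr_wpDl// mulr_ge0// mulr_ge0.
apply/climP => e e0.
have d0 : 0 < e / M by rewrite divr_gt0.
apply: filterS2 (away_near c0 zc) (near_normc z d0) => y yc yz.
have -> : Gp 3 y - Gp 3 z =
    cint a b (fun x => (dens x)%:C * kern y x ^+ 3 - (dens x)%:C * kern z x ^+ 3).
  by rewrite (cintB hab (bm_densX 3 c2 yc) (bm_densX 3 c0 zc)).
  apply: (@le_lt_trans _ _ (2 * (b - a) * (gbound * wt a * (K * K * (3 * K ^+ 2)) * normc (y - z)))).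
    apply: (normc_cint_cst hab).
      by apply: bmB; [exact: (bm_densX 3 c2 yc)|exact: (bm_densX 3 c0 zc)].
    move=> x; rewrite inD => hx.
    have kB := kernB c2 zc2 yc hx.
    set u := kern z x in kB *; set v := kern y x in kB *; set h := y - z in kB *.
    have -> : (dens x)%:C * v ^+ 3 - (dens x)%:C * u ^+ 3 =
      (dens x)%:C * (u * v * (v ^+ 2 + u * v + u ^+ 2)) * (- h).
      have -> : (dens x)%:C * v ^+ 3 - (dens x)%:C * u ^+ 3 =
        (dens x)%:C * ((v - u) * (v ^+ 2 + u * v + u ^+ 2)) by ring.
      by rewrite kB; ring.
    rewrite normcM normcN ler_wpM2r ?normc_ge0//.
    rewrite normcM normc_real ger0_norm ?dens_ge0// ler_pM ?dens_ge0 ?normc_ge0 ?dens_le//.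
    have u1 : normc u <= K by exact: normc_kern.
    have v1 : normc v <= K by exact: normc_kern.
    have uv : normc u * normc v <= K * K by rewrite ler_pM ?normc_ge0.
    have uu : normc u * normc u <= K * K by rewrite ler_pM ?normc_ge0.
    have vv : normc v * normc v <= K * K by rewrite ler_pM ?normc_ge0.
    rewrite normcM ler_pM ?normc_ge0 ?normcM//.
    apply: le_trans (le_normcD _ _) _; have := le_normcD (v ^+ 2) (u * v).
    rewrite !expr2 !normcM; lra.
  have : M * normc (y - z) < e by rewrite -ltr_pdivlMl// mulrC.
  have := normc_ge0 (y - z); rewrite /M; lra.
Qed.

Lemma Cn_G z (c : R) : 0 < c -> away z c -> Cn 2 G z.
Proof.
move=> c0 zc; have c2 : 0 < c / 2 by rewrite divr_gt0.
exists (fun y => - Gp 2 y); split.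
  by apply: filterS (away_near c0 zc) => y; exact: cder_G.
exists (fun y => - (- 2 * Gp 3 y)); split.
  by apply: filterS (away_near c0 zc) => y yc; apply: cderN; exact: cder_Gp2 c2 yc.
by apply: ccontN; apply: ccontM (ccont_cst _ _) _; exact: ccont_Gp3 c0 zc.
Qed.

Lemma normc_G z (c : R) : 0 < c -> away z c ->
  normc (G z) <= 2 * (b - a) * (gbound * wt a * c^-1).
Proof.
move=> c0 zc; apply: normc_cint_cst => //; first exact: bm_densK c0 zc.
move=> x; rewrite inD => hx; rewrite normcM normc_real ger0_norm ?dens_ge0//.
by rewrite ler_pM ?dens_ge0 ?normc_ge0 ?dens_le ?(normc_kern c0).
Qed.

(** * The logarithmic kernel *)

Lemma Rintegral_FTC (F f : R -> R) :
  (forall x : R, 0 < x -> is_derive x 1 F (f x)) ->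
  (forall x : R, 0 < x -> f @ x --> f x) ->
  \int[lebesgue_measure]_(x in `]a, b[) f x = F b - F a.
Proof.
move=> dF cf.
have cF (x : R) : 0 < x -> F @ x --> F x.
  move=> x0; have [+ _] := dF x x0.
  by move=> /derivable1_diffP/differentiable_continuous.
have b0 := hb.
have wf : {within `[a, b], continuous f}.
  apply: continuous_in_subspaceT => x /set_mem /=; rewrite in_itv/= => /andP[ax _].
  by apply: cf; exact: lt_le_trans ax.
have iab : lebesgue_measure.-integrable `[a, b] (EFin \o f).
  by apply: continuous_compact_integrable => //; exact: segment_compact.
have sub (i : interval R) : [set` i] `<=` `[a, b] ->
    lebesgue_measure.-integrable [set` i] (EFin \o f).
  by move=> ?; apply: integrableS iab.
rewrite Rintegral_itv_bndo_bndc; last by apply: sub; exact: subset_itv_oo_cc.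
rewrite Rintegral_itv_obnd_cbnd; last by apply: sub; exact: subset_itv_oc_cc.
rewrite /Rintegral (@continuous_FTC2 _ f F a b)//.
- split.
  + by move=> x; rewrite in_itv/= => /andP[ax _]; have [] := dF x (lt_trans ha ax).
  + by apply: cvg_at_right_filter; exact: cF.
  + by apply: cvg_at_left_filter; exact: cF.
- move=> x; rewrite in_itv/= => /andP[ax _].
  have [d e] := dF x (lt_trans ha ax).
  by rewrite derive1E.
Qed.

Lemma clim_kern z x : Im z != 0 -> 0 < x ->
  clim (nbhs x) (fun t => (wt t)%:C * kern z t) ((wt x)%:C * kern z x).
Proof.
move=> zi x0.
have cpow p : (fun t : R => t `^ p) @ x --> x `^ p.
  have [+ _] := is_derive1_powR p x0.
  by move=> /derivable1_diffP/differentiable_continuous.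
apply: climM.
  by apply: clim_real; apply: cvgM; [exact: cvg_cst|exact: cpow].
apply: climV.
  apply/eqP => h; move: zi; have := congr1 Im h.
  by rewrite !ReImE subr0 => ->; rewrite eqxx.
by apply: climB; [exact: clim_cst|apply: clim_real; exact: cpow].
Qed.

Lemma rder_Log_kern z x : Im z != 0 -> 0 < x ->
  rder (fun t => Log (z - (phi t)%:C)) x ((wt x)%:C * kern z x).
Proof.
move=> zi x0.
have dphi : rder (fun t => (phi t)%:C) x (r * x `^ (r - 1))%:C.
  by apply: rder_real; exact: is_derive1_powR.
have d1 := rder_comp dphi (cderB (cder_cst z (phi x)%:C) (cder_id _)).
have sz : slit (z - (phi x)%:C) by apply: slit_Im; rewrite !ReImE subr0.
have := rder_comp d1 (cder_Log sz).
rewrite sub0r mulN1r => h.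
have -> : (wt x)%:C * kern z x = (z - (phi x)%:C)^-1 * - (r * x `^ (r - 1))%:C.
  by rewrite mulrC /wt mulNr rmorphN.
exact: h.
Qed.

Lemma bm_wtkern z (c : R) : 0 < c -> away z c -> bm a b (fun x => (wt x)%:C * kern z x).
Proof. by move=> c0 zc; exact: bmM bm_wt (bm_kern c0 zc). Qed.

(** The integrand is the derivative of [Log (z - (phi x)%:C)], and
    [z - (phi x)%:C] does not meet the cut when [z] is not real. *)
Lemma cint_wtkern z : Im z != 0 ->
  cint a b (fun x => (wt x)%:C * kern z x) = Log (z - A%:C) - Log (z - B%:C).
Proof.
move=> zi; apply: complexP; rewrite /cint [LHS]/=.
  rewrite ReD ReN; apply: (@Rintegral_FTC (fun t => Re (Log (z - (phi t)%:C)))).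
    by move=> x x0; apply: rder_Re; exact: rder_Log_kern.
  by move=> x x0; apply: clim_Re; exact: clim_kern.
rewrite ImD ImN; apply: (@Rintegral_FTC (fun t => Im (Log (z - (phi t)%:C)))).
  by move=> x x0; apply: rder_Im; exact: rder_Log_kern.
by move=> x x0; apply: clim_Im; exact: clim_kern.
Qed.

(** The Poisson kernel of the half-plane containing [z], without its constant. *)
Definition poisson z x : R := `|Im z| / normc (z - (phi x)%:C) ^+ 2.

Lemma Im_kern z x : Im (kern z x) = - Im z / normc (z - (phi x)%:C) ^+ 2.
Proof. by rewrite /kern ImVn !ReImE subr0. Qed.

Lemma measurable_poisson z : measurable_fun D (poisson z).
Proof.
have [mk1 mk2] := cmeasV (cmeasB (cmeas_cst a b z) (bm_phi.1)).
have [i0|i0] := lerP 0 (Im z).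
  have -> : poisson z = (fun x => - Im (kern z x)).
    by apply/funext => x; rewrite Im_kern /poisson ger0_norm// mulNr opprK.
  exact: measurable_funN mk2.
have -> : poisson z = (fun x => Im (kern z x)) => //.
by apply/funext => x; rewrite Im_kern /poisson ltr0_norm.
Qed.

Lemma poisson_ge0 z x : 0 <= poisson z x.
Proof. by rewrite /poisson mulr_ge0 ?invr_ge0 ?exprn_ge0 ?normc_ge0. Qed.

Lemma poisson_le z x : Im z != 0 -> a < x < b -> poisson z x <= `|Im z|^-1.
Proof.
move=> zi hx; have i0 : 0 < `|Im z| by rewrite normr_gt0.
rewrite /poisson ler_pdivrMr ?exprn_gt0 ?(lt_le_trans i0) ?(away_Im z hx)//.
rewrite -ler_pdivrMl ?invr_gt0// invrK -expr2.
by rewrite ler_sqr ?nnegrE ?normc_ge0// (away_Im z hx).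
Qed.

(** The integral is, up to sign, a difference of two arguments. *)
Lemma Rintegral_poisson z : Im z != 0 ->
  \int[lebesgue_measure]_(x in D) (wt x * poisson z x) <= 2 * pi.
Proof.
move=> zi.
have h : \int[lebesgue_measure]_(x in D) Im ((wt x)%:C * kern z x) =
    Arg (z - A%:C) - Arg (z - B%:C).
  by have := congr1 Im (cint_wtkern zi); rewrite ImD ImN.
have b1 := Arg_bounds (z - A%:C); have b2 := Arg_bounds (z - B%:C).
have [i0|i0] := lerP 0 (Im z).
  have -> : \int[lebesgue_measure]_(x in D) (wt x * poisson z x) =
     \int[lebesgue_measure]_(x in D) (-1 * Im ((wt x)%:C * kern z x)).
    apply: eq_Rintegral => x _; rewrite ImC_mul Im_kern /poisson ger0_norm//; ring.
  have zi0 : 0 < `|Im z| by rewrite normr_gt0.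
  have im := bm_Im_integrable hab (bm_wtkern zi0 (away_Im z)).
  by rewrite RintegralZl// h; lra.
have -> : \int[lebesgue_measure]_(x in D) (wt x * poisson z x) =
   \int[lebesgue_measure]_(x in D) Im ((wt x)%:C * kern z x).
  by apply: eq_Rintegral => x _; rewrite ImC_mul Im_kern /poisson ltr0_norm.
rewrite h; lra.
Qed.

(** * The continuation of the Cauchy transform *)

Hypothesis hint : (\int[lebesgue_measure]_(x in `]a, b[)
  (gpfp_pdf a b alpha l x)%:E)%E = 1%E.

Lemma Rintegral_dens : \int[lebesgue_measure]_(x in D) dens x = 1.
Proof.
rewrite /Rintegral -[RHS]/(fine 1%E) -hint; congr fine.
by apply: eq_integral => x; rewrite inE inD => hx; rewrite gpfp_pdfE.
Qed.

Lemma Im_G_sign z : Im z != 0 -> exists2 s : R, 0 < s & Im (G z) = - Im z * s.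
Proof.
move=> zi; have i0 : 0 < `|Im z| by rewrite normr_gt0.
have bk := bm_densK i0 (away_Im z).
have ik : lebesgue_measure.-integrable D (EFin \o (fun x => dens x * poisson z x)).
  apply: (@bounded_integrable _ _ _ hab _ (gbound * wt a * `|Im z|^-1)).
    by apply: measurable_funM; [apply: measurable_funM; [exact: measurable_greal|exact: measurable_wt]|exact: measurable_poisson].
  move=> x; rewrite inD => hx.
  have dp0 : 0 <= dens x * poisson z x by rewrite mulr_ge0 ?dens_ge0 ?poisson_ge0.
  rewrite ger0_norm//.
  by rewrite ler_pM ?dens_ge0 ?poisson_ge0 ?dens_le ?poisson_le.
have idn : lebesgue_measure.-integrable D (EFin \o dens).
  exact: (bm_Re_integrable hab bm_dens).
pose k := `|Im z| / (normc z + B) ^+ 2.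
have zB : 0 < normc z + B by rewrite ltr_wpDl ?normc_ge0 ?B_gt0.
have k0 : 0 < k by rewrite divr_gt0 ?exprn_gt0.
have kS : k <= \int[lebesgue_measure]_(x in D) (dens x * poisson z x).
  rewrite -[k]mulr1 -Rintegral_dens -RintegralZl//; have ikd : lebesgue_measure.-integrable D (EFin \o (fun x => k * dens x)).
    rewrite (_ : EFin \o _ = fun x => (k%:E * (EFin \o dens) x)%E)//.
    exact: integrableZl.
  apply: (le_Rintegral _ ikd ik) => // x; rewrite inD => hx; rewrite mulrC ler_wpM2l ?dens_ge0//.
  rewrite /k /poisson ler_wpM2l ?normr_ge0// lef_pV2 ?posrE ?exprn_gt0//; last first.
    exact: lt_le_trans (away_Im z hx).
  rewrite ler_sqr ?nnegrE ?normc_ge0 ?(ltW zB)//.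
  apply: le_trans (ler_normcB _ _) _; rewrite lerD2l normc_real ger0_norm ?phi_le//.
  by rewrite powR_ge0.
have s0 := lt_le_trans k0 kS.
have [p0|p0] := lerP 0 (Im z).
  exists (\int[lebesgue_measure]_(x in D) (dens x * poisson z x) / `|Im z|).
    by rewrite divr_gt0.
  rewrite (ger0_norm p0); set S := \int[_]_(x in _) (_ * _).
  have -> : - Im z * (S / Im z) = -1 * S by field.
  rewrite -RintegralZl//; apply: eq_Rintegral => x _.
  rewrite ImC_mul Im_kern /poisson ger0_norm//; ring.
exists (\int[lebesgue_measure]_(x in D) (dens x * poisson z x) / `|Im z|).
  by rewrite divr_gt0.
rewrite (ltr0_norm p0); set S := \int[_]_(x in _) (_ * _).
have -> : - Im z * (S / - Im z) = S by field.
apply: eq_Rintegral => x _.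
by rewrite ImC_mul Im_kern /poisson ltr0_norm//.
Qed.

Lemma Im_G_lt0 z : 0 < Im z -> Im (G z) < 0.
Proof.
move=> zi; have [|s s0 ->] := @Im_G_sign z; first by rewrite gt_eqF.
by rewrite mulNr oppr_lt0 mulr_gt0.
Qed.

Lemma Im_G_gt0 z : Im z < 0 -> 0 < Im (G z).
Proof.
move=> zi; have [|s s0 ->] := @Im_G_sign z; first by rewrite lt_eqF.
by rewrite mulr_gt0// oppr_gt0.
Qed.

Definition Lc z := Log (z - A%:C) - Log (B%:C - z) - 'i * pi%:C.
Definition Qd z x := (gdens z - (greal x)%:C) * kern z x.
(** Subtracting [gdens z] from the density removes the singularity of the
    Cauchy integral on the support, and the integral of the subtracted part is
    an explicit logarithm. The branch of the latter is the one for which the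
    two terms recombine to [G] on the upper half-plane. *)
Definition Gh z := gdens z * Lc z - cint a b (fun x => (wt x)%:C * Qd z x).

Lemma Gh_offline z : Im z != 0 -> Gh z = G z +
  gdens z * (Lc z - (Log (z - A%:C) - Log (z - B%:C))).
Proof.
move=> zi; have i0 : 0 < `|Im z| by rewrite normr_gt0.
have bk := bm_densK i0 (away_Im z); have bw := bm_wtkern i0 (away_Im z).
have e : cint a b (fun x => (wt x)%:C * Qd z x) =
    gdens z * (Log (z - A%:C) - Log (z - B%:C)) - G z.
  rewrite -(cint_wtkern zi) -(cintZ hab _ bw) /G -(cintB hab (bmM (bm_cst _ _ _) bw) bk).
  apply: eq_cint => x _; rewrite /Qd /dens (rmorphM _ (greal x) (wt x)); ring.
by rewrite /Gh e; ring.
Qed.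

Lemma Gh_up z : 0 < Im z -> Gh z = G z.
Proof.
move=> zi; have zi' : Im z != 0 by rewrite gt_eqF.
rewrite Gh_offline// /Lc.
have -> : z - B%:C = - (B%:C - z) by rewrite opprB.
rewrite LogN_neg; last by rewrite !ReImE sub0r oppr_lt0.
rewrite [X in gdens z * X](_ : _ = 0); first by rewrite mulr0 addr0.
ring.
Qed.

Lemma Gh_down z : Im z < 0 -> Gh z = G z - 2 * ('i * pi%:C) * gdens z.
Proof.
move=> zi; have zi' : Im z != 0 by rewrite lt_eqF.
rewrite Gh_offline// /Lc.
have -> : z - B%:C = - (B%:C - z) by rewrite opprB.
rewrite LogN_pos; last by rewrite !ReImE sub0r oppr_gt0.
ring.
Qed.

Lemma near_Im_gt0 z : 0 < Im z -> \forall y \near (z : C^o), 0 < Im y.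
Proof.
move=> h.
have ci : (fun y : C^o => Im y) @ nbhs (z : C^o) --> Im z by exact: clim_Im (ccont_id z).
exact: (cvgr_gt (Im z) ci).
Qed.

Lemma near_Im_lt0 z : Im z < 0 -> \forall y \near (z : C^o), Im y < 0.
Proof.
move=> h.
have ci : (fun y : C^o => Im y) @ nbhs (z : C^o) --> Im z by exact: clim_Im (ccont_id z).
exact: (cvgr_lt (Im z) ci).
Qed.

Lemma Cn_Gh z : Im z != 0 -> Cn 2 Gh z.
Proof.
move=> zi; have i0 : 0 < `|Im z| by rewrite normr_gt0.
have cG := Cn_G i0 (away_Im z).
have [h|h] : Im z < 0 \/ 0 < Im z by apply/orP; rewrite -neq_lt.
  apply: (@Cn_near _ _ (fun y => G y - 2 * ('i * pi%:C) * gdens y)).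
    by apply: filterS (near_Im_lt0 h) => y /Gh_down.
  apply: CnB => //; apply: CnM; first exact: Cn_cst.
  by apply: Cn_gdens; left; exact/eqP.
by apply: Cn_near cG; apply: filterS (near_Im_gt0 h) => y /Gh_up.
Qed.

Lemma Dom_slitA z : Dom z -> slit (z - A%:C).
Proof.
move=> [/eqP h|/andP[h _]]; first by apply: slit_Im; rewrite !ReImE subr0.
by apply/slitP; right; rewrite !ReImE subr_gt0.
Qed.

Lemma Dom_slitB z : Dom z -> slit (B%:C - z).
Proof.
move=> [/eqP h|/andP[_ h]]; first by apply: slit_Im; rewrite !ReImE sub0r oppr_eq0.
by apply/slitP; right; rewrite !ReImE subr_gt0.
Qed.

Lemma Cn_Lc n z : Dom z -> Cn n Lc z.
Proof.
move=> Dz; apply: CnB; last exact: Cn_cst.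
apply: CnB; apply: Cn_comp.
- by apply: CnB; [exact: Cn_id|exact: Cn_cst].
- exact: Cn_Log (Dom_slitA Dz).
- by apply: CnB; [exact: Cn_cst|exact: Cn_id].
- exact: Cn_Log (Dom_slitB Dz).
Qed.

Lemma cmeas_Qd z : cmeas a b (Qd z).
Proof.
apply: cmeasM; last by apply: cmeasV; apply: cmeasB (cmeas_cst _ _ _) bm_phi.1.
exact: cmeasB (cmeas_cst _ _ _) bm_greal.1.
Qed.

Lemma bm_Qd z : Dom z -> bm a b (Qd z).
Proof.
move=> Dz; split; first exact: cmeas_Qd.
have [L L0 [d d0 hL]] := Cn_lip (Cn_gdens 1 Dz).
exists (L + (normc (gdens z) + gbound) * d^-1) => x; rewrite inD => hx.
have gb := greal_le hx; have g0 := greal_ge0 x.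
have K0 : 0 <= (normc (gdens z) + gbound) * d^-1.
  by rewrite mulr_ge0 ?invr_ge0 ?(ltW d0)// addr_ge0 ?normc_ge0// (le_trans g0).
have [e|ne] := eqVneq z (phi x)%:C.
  have -> : Qd z x = 0 by rewrite /Qd /kern e subrr invr0 mulr0.
  by rewrite normc0 addr_ge0// ltW.
have n0 : 0 < normc (z - (phi x)%:C) by rewrite normc_gt0 subr_eq0.
have [zd|zd] := ltrP (normc (z - (phi x)%:C)) d.
  rewrite ler_wpDr// /Qd /kern normcM normcV ler_pdivrMr// -gdens_phi//.
  by apply: hL; rewrite ?subrr ?normc0// normcB.
rewrite ler_wpDl ?(ltW L0)// /Qd /kern normcM normcV ler_pM ?normc_ge0 ?invr_ge0 ?normc_ge0//.
  by apply: le_trans (ler_normcB _ _) _; rewrite lerD2l normc_real ger0_norm.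
by rewrite lef_pV2 ?posrE.
Qed.

Lemma bm_wtQd z : Dom z -> bm a b (fun x => (wt x)%:C * Qd z x).
Proof. by move=> Dz; exact: bmM bm_wt (bm_Qd Dz). Qed.

(** * Differentiability of the continuation on the support *)

Lemma Rintegral_D_set1 x0 (K : R) :
  \int[lebesgue_measure]_(x in D) (K * \1_[set x0] x) = 0.
Proof.
rewrite RintegralZl//; last first.
  apply: (@bounded_integrable _ _ _ hab _ 1) => //.
  by move=> x _; rewrite indicE ger0_norm// lern1 leq_b1.
rewrite /Rintegral integral_indic//= (_ : fine _ = 0) ?mulr0//.
suff -> : lebesgue_measure ([set x0] `&` D) = 0%E by [].
apply/eqP; rewrite -measure_le0 -(lebesgue_measure_set1 x0).
by apply: le_measure; rewrite ?inE//; exact: measurableI.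
Qed.

(** The two exceptional points are those where the denominators of the difference
    quotients vanish. *)
Lemma normc_cint_off (h : R -> C) (k : R -> R) (K x0 x1 : R) : bm a b h ->
  measurable_fun D k -> (forall x, D x -> 0 <= k x <= K) ->
  (forall x, D x -> x != x0 -> x != x1 -> normc (h x) <= k x) ->
  normc (cint a b h) <= 2 * \int[lebesgue_measure]_(x in D) k x.
Proof.
move=> bh mk kK hk; have [_ [H hH]] := bh.
have H0 : 0 <= `|H| by [].
pose k0 y x : R := `|H| * \1_[set y] x.
have k00 y x : 0 <= k0 y x by rewrite mulr_ge0.
have k0le y x : k0 y x <= `|H|.
  by rewrite /k0 indicE ler_piMr//= lern1 leq_b1.
have mk0 y : measurable_fun D (k0 y) by apply: measurable_funM.
have ik0 y : lebesgue_measure.-integrable D (EFin \o k0 y).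
  by apply: (@bounded_integrable _ _ _ hab _ `|H|) => // x _; rewrite ger0_norm.
have ik : lebesgue_measure.-integrable D (EFin \o k).
  apply: (@bounded_integrable _ _ _ hab _ K) => // x /kK/andP[kx0 kxK].
  by rewrite ger0_norm.
have ik1 : lebesgue_measure.-integrable D (EFin \o (fun x => k x + k0 x0 x)).
  apply: (@bounded_integrable _ _ _ hab _ (K + `|H|)); first exact: measurable_funD.
  move=> x /kK/andP[kx0 kxK].
  by rewrite ger0_norm ?lerD// addr_ge0.
have -> : \int[lebesgue_measure]_(x in D) k x =
    \int[lebesgue_measure]_(x in D) (k x + k0 x0 x + k0 x1 x).
  by rewrite RintegralD// RintegralD// !Rintegral_D_set1 !addr0.
apply: (@normc_cint _ _ _ hab _ _ (K + `|H| + `|H|)) => //.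
- by apply: measurable_funD => //; exact: measurable_funD.
- move=> x Dx; have /andP[kx0 kxK] := kK x Dx.
  have hx : normc (h x) <= `|H| by apply: le_trans (hH x Dx) (ler_norm _).
  have [e0|n0] := eqVneq x x0.
    apply: le_trans hx _; have -> : k0 x0 x = `|H|.
      by rewrite /k0 indicE mem_set ?mulr1//= e0.
    by have := k00 x1 x; lra.
  have [e1|n1] := eqVneq x x1.
    apply: le_trans hx _; have -> : k0 x1 x = `|H|.
      by rewrite /k0 indicE mem_set ?mulr1//= e1.
    by have := k00 x0 x; lra.
  by have := hk x Dx n0 n1; have := k00 x0 x; have := k00 x1 x; lra.
- move=> x Dx; have /andP[kx0 kxK] := kK x Dx.
  by have := k0le x0 x; have := k0le x1 x; lra.
Qed.

Lemma phi_inj x y : 0 < x -> 0 < y -> phi x = phi y -> x = y.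
Proof. by move=> x0 y0 e; rewrite -(phiK x0) -(phiK y0) e. Qed.

(** The support is split at the distance [rho] from [z0]. On the near part the
    error of the linear approximation is at most a constant times [rho] times the
    increment times a Poisson kernel, hence of small slope after
    integration; on the far part it is quadratic in the increment. *)
Lemma cder_I_cut z0 : Im z0 = 0 -> A < Re z0 < B ->
  exists c, cder (fun z => cint a b (fun x => (wt x)%:C * Qd z x)) z0 c.
Proof.
move=> im0 re0; have D0 : Dom z0 by right.
have zE : z0 = (Re z0)%:C by apply: complexP.
have z00 : 0 < Re z0 by case/andP: re0 => h _; exact: lt_trans A_gt0 h.
pose x0 := Re z0 `^ (- q).
have x00 : 0 < x0 by rewrite powR_gt0.
have phx0 : phi x0 = Re z0 by exact: powqK.
have [M M0 [c1 [d d0 [dg hrm hdd]]]] := Cn_divdiff2 (Cn_gdens 2 D0).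
pose rem z := gdens z - gdens z0 - c1 * (z - z0).
(* The derivative in [z], at [z0], of the difference quotient
   [(gdens z - gdens y) / (z - y)]. *)
pose N0 x := (c1 * (z0 - (phi x)%:C) - (gdens z0 - (greal x)%:C)) * kern z0 x ^+ 2.
(* bounds of the remainder along the support *)
have remE x : a < x < b -> rem (phi x)%:C =
    - ((gdens z0 - (greal x)%:C) - c1 * (z0 - (phi x)%:C)).
  by move=> hx; rewrite /rem gdens_phi//; ring.
pose Kr := gbound + normc (gdens z0) + normc c1 * (B + normc z0).
have remK x : a < x < b -> normc (rem (phi x)%:C) <= Kr.
  move=> hx; rewrite /rem gdens_phi//.
  apply: le_trans (ler_normcB _ _) _; rewrite lerD//.
    apply: le_trans (ler_normcB _ _) _; rewrite lerD2r normc_real ger0_norm ?greal_ge0//.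
    exact: greal_le.
  rewrite normcM ler_wpM2l ?normc_ge0//; apply: le_trans (ler_normcB _ _) _.
  by rewrite lerD2r normc_real ger0_norm ?phi_le// powR_ge0.
have Kr0 : 0 <= Kr.
  have m : a < (a + b) / 2 < b by have := hab; lra.
  by apply: le_trans (remK _ m); exact: normc_ge0.
have neq x : a < x < b -> x != x0 -> z0 - (phi x)%:C != 0.
  move=> hx xx0; rewrite subr_eq0 zE; apply: contra xx0 => /eqP[e].
  apply/eqP; apply: phi_inj => //; last by rewrite phx0 e.
  by case/andP: hx => h _; exact: lt_trans ha h.
have bmN0 : bm a b N0.
  split.
    apply: cmeasM; last first.
      have ck : cmeas a b (kern z0) by apply: cmeasV; apply: cmeasB (cmeas_cst _ _ _) bm_phi.1.
      by apply: eq_cmeas (cmeasM ck ck) => x _; rewrite expr2.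
    apply: cmeasB; last exact: cmeasB (cmeas_cst _ _ _) bm_greal.1.
    by apply: cmeasM (cmeas_cst _ _ _) _; apply: cmeasB (cmeas_cst _ _ _) bm_phi.1.
  exists (M + Kr * d^-1 ^+ 2) => x; rewrite inD => hx.
  have Kd : 0 <= Kr * d^-1 ^+ 2 by rewrite mulr_ge0 ?exprn_ge0 ?invr_ge0 ?(ltW d0).
  have N0E : N0 x = rem (phi x)%:C * kern z0 x ^+ 2 by rewrite remE// /N0; ring.
  have [xx0|xx0] := eqVneq x x0.
    have -> : N0 x = 0.
      rewrite N0E /kern (_ : z0 - _ = 0) ?invr0 ?expr0n/= ?mulr0//.
      by rewrite xx0 phx0 -zE subrr.
    by rewrite normc0 addr_ge0 ?(ltW M0).
  have n0 : 0 < normc (z0 - (phi x)%:C) by rewrite normc_gt0 neq.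
  rewrite N0E normcM normcX /kern normcV.
  have [xd|xd] := ltrP (normc ((phi x)%:C - z0)) d.
    rewrite ler_wpDr// exprVn ler_pdivrMr ?exprn_gt0// [normc (z0 - _)]normcB.
    exact: hrm.
  rewrite ler_wpDl ?(ltW M0)// ler_pM ?normc_ge0 ?exprn_ge0 ?invr_ge0 ?normc_ge0 ?remK//.
  by rewrite ler_pXn2r ?nnegrE ?invr_ge0 ?normc_ge0 ?(ltW d0)// lef_pV2 ?posrE// normcB.
have bmwN0 : bm a b (fun x => (wt x)%:C * N0 x) by exact: bmM bm_wt bmN0.
exists (cint a b (fun x => (wt x)%:C * N0 x)).
apply/cder_eps => e e0.
have pi0 := @pi_gt0 R.
pose rho := Num.min d (e / (64 * M * pi)).
have rho0 : 0 < rho by rewrite lt_min d0 divr_gt0 ?mulr_gt0.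
have rhod : rho <= d by rewrite ge_min lexx.
have rhoe : 32 * M * pi * rho <= e / 2.
  have : rho <= e / (64 * M * pi) by rewrite ge_min lexx orbT.
  by rewrite ler_pdivlMr ?mulr_gt0//; lra.
pose Cr := M * 2 / rho + Kr * 2 / rho ^+ 3.
have Cr0 : 0 <= Cr.
  by rewrite /Cr addr_ge0// mulr_ge0 ?mulr_ge0 ?invr_ge0 ?exprn_ge0 ?(ltW M0) ?(ltW rho0).
have wa0 : 0 < wt a by exact: wt_gt0.
pose T := 2 * (b - a) * (Cr * wt a) + 1.
have ba0 : 0 < b - a by rewrite subr_gt0.
have T0 : 0 < T by rewrite ltr_wpDl// mulr_ge0// mulr_ge0// ltW.
pose d' := Num.min (rho / 2) (e / (2 * T)).
have d'0 : 0 < d' by rewrite lt_min !divr_gt0 ?mulr_gt0.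
apply: filterS2 (Dom_open D0) (near_normc z0 d'0) => z Dz.
rewrite lt_min => /andP[hz1 hz2].
have bz := bm_wtQd Dz; have bz0 := bm_wtQd D0.
set h := z - z0 in hz1 hz2 *.
pose E x := (wt x)%:C * (Qd z x - Qd z0 x - h * N0 x).
have bE : bm a b E.
  apply: bmM bm_wt _; apply: bmB; first exact: bmB (bm_Qd Dz) (bm_Qd D0).
  exact: bmM (bm_cst _ _ _) bmN0.
have -> : cint a b (fun x => (wt x)%:C * Qd z x) - cint a b (fun x => (wt x)%:C * Qd z0 x) -
   cint a b (fun x => (wt x)%:C * N0 x) * h = cint a b E.
  rewrite [_ * h]mulrC -(cintZ hab h bmwN0) -(cintB hab bz bz0).
  rewrite -(cintB hab (bmB bz bz0) (bmM (bm_cst _ _ h) bmwN0)).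
  by apply: eq_cint => x _; rewrite /E; ring.
have h0 := normc_ge0 h.
pose pt := z0 + 'i * rho%:C.
have Impt : Im pt = rho by rewrite !ReImE im0; ring.
have Impt0 : Im pt != 0 by rewrite Impt gt_eqF.
pose x1 := if Im z == 0 then Re z `^ (- q) else a.
pose k x : R := wt x * (2 * M * normc h * (2 * rho) * poisson pt x + Cr * normc h ^+ 2).
have Mh : 0 <= 2 * M * normc h * (2 * rho).
  by rewrite !mulr_ge0 ?(ltW M0) ?(ltW rho0).
have Ch : 0 <= Cr * normc h ^+ 2 by rewrite mulr_ge0 ?exprn_ge0.
have mk1 : measurable_fun D (fun x => wt x * poisson pt x).
  by apply: measurable_funM; [exact: measurable_wt|exact: measurable_poisson].
have hE x : D x -> x != x0 -> x != x1 -> normc (E x) <= k x.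
  rewrite inD => hx xx0 xx1.
  have y0 : z0 - (phi x)%:C != 0 by exact: neq.
  have y1 : z - (phi x)%:C != 0.
    apply/eqP => /eqP; rewrite subr_eq0 => /eqP ze; move: xx1.
    by rewrite /x1 ze ImC ReC eqxx phiK ?eqxx//; case/andP: hx => hxa _; exact: lt_trans ha hxa.
  have xw := wt_ge0 hx.
  rewrite /E normcM normc_real ger0_norm// /k ler_wpM2l//.
  set y := (phi x)%:C in y0 y1 *.
  have ry := remE x hx; rewrite -/y in ry.
  have Erep : Qd z x - Qd z0 x - h * N0 x =
     (rem z * (z0 - y) ^+ 2 - rem y * h ^+ 2) / ((z0 - y) ^+ 2 * (z - y)).
    rewrite /Qd /N0 /kern -/y ry /rem /h; field.
    by rewrite y0 y1.
  have P0 := poisson_ge0 pt x.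
  have zd : normc (z - z0) < d.
    by apply: lt_le_trans hz1 _; lra.
  have rz := hrm z zd; rewrite -/(rem z) in rz.
  rewrite Erep; have [yr|yr] := ltrP (normc (y - z0)) rho.
    have yd : normc (y - z0) < d := lt_le_trans yr rhod.
    rewrite ler_wpDr//; have npt : normc (pt - y) ^+ 2 = normc (y - z0) ^+ 2 + rho ^+ 2.
      rewrite !sqr_normcE /pt /y !ReImE im0; ring.
    rewrite /poisson npt Impt (gtr0_norm rho0).
    exact: divdiff_near M0 rho0 y0 y1 yr (hdd z y zd yd) (hrm y yd).
  rewrite ler_wpDl ?(mulr_ge0 Mh P0)//.
  exact: divdiff_far M0 Kr0 rho0 y0 y1 yr hz1 rz (remK x hx).
have kint : \int[lebesgue_measure]_(x in D) k x <=
   2 * M * normc h * (2 * rho) * (2 * pi) + Cr * normc h ^+ 2 * (wt a * (b - a)).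
  have i1 : lebesgue_measure.-integrable D (EFin \o (fun x => wt x * poisson pt x)).
    apply: (@bounded_integrable _ _ _ hab _ (wt a * `|Im pt|^-1)) => // x; rewrite inD => hx.
    have P0 := poisson_ge0 pt x; have w0 := wt_ge0 hx.
    rewrite ger0_norm; last by rewrite mulr_ge0.
    by rewrite ler_pM ?wt_le ?poisson_le.
  have i2 : lebesgue_measure.-integrable D (EFin \o wt).
    exact: (bm_Re_integrable hab bm_wt).
  have iZ (g : R -> R) (c : R) : lebesgue_measure.-integrable D (EFin \o g) ->
      lebesgue_measure.-integrable D (EFin \o (fun x => c * g x)).
    move=> hp; rewrite (_ : EFin \o _ = fun x => (c%:E * (EFin \o g) x)%E)//.
    exact: integrableZl.
  have -> : \int[lebesgue_measure]_(x in D) k x = \int[lebesgue_measure]_(x in D)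
     (2 * M * normc h * (2 * rho) * (wt x * poisson pt x) + Cr * normc h ^+ 2 * wt x).
    by apply: eq_Rintegral => x _; rewrite /k; ring.
  rewrite RintegralD//; [|exact: iZ|exact: iZ].
  have eZ (g : R -> R) (c : R) : lebesgue_measure.-integrable D (EFin \o g) ->
      \int[lebesgue_measure]_(x in D) (c * g x) = c * \int[lebesgue_measure]_(x in D) g x.
    by move=> ig; rewrite RintegralZl.
  rewrite (eZ _ _ i1) (eZ _ _ i2).
  apply: lerD; first by rewrite ler_wpM2l// Rintegral_poisson.
  rewrite ler_wpM2l//.
  apply: (@le_trans _ _ (\int[lebesgue_measure]_(x in D) wt a)).
    have i3 : lebesgue_measure.-integrable D (EFin \o (fun=> wt a)).
      apply: (@bounded_integrable _ _ _ hab _ (wt a)) => // x _.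
      by rewrite ger0_norm// ltW.
    by apply: (le_Rintegral _ i2 i3) => // x; rewrite inD => hx; exact: wt_le.
  by rewrite Rintegral_cst//= lebesgue_measure_itv/= lte_fin hab -EFinB/=.
have kb x : D x -> 0 <= k x <= wt a * (2 * M * normc h * (2 * rho) * `|Im pt|^-1 + Cr * normc h ^+ 2).
  rewrite inD => hx; have P0 := poisson_ge0 pt x; have w0 := wt_ge0 hx.
  have s0 : 0 <= 2 * M * normc h * (2 * rho) * poisson pt x + Cr * normc h ^+ 2.
    by rewrite addr_ge0// mulr_ge0.
  rewrite /k mulr_ge0//= ler_pM// ?wt_le//.
  by rewrite lerD2r ler_wpM2l// poisson_le.
have mk : measurable_fun D k.
  apply: measurable_funM; first exact: measurable_wt.
  apply: measurable_funD => //; apply: measurable_funM => //; exact: measurable_poisson.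
apply: le_trans (normc_cint_off bE mk kb hE) _.
have Th : T * normc h <= e / 2.
  have := hz2; rewrite ltr_pdivlMr ?mulr_gt0//; lra.
have t1 : 32 * M * pi * rho * normc h <= e / 2 * normc h by rewrite ler_wpM2r.
have t2 : T * normc h * normc h <= e / 2 * normc h by rewrite ler_wpM2r.
have t3 : 0 <= 2 * M * pi * rho * normc h by rewrite !mulr_ge0 ?(ltW M0) ?(ltW rho0) ?(ltW pi0).
move: kint t2; rewrite /T expr2.
have : 0 <= normc h * normc h by rewrite mulr_ge0.
lra.
Qed.

Lemma smooth_Gh z : Dom z -> smooth_at Gh z.
Proof.
move=> Dz; have [i0|i0] := eqVneq (Im z) 0; last by left; exact: Cn_Gh.
right; split=> //; case: (Dz) => [/eqP|re]; first by rewrite i0 eqxx.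
have [c hc] := cder_I_cut i0 re.
have [c' hc'] := Cn_cder (CnM (Cn_gdens 1 Dz) (Cn_Lc 1 Dz)).
by exists (c' - c); exact: cderB.
Qed.

(** * Boundary behaviour of the density *)

Lemma sqr_rootS z : Dom z -> rootS z ^+ 2 = (b%:C - zeta z) * (zeta z - a%:C).
Proof. by move=> /zeta_slit[s1 s2]; rewrite exprMn !sqr_csqrt. Qed.

Lemma Re_sqrt_sqr w : 2 * Re w ^+ 2 = normc (w ^+ 2) + Re (w ^+ 2).
Proof. rewrite normcX sqr_normcE expr2 !ReImE; ring. Qed.

(** Next to a positive boundary point the square of [rootS] is close to the
    negative half-axis, so that the density is close to the imaginary axis. *)
Lemma Re_gdens_pos (e eta : R) : 0 < e -> ~~ (A < e < B) -> 0 < eta ->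
  \forall y \near (e%:C : C^o), Dom y -> `|Re (gdens y)| < eta.
Proof.
move=> e0 eAB eta0; have es := slit_real e0.
pose P y := (b%:C - zeta y) * (zeta y - a%:C).
pose m y := q%:C * y^-1 * gsum y.
have cz : ccont zeta e%:C := Cn_ccont (Cn_zeta 0 es).
have cP : ccont P e%:C.
  by apply: ccontM; apply: ccontB => //; exact: ccont_cst.
have cm : ccont m e%:C.
  apply: ccontM; last exact: Cn_ccont (Cn_gsum 0 es).
  by apply: ccontM; [exact: ccont_cst|apply: ccontV; [exact: slit_neq0|exact: ccont_id]].
have Pe : normc (P e%:C) + Re (P e%:C) = 0.
  rewrite /P zeta_real// -!rmorphB -rmorphM normc_real ReC ler0_norm ?addNr//.
  have [le|lt] := lerP e A.
    have h : b <= e `^ (- q).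
      rewrite -{1}(phiK hb); apply: ler_powRN => //; rewrite oppr_le0 ltW//; exact: q_gt0.
    by rewrite mulr_le0_ge0 ?subr_le0 ?subr_ge0// (le_trans _ h) ?ltW.
  have h : e `^ (- q) <= a.
    rewrite -[leRHS](phiK ha); apply: ler_powRN; rewrite ?oppr_le0 ?(ltW q_gt0) ?B_gt0//.
    by move: eAB; rewrite lt /= -leNgt.
  by rewrite mulr_ge0_le0 ?subr_le0 ?subr_ge0// (le_trans h) ?ltW.
have me : Im (m e%:C) = 0.
  have -> : m e%:C = (q * e^-1 * \sum_(k < N) alpha k * e `^ (q * l k))%:C.
    rewrite /m /gsum !rmorphM rmorph_sum fmorphV; congr (_ * _).
    by apply: eq_bigr => k _; rewrite cpow_real// rmorphM.
  by [].
pose Km := normc (m e%:C) + 1.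
have Km0 : 0 < Km by rewrite ltr_wpDl// normc_ge0.
pose KS := b + 1 + normc (zeta e%:C) .
have KS0 : 0 < KS by have := normc_ge0 (zeta e%:C); have := hb; rewrite /KS; lra.
have lim1 : (fun y : C^o => normc (P y) + Re (P y)) @ nbhs (e%:C : C^o) --> (0 : R).
  rewrite -Pe; have h1 : (fun y : C^o => normc (P y)) @ nbhs (e%:C : C^o) --> normc (P e%:C).
    exact: clim_normc cP.
  have h2 : (fun y : C^o => Re (P y)) @ nbhs (e%:C : C^o) --> Re (P e%:C) by exact: clim_Re cP.
  exact: cvgD h1 h2.
have lim2 : (fun y : C^o => Im (m y)) @ nbhs (e%:C : C^o) --> (0 : R).
  by rewrite -me; exact: clim_Im cm.
pose s := eta / (4 * Km).
have s0 : 0 < s by rewrite divr_gt0 ?mulr_gt0.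
have n1 : \forall y \near (e%:C : C^o), normc (P y) + Re (P y) < 2 * s ^+ 2.
  by apply: (cvgr_lt 0 lim1); rewrite mulr_gt0 ?exprn_gt0.
have t0 : 0 < eta / (4 * KS) by rewrite divr_gt0 ?mulr_gt0.
have n2 : \forall y \near (e%:C : C^o), `|Im (m y)| < eta / (4 * KS).
  have := (cvgr_norm_lt _ lim2); apply; by rewrite normr0.
have n3 := ccont_bounded cm; have n4 := ccont_bounded cz.
apply: filterS3 (filterI n1 n2) n3 n4 => y [h1 h2] h3 h4 Dy.
have h5 : normc (rootS y) <= KS.
  apply: le_trans (normc_rootS_le Dy) _; rewrite /KS; lra.
have h6 : `|Re (rootS y)| < s.
  rewrite -ltr_sqr ?nnegrE ?(ltW s0)// real_normK ?num_real//.
  have := Re_sqrt_sqr (rootS y); rewrite sqr_rootS// -/(P y); lra.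
have -> : gdens y = m y * rootS y by rewrite /gdens /m /gsum; ring.
rewrite ReM; apply: le_lt_trans (ler_normB _ _) _; rewrite !normrM.
have k1 : `|Re (m y)| * `|Re (rootS y)| <= Km * s.
  by rewrite ler_pM// ?(ltW h6)// (le_trans (normc_Re _)).
have k2 : `|Im (m y)| * `|Im (rootS y)| <= eta / (4 * KS) * KS.
  by rewrite ler_pM// ?(ltW h2)// (le_trans (normc_Im _)).
have e1 : Km * s = eta / 4 by rewrite /s; field; rewrite gt_eqF.
have e2 : eta / (4 * KS) * KS = eta / 4 by field; rewrite gt_eqF.
lra.
Qed.

Lemma Log_zeta z : slit z -> Log (zeta z) = (- q)%:C * Log z.
Proof.
move=> zs; apply: Log_uniq => //.
rewrite ImC_mul /=; have := Arg_bounds z; have := q_gt0; have := q_le1 => q1 q0 /andP[A1 A2].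
have k1 : q * Arg z < pi.
  have [h|h] := lerP 0 (Arg z); first by apply: le_lt_trans A2; rewrite ler_piMl.
  by apply: lt_trans (pi_gt0 R); rewrite pmulr_rlt0.
have k2 : - pi < q * Arg z.
  have [h|h] := lerP 0 (Arg z).
    by apply: (@lt_le_trans _ _ 0); [rewrite oppr_lt0 pi_gt0|rewrite mulr_ge0 ?(ltW q0)].
  have : 0 <= (1 - q) * - Arg z by rewrite mulr_ge0 ?subr_ge0 ?oppr_ge0 ?(ltW h).
  lra.
by apply/andP; rewrite mulNr; lra.
Qed.

Lemma Arg_zeta z : slit z -> Arg (zeta z) = - q * Arg z.
Proof. by move=> zs; have := congr1 Im (Log_zeta zs); rewrite ImC_mul. Qed.

Definition term (k : 'I_N) z := cpow z (q * l k - 1) * rootS z.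

Lemma gdens_term z : slit z -> gdens z = q%:C * \sum_(k < N) (alpha k)%:C * term k z.
Proof.
move=> zs; rewrite /gdens -mulrA; congr (_ * _); rewrite !mulr_sumr.
by apply: eq_bigr => k _; rewrite /term cpowD cpowN1//; ring.
Qed.

Lemma ql_bounds k : 0 <= q * l k <= 1.
Proof.
have /andP[l0 l1] := hl01 k; have q0 := q_gt0; have q1 := q_le1.
rewrite mulr_ge0 ?(ltW q0)//=; apply: le_trans q1; by rewrite ler_piMr// ltW.
Qed.

Lemma normc_term k z : Dom z ->
  normc (term k z) <= (b + 1) * (1 + (normc z)^-1) ^+ 2.
Proof.
move=> Dz; have zs := Dom_slit Dz; have n0 := slit_normc zs.
have q0 := q_gt0; have q1 := q_le1; have b0 := hb.
set n := normc z in n0 *.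
have i0 : 0 < n^-1 by rewrite invr_gt0.
have k1 : normc (rootS z) <= (b + 1) * (1 + n^-1).
  apply: le_trans (normc_rootS_le Dz) _; rewrite normc_zeta//.
  have : n `^ (- q) <= 1 + n^-1 by apply: powR_le1DV => //; apply/andP; lra.
  have : 0 <= b * n^-1 by rewrite mulr_ge0 ?ltW.
  lra.
rewrite /term normcM normc_cpow// mulrC expr2 mulrA ler_pM ?normc_ge0 ?powR_ge0//.
apply: powR_le1DV => //; have := ql_bounds k => /andP[? ?]; apply/andP; lra.
Qed.

(** The argument of [rootS]. *)
Definition sigma z := 2^-1 * (Arg (b%:C - zeta z) + Arg (zeta z - a%:C)).

Lemma rootS_cexp z : rootS z =
  cexp (2^-1%:C * (Log (b%:C - zeta z) + Log (zeta z - a%:C))).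
Proof. by rewrite mulrDr cexpD. Qed.

Lemma Re_rootS z : Re (rootS z) = normc (rootS z) * cos (sigma z).
Proof. by rewrite rootS_cexp normc_cexp Re_cexp ImC_mul ImD. Qed.

Lemma Im_rootS z : Im (rootS z) = normc (rootS z) * sin (sigma z).
Proof. by rewrite rootS_cexp normc_cexp Im_cexp ImC_mul ImD. Qed.

Lemma Re_term k z : slit z ->
  Re (term k z) = normc (term k z) * cos ((q * l k - 1) * Arg z + sigma z).
Proof.
move=> zs; rewrite /term /cpow rootS_cexp -cexpD normc_cexp Re_cexp ImD ImC_mul.
by rewrite ImC_mul ImD.
Qed.

(** On the lower half-plane both factors of [rootS] are explicit: [zeta z] lies above
    the real axis, and subtracting a positive real number increases its
    argument. *)
Lemma sigma_bounds z : Im z < 0 -> - q * Arg z - pi / 2 <= sigma z < pi / 2.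
Proof.
move=> zi; have zs := slit_neg zi; have iz := Im_zeta_gt0 zi.
have := Arg_le iz (ltW ha); have := Arg_le iz (ltW hb).
have ib : 0 < Im (zeta z - b%:C) by rewrite !ReImE subr0.
have eb : Arg (b%:C - zeta z) = Arg (zeta z - b%:C) - pi.
  have := congr1 Im (LogN_pos ib); rewrite opprB ImD ImN => e; rewrite -[LHS]/(Im (Log _)) e.
  by rewrite !ReImE /=; ring.
rewrite Arg_zeta// /sigma eb.
have /andP[_ h1] := Arg_bounds (zeta z - b%:C).
have /andP[_ h2] := Arg_bounds (zeta z - a%:C).
by move=> k1 k2; apply/andP; lra.
Qed.

Lemma Re_rootS_gt0 z : Im z < 0 -> 0 < Re (rootS z).
Proof.
move=> zi; have /andP[s1 s2] := sigma_bounds zi.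
have A0 := Arg_lt0 zi; have q0 := q_gt0.
have : 0 < - q * Arg z by rewrite mulNr -mulrN mulr_gt0// oppr_gt0.
move=> h; rewrite Re_rootS mulr_gt0//.
  by rewrite normc_gt0 rootS_cexp cexp_neq0.
by apply: cos_gt0_pihalf; apply/andP; lra.
Qed.

Lemma Re_gdens_sum_le z (c : R) : slit z ->
  (forall k, Re (term k z) <= c) -> Re (gdens z) <= q * (alphas * c).
Proof.
move=> zs h; rewrite gdens_term// ReC_mul ler_wpM2l ?(ltW q_gt0)//.
rewrite /alphas mulr_suml.
elim/big_ind2 : _ => [|x1 x2 y1 y2 h1 h2|k _]; first by rewrite Re0.
  by rewrite ReD lerD.
by rewrite ReC_mul ler_wpM2l ?(ltW (halpha k)).
Qed.

(** Below the negative axis, at an angle [t] from the positive one, the argument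
    of the term lies within [pi / 2] of [t]; so its cosine is at most [sin t]. *)
Lemma Re_term_neg k z : Im z < 0 -> Re z < 0 ->
  Re (term k z) <= normc (term k z) * (`|Im z| / normc z).
Proof.
move=> zi zr; have zs := slit_neg zi; have n0 := slit_normc zs.
have [hc hs] := cos_sin_Arg zs.
rewrite Re_term// ler_wpM2l ?normc_ge0//.
have A0 := Arg_lt0 zi; have /andP[A1 _] := Arg_bounds z.
set t := - Arg z.
have st : sin t = `|Im z| / normc z by rewrite /t sinN hs ltr0_norm// mulNr.
have ct : cos t < 0 by rewrite /t cosN hc pmulr_llt0 ?invr_gt0.
have t2 : pi / 2 < t.
  rewrite ltNge; apply/negP => h; move: ct; apply/negP; rewrite -leNgt.
  by apply: cos_ge0_pihalf; have := pi_gt0 R; move: h; rewrite /t; lra.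
rewrite -st.
have /andP[s1 s2] := sigma_bounds zi; have /andP[l0 l1] := hl01 k.
have q0 := q_gt0; have q1 := q_le1.
set psi := _ + _.
have psiE : psi = t * (1 - q * l k) + sigma z by rewrite /psi /t; ring.
have tp : 0 < t by rewrite /t oppr_gt0.
have p1 : t - pi / 2 <= psi.
  rewrite psiE; have : 0 <= q * t * (1 - l k).
    by rewrite !mulr_ge0 ?subr_ge0 ?(ltW q0) ?(ltW tp).
  have : - q * Arg z = q * t by rewrite /t; ring.
  move: s1 => + e; rewrite e; lra.
have p2 : psi < t + pi / 2.
  rewrite psiE; have : 0 <= t * (q * l k) by rewrite !mulr_ge0 ?(ltW q0) ?(ltW tp).
  lra.
have tpi : t < pi by rewrite /t; lra.
have -> : cos psi = - sin (psi - pi / 2) by rewrite sinBpihalf opprK.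
have [u0|u0] := lerP 0 (psi - pi / 2).
  have s0 : 0 <= sin (psi - pi / 2) by apply: sin_ge0_pi; apply/andP; lra.
  have : 0 <= sin t by apply: sin_ge0_pi; apply/andP; lra.
  lra.
rewrite -sinN.
have -> : sin t = sin (pi - t).
  by rewrite sinB sinpi cospi; ring.
have [->//|ne] := eqVneq (- (psi - pi / 2)) (pi - t).
apply: ltW; rewrite ltr_sin ?in_itv/=; last 2 first.
- by apply/andP; lra.
- by apply/andP; lra.
by rewrite lt_neqAle ne /=; lra.
Qed.

Lemma Re_gdens_neg (e eta : R) : e < 0 -> 0 < eta ->
  \forall y \near (e%:C : C^o), Im y < 0 -> Re (gdens y) < eta.
Proof.
move=> e0 eta0; pose n := - e / 2; have n0 : 0 < n by rewrite /n; lra.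
pose K := (b + 1) * (1 + n^-1) ^+ 2 * n^-1.
have K0 : 0 < K.
  have i0 : 0 < n^-1 by rewrite invr_gt0.
  by rewrite /K !mulr_gt0 ?exprn_gt0//; have := hb; lra.
pose T := q * (alphas * K) + 1.
have T0 : 0 < T.
  by rewrite ltr_wpDl//; apply: mulr_ge0 (ltW q_gt0) (mulr_ge0 alphas_ge0 (ltW K0)).
have d0 : 0 < Num.min n (eta / T) by rewrite lt_min n0 divr_gt0.
apply: filterS (near_normc e%:C d0) => y; rewrite lt_min => /andP[yn yT] yi.
have ys := slit_neg yi; have Dy : Dom y by left; apply/eqP; rewrite lt_eqF.
have yr : Re y < 0.
  have := Re_le_normc (y - e%:C); rewrite !ReImE; move: yn; rewrite /n; lra.
have ny : n <= normc y.
  have := normc_tri y e%:C 0; have := normc_tri e%:C y 0; rewrite !subr0 normc_real.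
  rewrite ltr0_norm// (normcB e%:C y); move: yn; rewrite /n; lra.
have iy : `|Im y| <= normc (y - e%:C).
  by apply: le_trans (normc_Im _); rewrite !ReImE subr0.
apply: (@le_lt_trans _ _ (q * (alphas * (K * normc (y - e%:C))))).
  apply: Re_gdens_sum_le => // k; apply: le_trans (Re_term_neg k yi yr) _.
  rewrite /K -mulrA ler_pM ?normc_ge0 ?mulr_ge0 ?invr_ge0 ?normc_ge0//.
    apply: le_trans (normc_term k Dy) _; rewrite ler_wpM2l//; first by have := hb; lra.
    rewrite ler_sqr ?nnegrE ?addr_ge0 ?invr_ge0 ?normc_ge0 ?(ltW n0)//.
    by rewrite lerD2l lef_pV2 ?posrE// slit_normc.
  rewrite mulrC ler_pM ?invr_ge0 ?normc_ge0//.
  by rewrite lef_pV2 ?posrE// slit_normc.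
move: yT; rewrite ltr_pdivlMr// /T; have := normc_ge0 (y - e%:C); lra.
Qed.

(** At infinity [zeta] tends to zero, so that [rootS] approaches the positive
    imaginary axis, while the powers of [z] have nonnegative imaginary parts. *)
Lemma Re_gdens_infty (eta : R) : 0 < eta ->
  exists2 M : R, 0 < M & forall z, Im z < 0 -> M < normc z -> Re (gdens z) < eta.
Proof.
move=> eta0; have q0 := q_gt0; have b0 := hb.
pose T := q * alphas + 1.
have T0 : 0 < T by rewrite ltr_wpDl// mulr_ge0 ?alphas_ge0 ?(ltW q0).
pose s := eta / T; have s0 : 0 < s by rewrite divr_gt0.
pose d := Num.min (Num.min 1 (a / 2)) (s ^+ 2 / (a + b + 1)).
have ab0 : 0 < a + b + 1 by have := ha; lra.
have d0 : 0 < d by rewrite !lt_min ltr01 !divr_gt0// exprn_gt0.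
exists (Num.max 1 (phi d)); first by rewrite lt_max ltr01.
move=> z zi; rewrite gt_max => /andP[z1 zd].
have zs := slit_neg zi; have Dz : Dom z by left; apply/eqP; rewrite lt_eqF.
have nz : normc (zeta z) < d.
  rewrite normc_zeta// -[ltRHS](phiK d0); apply: ltr_powRN => //; first by rewrite oppr_lt0.
  exact: phi_gt0.
move: nz; rewrite !lt_min => /andP[/andP[nz1 nz2] nz3].
set w := zeta z in nz1 nz2 nz3 *.
have w0 := normc_ge0 w.
have iw : 0 < Im w by exact: Im_zeta_gt0.
pose P := (b%:C - w) * (w - a%:C).
have SP : rootS z ^+ 2 = P by rewrite sqr_rootS.
have rS := Re_rootS_gt0 zi.
have iS : 0 < Im (rootS z).
  have : Im (rootS z ^+ 2) = 2 * Re (rootS z) * Im (rootS z) by rewrite expr2 ImM; ring.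
  have -> : Im (rootS z ^+ 2) = Im w * (a + b - 2 * Re w).
    by rewrite SP /P !ReImE; ring.
  have rw : Re w < a / 2 := le_lt_trans (Re_le_normc w) nz2.
  move=> e; have : 0 < Im w * (a + b - 2 * Re w) by rewrite mulr_gt0//; lra.
  by rewrite e pmulr_rgt0// mulr_gt0.
have rSs : Re (rootS z) < s.
  rewrite -ltr_sqr ?nnegrE ?(ltW rS) ?(ltW s0)//.
  have := Re_sqrt_sqr (rootS z); rewrite SP.
  pose dl := (a + b)%:C * w - w ^+ 2.
  have PE : P = - (a * b)%:C + dl by rewrite /P /dl rmorphD rmorphM; ring.
  have dlb : normc dl <= (a + b + 1) * normc w.
    apply: le_trans (ler_normcB _ _) _; rewrite normcM normcX normc_real ger0_norm; last by have := ha; lra.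
    have : normc w ^+ 2 <= normc w by rewrite expr2 ler_piMl// ltW.
    lra.
  have nP : normc P <= a * b + normc dl.
    rewrite PE; apply: le_trans (le_normcD _ _) _; rewrite normcN normc_real ger0_norm//.
    by rewrite mulr_ge0 ?ltW.
  have rP : Re P <= - (a * b) + normc dl.
    by rewrite PE ReD ReN ReC lerD2l Re_le_normc.
  have : (a + b + 1) * normc w < s ^+ 2 by rewrite -ltr_pdivlMl// mulrC.
  lra.
apply: (@le_lt_trans _ _ (q * (alphas * Re (rootS z)))).
  apply: Re_gdens_sum_le => // k; rewrite /term ReM.
  have /andP[ql0 ql1] := ql_bounds k.
  have nc : normc (cpow z (q * l k - 1)) <= 1.
    rewrite normc_cpow//; have := @ler_powR R (normc z) (ltW z1) (q * l k - 1) 0.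
    by rewrite powRr0; apply; rewrite subr_le0.
  have ic : 0 <= Im (cpow z (q * l k - 1)).
    rewrite Im_cpow// mulr_ge0 ?powR_ge0//; apply: sin_ge0_pi.
    have A0 := Arg_lt0 zi; have /andP[A1 _] := Arg_bounds z.
    have -> : (q * l k - 1) * Arg z = (1 - q * l k) * - Arg z by ring.
    rewrite mulr_ge0 ?subr_ge0 ?oppr_ge0 ?(ltW A0)//=.
    apply: (@le_trans _ _ (- Arg z)); last by lra.
    by rewrite ler_piMl ?oppr_ge0 ?(ltW A0)//; lra.
  have := mulr_ge0 ic (ltW iS).
  have : Re (cpow z (q * l k - 1)) * Re (rootS z) <= 1 * Re (rootS z).
    by rewrite ler_wpM2r ?(ltW rS)// (le_trans (Re_le_normc _)).
  lra.
have : q * (alphas * Re (rootS z)) <= q * (alphas * s).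
  by rewrite !ler_wpM2l ?alphas_ge0 ?(ltW q0) ?(ltW rSs).
have : T * s = eta by rewrite /s mulrC divfK// gt_eqF.
rewrite /T; lra.
Qed.

(** * Boundary behaviour of the continuation *)

Lemma integrable_dens_poisson z : Im z != 0 ->
  lebesgue_measure.-integrable D (EFin \o (fun x => dens x * poisson z x)).
Proof.
move=> zi; apply: (@bounded_integrable _ _ _ hab _ (gbound * wt a * `|Im z|^-1)).
  by apply: measurable_funM; [apply: measurable_funM; [exact: measurable_greal|exact: measurable_wt]|exact: measurable_poisson].
move=> x; rewrite inD => hx.
have dp0 : 0 <= dens x * poisson z x by rewrite mulr_ge0 ?dens_ge0 ?poisson_ge0.
rewrite ger0_norm//.
by rewrite ler_pM ?dens_ge0 ?poisson_ge0 ?dens_le ?poisson_le.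
Qed.

Lemma integrable_wt_poisson z : Im z != 0 ->
  lebesgue_measure.-integrable D (EFin \o (fun x => wt x * poisson z x)).
Proof.
move=> zi; apply: (@bounded_integrable _ _ _ hab _ (wt a * `|Im z|^-1)).
  by apply: measurable_funM; [exact: measurable_wt|exact: measurable_poisson].
move=> x; rewrite inD => hx; have P0 := poisson_ge0 z x; have w0 := wt_ge0 hx.
rewrite ger0_norm; last by rewrite mulr_ge0.
by rewrite ler_pM ?wt_le ?poisson_le.
Qed.

Lemma Im_G_poisson z : 0 < Im z ->
  Im (G z) = - \int[lebesgue_measure]_(x in D) (dens x * poisson z x).
Proof.
move=> zi; have zi' : Im z != 0 by rewrite gt_eqF.
have ik := integrable_dens_poisson zi'.
rewrite -[RHS]mulN1r -RintegralZl//; apply: eq_Rintegral => x _.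
rewrite ImC_mul Im_kern /poisson gtr0_norm//; ring.
Qed.

Lemma Rintegral_dens_poisson_le z (c K : R) : Im z != 0 -> 0 <= c ->
  (forall x, a < x < b -> dens x * poisson z x <= c * (wt x * poisson z x) + K) ->
  \int[lebesgue_measure]_(x in D) (dens x * poisson z x) <= c * (2 * pi) + K * (b - a).
Proof.
move=> zi c0 h; have ik := integrable_dens_poisson zi; have iw := integrable_wt_poisson zi.
have iz : lebesgue_measure.-integrable D (EFin \o (fun x => c * (wt x * poisson z x))).
  rewrite (_ : EFin \o _ = fun x => (c%:E * (EFin \o (fun t => (wt t * poisson z t)%R)) x)%E)//.
  exact: integrableZl.
have iK : lebesgue_measure.-integrable D (EFin \o (fun=> K)).
  by apply: (@bounded_integrable _ _ _ hab _ `|K|).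
have isum : lebesgue_measure.-integrable D (EFin \o (fun x => c * (wt x * poisson z x) + K)).
  rewrite (_ : EFin \o _ = ((EFin \o (fun x => (c * (wt x * poisson z x))%R)) \+ (EFin \o (fun=> K)))%E)//.
  exact: integrableD.
apply: (@le_trans _ _ (\int[lebesgue_measure]_(x in D) (c * (wt x * poisson z x) + K))).
  by apply: (le_Rintegral _ ik isum) => // x; rewrite inD; exact: h.
rewrite RintegralD// lerD//.
  have -> : \int[lebesgue_measure]_(x in D) (c * (wt x * poisson z x)) =
    c * \int[lebesgue_measure]_(x in D) (wt x * poisson z x) by rewrite RintegralZl.
  by rewrite ler_wpM2l// Rintegral_poisson.
by rewrite Rintegral_cst//= lebesgue_measure_itv/= lte_fin hab -EFinB/=.
Qed.

Lemma gbound_ge0 : 0 <= gbound.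
Proof.
have m : a < (a + b) / 2 < b by have := hab; lra.
by apply: le_trans (greal_le m); exact: greal_ge0.
Qed.

(** The density is small on the part of the support next to a real point
    outside the open support, and the Poisson kernel is small on the rest. *)
Lemma Im_G_boundary (e eta : R) : ~~ (A < e < B) -> 0 < eta ->
  \forall y \near (e%:C : C^o), 0 < Im y -> - eta < Im (G y).
Proof.
move=> eAB eta0; have pi0 := @pi_gt0 R.
pose c := eta / (8 * pi).
have c0 : 0 < c by rewrite divr_gt0 ?mulr_gt0.
have [rho rho0 hg] : exists2 rho : R, 0 < rho &
    forall x, a < x < b -> `|phi x - e| < rho -> greal x <= c.
  have [e0|e0] := ltrP 0 e; last first.
    exists A; first exact: A_gt0.
    move=> x /phi_range/andP[h _]; rewrite ltr_norml => /andP[_ h'].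
    by exfalso; lra.
  have [d d0 hd] := (nbhsC _ _).1 (Re_gdens_pos e0 eAB c0).
  exists d => // x hx xd.
  have := hd (phi x)%:C; rewrite -rmorphB normc_real => /(_ xd).
  have Dx : Dom (phi x)%:C by right; rewrite ReC phi_range.
  by move=> /(_ Dx); rewrite gdens_phi// ReC ger0_norm ?greal_ge0// => /ltW.
have wa0 : 0 < wt a by exact: wt_gt0.
pose H := gbound * wt a * (4 / rho ^+ 2).
have H0 : 0 <= H by rewrite /H mulr_ge0 ?divr_ge0 ?exprn_ge0 ?(ltW rho0)// mulr_ge0 ?gbound_ge0// ltW.
have ba : 0 < b - a by rewrite subr_gt0.
have T0 : 0 < H * (b - a) + 1 by rewrite ltr_wpDl// mulr_ge0// ltW.
have d0 : 0 < Num.min (rho / 2) (eta / (4 * (H * (b - a) + 1))).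
  by rewrite lt_min !divr_gt0// mulr_gt0.
apply: filterS (near_normc e%:C d0) => y; rewrite lt_min => /andP[y1 y2] yi.
have yi' : Im y != 0 by rewrite gt_eqF.
have iy : Im y <= normc (y - e%:C).
  by apply: le_trans (Im_le_normc _); rewrite !ReImE subr0.
rewrite (Im_G_poisson yi) ltrN2.
apply: (@le_lt_trans _ _ (c * (2 * pi) + H * Im y * (b - a))).
  apply: (Rintegral_dens_poisson_le yi' (ltW c0)) => x hx.
  have P0 := poisson_ge0 y x; have w0 := wt_ge0 hx.
  have HI : 0 <= H * Im y by rewrite mulr_ge0// ltW.
  have [xr|xr] := ltrP `|phi x - e| rho.
    rewrite ler_wpDr// /dens -mulrA ler_wpM2r ?hg//; exact: mulr_ge0 w0 P0.
  rewrite ler_wpDl//; first exact: mulr_ge0 (ltW c0) (mulr_ge0 w0 P0).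
  have n2 : rho / 2 <= normc (y - (phi x)%:C).
    have := normc_tri (phi x)%:C y e%:C; rewrite -rmorphB normc_real (normcB _ y); lra.
  have -> : H * Im y = gbound * wt a * (Im y * (4 / rho ^+ 2)) by rewrite /H; ring.
  rewrite ler_pM ?dens_ge0 ?dens_le// /poisson gtr0_norm// ler_wpM2l ?(ltW yi)//.
  rewrite -[4 / _]invrK lef_pV2 ?posrE ?exprn_gt0 ?invr_gt0 ?divr_gt0 ?exprn_gt0//; last first.
    by apply: lt_le_trans n2; rewrite divr_gt0.
  have -> : (4 / rho ^+ 2)^-1 = (rho / 2) ^+ 2 by field; rewrite gt_eqF.
  by rewrite ler_sqr ?nnegrE ?normc_ge0 ?divr_ge0 ?(ltW rho0).
have -> : c * (2 * pi) = eta / 4.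
  by rewrite /c; move: pi0; move: (pi : R) => p p0; field; rewrite gt_eqF.
move: y2; rewrite ltr_pdivlMr ?mulr_gt0//.
have : Im y * (H * (b - a) + 1) <= normc (y - e%:C) * (H * (b - a) + 1).
  by rewrite ler_wpM2r ?(ltW T0).
have := normc_ge0 (y - e%:C); move: yi; lra.
Qed.

Lemma Im_Gh_down z : Im z < 0 -> Im (Gh z) = Im (G z) - 2 * pi * Re (gdens z).
Proof.
move=> zi; rewrite Gh_down//.
have -> : 2 * ('i * pi%:C) * gdens z = (2 * pi)%:C * ('i * gdens z).
  by rewrite rmorphM rmorph_nat; ring.
rewrite ImD ImN ImC_mul ImM Rei Imi; ring.
Qed.

Lemma Im_Gh_cut z : Im z = 0 -> A < Re z < B -> Im (Gh z) = - pi * Re (gdens z).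
Proof.
move=> iz rz; have zE : z = (Re z)%:C by apply: complexP.
pose x := Re z `^ (- q).
have rz0 : 0 < Re z by case/andP: rz => h _; exact: lt_trans A_gt0 h.
have zx : z = (phi x)%:C by rewrite powqK.
have xab : a < x < b := powq_range rz.
have gz : gdens z = (greal x)%:C by rewrite zx gdens_phi.
have Lz : Im (Lc z) = - pi.
  rewrite /Lc zE -!rmorphB !Log_real ?subr_gt0; [|by case/andP: rz..].
  by rewrite !ReImE /=; ring.
have Iz : Im (cint a b (fun t => (wt t)%:C * Qd z t)) = 0.
  rewrite -[RHS](mul0r (\int[lebesgue_measure]_(x in D) 0)) -RintegralZl//; last first.
    by apply: (@bounded_integrable _ _ _ hab _ 0) => // t _; rewrite normr0.
  apply: eq_Rintegral => t _; rewrite mul0r /Qd /kern gz zx -!rmorphB.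
  have -> : ((phi x - phi t)%:C)^-1 = ((phi x - phi t)^-1)%:C :> C by rewrite fmorphV.
  by rewrite -!rmorphM.
by rewrite /Gh ImD ImN Iz ImM gz ImC ReC Lz; ring.
Qed.

Lemma Im_Gh_ge z : Dom z -> Im z <= 0 -> - (2 * pi * `|Re (gdens z)|) <= Im (Gh z).
Proof.
move=> Dz; have pi0 := @pi_gt0 R; rewrite le_eqVlt => /orP[/eqP iz|iz].
  have rz : A < Re z < B by case: Dz => [/eqP|//]; rewrite iz eqxx.
  have h : pi * Re (gdens z) <= pi * `|Re (gdens z)| by rewrite ler_wpM2l ?(ltW pi0)// ler_norm.
  have : 0 <= pi * `|Re (gdens z)| by rewrite mulr_ge0// ltW.
  rewrite Im_Gh_cut//; lra.
have := Im_G_gt0 iz; rewrite Im_Gh_down//.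
have : pi * Re (gdens z) <= pi * `|Re (gdens z)| by rewrite ler_wpM2l ?(ltW pi0)// ler_norm.
lra.
Qed.

Lemma not_Dom e : ~ Dom e -> Im e = 0 /\ ~~ (A < Re e < B).
Proof.
move=> h; split; first by apply: contrapT => h'; apply: h; left.
by apply/negP => h'; apply: h; right.
Qed.

Lemma real_complex e : Im e = 0 -> e = (Re e)%:C.
Proof. by move=> h; apply: complexP. Qed.

(** Above the real axis this is a property of [G]; below it, [Im G] is positive and
    only the density counts. *)
Lemma Im_Gh_boundary e (eta : R) : ~ Dom e -> e != 0 -> 0 < eta ->
  \forall y \near (e : C^o), Dom y -> - eta < Im (Gh y).
Proof.
move=> /not_Dom[ie re] e0 eta0; have pi0 := @pi_gt0 R.
have eE := real_complex ie; set x := Re e in re eE; rewrite eE in e0 *.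
have x0 : x != 0 by apply: contraNneq e0 => ->.
have h1 := Im_G_boundary re eta0.
have c0 : 0 < eta / (4 * pi) by rewrite divr_gt0 ?mulr_gt0.
have cE : 2 * pi * (eta / (4 * pi)) = eta / 2.
  by move: pi0; move: (pi : R) => p p0; field; rewrite gt_eqF.
have [xp|xn] := ltrP 0 x.
  apply: filterS2 h1 (Re_gdens_pos xp re c0) => y k1 k2 Dy.
  have [iy|iy] := ltrP 0 (Im y); first by rewrite Gh_up//; exact: k1.
  apply: lt_le_trans (Im_Gh_ge Dy iy); rewrite ltrN2.
  have : 2 * pi * `|Re (gdens y)| < 2 * pi * (eta / (4 * pi)) by rewrite ltr_pM2l ?mulr_gt0// k2.
  rewrite cE; lra.
have xlt : x < 0 by rewrite lt_neqAle x0.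
have d0 : 0 < - x by rewrite oppr_gt0.
apply: filterS3 h1 (Re_gdens_neg xlt c0) (near_normc x%:C d0) => y k1 k2 k3 Dy.
have ry : Re y < 0.
  by have := Re_le_normc (y - x%:C); rewrite !ReImE; move: k3; lra.
case: Dy => [/eqP iy|/andP[h _]]; last by have := A_gt0; lra.
have {iy} [iy|iy] : Im y < 0 \/ 0 < Im y by apply/orP; rewrite -neq_lt.
  have := Im_G_gt0 iy; rewrite Im_Gh_down//.
  have : 2 * pi * Re (gdens y) < 2 * pi * (eta / (4 * pi)) by rewrite ltr_pM2l ?mulr_gt0// k2.
  rewrite cE; lra.
by rewrite Gh_up//; exact: k1.
Qed.

Lemma Im_Gh_zero (eta : R) : 0 < eta ->
  \forall y \near ((0 : C) : C^o), 0 < Im y -> - eta < Im (Gh y).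
Proof.
move=> eta0; have n0 : ~~ (A < 0 < B) by rewrite ltNge (ltW A_gt0).
by apply: filterS (Im_G_boundary n0 eta0) => y h iy; rewrite Gh_up//; exact: h.
Qed.

Lemma away_infty z : away z (normc z - B).
Proof.
move=> x hx; have := ler_distc z (phi x)%:C; rewrite normc_real ger0_norm ?powR_ge0//.
have := phi_le hx; lra.
Qed.

Lemma Im_Gh_infty (eta : R) : 0 < eta ->
  exists2 M : R, 0 < M & forall z, Dom z -> M < normc z -> - eta < Im (Gh z).
Proof.
move=> eta0; have pi0 := @pi_gt0 R; have B0 := B_gt0.
have c0 : 0 < eta / (4 * pi) by rewrite divr_gt0 ?mulr_gt0.
have cE : 2 * pi * (eta / (4 * pi)) = eta / 2.
  by move: pi0; move: (pi : R) => p p0; field; rewrite gt_eqF.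
have [M M0 hM] := Re_gdens_infty c0.
pose K := 2 * (b - a) * (gbound * wt a).
have K0 : 0 <= K.
  rewrite /K mulr_ge0//; first by rewrite mulr_ge0// subr_ge0 ltW.
  by rewrite mulr_ge0 ?gbound_ge0// ltW// wt_gt0.
have K1 : 0 <= K / eta by rewrite divr_ge0 ?(ltW eta0).
exists (M + B + K / eta + 1); first lra.
move=> z Dz zM.
have iz : Im z != 0.
  case: Dz => [/eqP//|/andP[h1 h2]]; have A0 := A_gt0.
  apply/eqP => iz; move: zM; rewrite (real_complex iz) normc_real gtr0_norm; lra.
have {iz} [iz|iz] : Im z < 0 \/ 0 < Im z by apply/orP; rewrite -neq_lt.
  have := Im_G_gt0 iz; rewrite Im_Gh_down//.
  have : 2 * pi * Re (gdens z) < 2 * pi * (eta / (4 * pi)).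
    by rewrite ltr_pM2l ?mulr_gt0// hM//; lra.
  rewrite cE; lra.
rewrite Gh_up//; have c1 : 0 < normc z - B by lra.
have := normc_G c1 (@away_infty z); rewrite mulrA -/K => h.
have : K * (normc z - B)^-1 < eta.
  rewrite ltr_pdivrMr// mulrC -ltr_pdivrMr//; lra.
have := Im_ge_normc (G z); lra.
Qed.

(** * Blow-up at the origin from below *)

Hypothesis hl : forall i j : 'I_N, (i < j)%N -> l i < l j.

Lemma N_gt0 : (0 < N)%N.
Proof.
rewrite lt0n; apply/negP => /eqP N0.
have e : (\int[lebesgue_measure]_(x in `]a, b[) (gpfp_pdf a b alpha l x)%:E = 0)%E.
  apply: integral0_eq => x _; rewrite /gpfp_pdf big1 ?mulr0 ?mul0r//.
  by case=> k hk; exfalso; rewrite N0 in hk.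
by have := hint; rewrite e => /eqP; rewrite eqe eq_sym oner_eq0.
Qed.

Definition kmin := Ordinal N_gt0.

Lemma kminP k : k != kmin -> l kmin < l k.
Proof.
move=> h; apply: hl; rewrite /= lt0n; apply: contra h => /eqP k0.
by apply/eqP/val_inj.
Qed.

Lemma normc_rootS_ge z : Dom z -> normc (zeta z) - b <= normc (rootS z).
Proof.
move=> Dz; have [h|h] := lerP (normc (zeta z) - b) 0.
  by apply: le_trans h _; exact: normc_ge0.
rewrite -ler_sqr ?nnegrE ?normc_ge0 ?(ltW h)// normc_rootS// expr2.
rewrite ler_pM ?(ltW h)//.
  by have := ler_distc (zeta z) b%:C; rewrite normc_real gtr0_norm ?hb// normcB.
have := ler_distc (zeta z) a%:C; rewrite normc_real gtr0_norm//.
by have := hab; lra.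
Qed.

Lemma normc_zeta_infty (M : R) :
  \forall y \near ((0 : C) : C^o), Dom y -> M < normc (zeta y).
Proof.
have M0 : 0 < Num.max M 1 by rewrite lt_max ltr01 orbT.
apply: filterS (near_normc 0 (phi_gt0 M0)) => y; rewrite subr0 => yd Dy.
have ys := Dom_slit Dy.
rewrite normc_zeta//; apply: (@le_lt_trans _ _ (Num.max M 1)).
  by rewrite le_max lexx.
rewrite -[ltLHS](phiK M0); apply: ltr_powRN => //; last exact: slit_normc.
by rewrite oppr_lt0 q_gt0.
Qed.

Lemma normc_rootS_infty (M : R) :
  \forall y \near ((0 : C) : C^o), Dom y -> M < normc (rootS y).
Proof.
apply: filterS (normc_zeta_infty (M + b)) => y h Dy.
by have := normc_rootS_ge Dy; have := h Dy; lra.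
Qed.

Lemma normc_cpow_ge1 z (c : R) : slit z -> normc z <= 1 -> c <= 0 ->
  1 <= normc (cpow z c).
Proof.
move=> zs z1 c0; rewrite normc_cpow// -(powRr0 (normc z)).
by apply: ger_powR => //; rewrite slit_normc.
Qed.

(** The summand of smallest exponent dominates. *)
Lemma normc_gdens_ge : exists2 c : R, 0 < c &
  \forall y \near ((0 : C) : C^o), Dom y -> c * normc (rootS y) <= normc (gdens y).
Proof.
have q0 := q_gt0; have a0 := halpha kmin.
exists (q * (alpha kmin / 2)); first by rewrite mulr_gt0// divr_gt0.
pose T := alphas + 1.
have T0 : 0 < T by rewrite /T ltr_wpDl ?alphas_ge0.
pose d := alpha kmin / (2 * T).
have d0 : 0 < d by rewrite divr_gt0 ?mulr_gt0.
have nk (k : 'I_N) : \forall y \near ((0 : C) : C^o),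
    Dom y -> k != kmin -> normc (cpow y (q * (l k - l kmin))) <= d.
  have [->|kk] := eqVneq k kmin; first by apply/nbhsC; exists 1 => // y _ _; rewrite eqxx.
  have c0 : 0 < q * (l k - l kmin) by rewrite mulr_gt0// subr_gt0 kminP.
  have e0 : 0 < d `^ (q * (l k - l kmin))^-1 by rewrite powR_gt0.
  apply: filterS (near_normc 0 e0) => y; rewrite subr0 => yd Dy _.
  have ys := Dom_slit Dy; rewrite normc_cpow//.
  have -> : d = (d `^ (q * (l k - l kmin))^-1) `^ (q * (l k - l kmin)).
    by rewrite -powRrM mulVf ?gt_eqF// powRr1// ltW.
  by apply: ge0_ler_powR; rewrite ?nnegrE ?normc_ge0 ?(ltW c0) ?(ltW e0) ?(ltW yd).
have nk' : \forall y \near ((0 : C) : C^o), forall k : 'I_N,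
    Dom y -> k != kmin -> normc (cpow y (q * (l k - l kmin))) <= d.
  exact: (@filter_forall _ _ (fun (k : 'I_N) (y : C) =>
    Dom y -> k != kmin -> normc (cpow y (q * (l k - l kmin))) <= d) _ _ nk).
apply: filterS2 nk' (near_normc 0 ltr01) => y hk; rewrite subr0 => y1 Dy.
have ys := Dom_slit Dy.
have ->  : gdens y = q%:C * (cpow y (q * l kmin - 1) *
    (\sum_(k < N) (alpha k)%:C * cpow y (q * (l k - l kmin))) * rootS y).
  rewrite gdens_term//; congr (_ * _); rewrite mulr_sumr mulr_suml.
  apply: eq_bigr => k _; rewrite /term.
  have -> : q * l k - 1 = (q * l kmin - 1) + q * (l k - l kmin) by ring.
  by rewrite cpowD; ring.
rewrite (normcM q%:C) normc_real (gtr0_norm q0) -[leLHS]mulrA; apply: ler_wpM2l; first exact: ltW.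
rewrite [leRHS](normcM _ (rootS y)); apply: ler_wpM2r; first exact: normc_ge0.
rewrite normcM.
set s := \sum_(k < N) _.
have hs : alpha kmin / 2 <= normc s.
  have -> : s = (alpha kmin)%:C +
     \sum_(k < N | k != kmin) (alpha k)%:C * cpow y (q * (l k - l kmin)).
    rewrite /s (bigD1 kmin)//=; congr (_ + _).
    by rewrite subrr mulr0 /cpow mul0r cexp0 mulr1.
  set t := \sum_(k < N | _) _.
  have ht : normc t <= alphas * d.
    rewrite /t big_mkcond /alphas mulr_suml.
    elim/big_ind2 : _ => [|x1 x2 y1' y2 h1 h2|k _].
    - by rewrite normc0.
    - by apply: le_trans (le_normcD _ _) _; exact: lerD.
    - case: ifP => kk; last by rewrite normc0 mulr_ge0 ?(ltW d0) ?(ltW (halpha k)).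
      by rewrite normcM normc_real gtr0_norm// ler_wpM2l ?(ltW (halpha k))// hk.
  have := ler_distc (alpha kmin)%:C (- t); rewrite opprK normcN normc_real gtr0_norm//.
  have e : T * d = alpha kmin / 2 by rewrite /d; field; rewrite gt_eqF.
  move: e; rewrite /T; lra.
apply: le_trans hs _; rewrite ler_peMl ?normc_ge0//.
apply: normc_cpow_ge1; rewrite ?(ltW y1)// subr_le0.
by have /andP[_] := ql_bounds kmin.
Qed.

Lemma away_zero z : normc z < A / 2 -> away z (A / 2).
Proof.
move=> zA x hx; have := ler_distc (phi x)%:C z; rewrite normcB normc_real ger0_norm ?powR_ge0//.
by have /andP[h _] := phi_range hx; lra.
Qed.

Lemma normc_Gh_zero (M : R) :
  \forall y \near ((0 : C) : C^o), Im y < 0 -> M < normc (Gh y).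
Proof.
have A2 : 0 < A / 2 by rewrite divr_gt0 ?A_gt0.
have pi0 := @pi_gt0 R.
have [c c0 hc] := normc_gdens_ge.
pose K := 2 * (b - a) * (gbound * wt a * (A / 2)^-1).
apply: filterS3 hc (normc_rootS_infty ((`|M| + `|K|) / (2 * pi * c))) (near_normc 0 A2) => y h1 h2.
rewrite subr0 => yA iy.
have Dy : Dom y by left; apply/eqP; rewrite lt_eqF.
have hG := normc_G A2 (away_zero yA); rewrite -/K in hG.
rewrite Gh_down// normcB.
apply: lt_le_trans (ler_distc _ _); rewrite (normcM _ (gdens y)) (normcM 2) normc_ipi normc2.
have := h2 Dy; rewrite ltr_pdivrMr ?mulr_gt0// => h3.
have : 2 * pi * (c * normc (rootS y)) <= 2 * pi * normc (gdens y).
  by rewrite ler_wpM2l ?(h1 Dy)// mulr_ge0// ltW.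
have := ler_norm M; have := ler_norm K; lra.
Qed.

Lemma sigma_le0 z : Im z < 0 -> a + b <= 2 * Re (zeta z) -> sigma z <= 0.
Proof.
move=> iz rzeta; have Dz : Dom z by left; apply/eqP; rewrite lt_eqF.
have /andP[_ s2] := sigma_bounds iz; have rS := Re_rootS_gt0 iz.
rewrite leNgt; apply/negP => sp.
have iS : 0 < Im (rootS z).
  rewrite Im_rootS mulr_gt0//; first by rewrite normc_gt0 rootS_cexp cexp_neq0.
  by apply: sin_gt0_pi; apply/andP; have := @pi_gt0 R; lra.
have : Im (rootS z ^+ 2) = 2 * Re (rootS z) * Im (rootS z) by rewrite expr2 ImM; ring.
have -> : Im (rootS z ^+ 2) = Im (zeta z) * (a + b - 2 * Re (zeta z)).
  by rewrite sqr_rootS// !(ReD, ReN, ImD, ImN, ReM, ImM, ReC, ImC); ring.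
move=> e; have : Im (zeta z) * (a + b - 2 * Re (zeta z)) <= 0.
  by rewrite pmulr_rle0 ?Im_zeta_gt0//; lra.
by rewrite e leNgt mulr_gt0// mulr_gt0.
Qed.

(** On the ray of argument [- pi / 4] the terms of the density end up in the
    sector of half-angle [pi / 4] around the positive half-axis, because the root
    contributes an argument between [- pi / 2] and [0] and the power one between
    [0] and [pi / 4]. *)
Lemma Re_gdens_ray z : Arg z = - (pi / 4) -> Im z < 0 -> normc z < 1 ->
  2 * (a + b) < normc (zeta z) ->
  q * (alpha kmin / 2 * normc (rootS z)) <= Re (gdens z).
Proof.
move=> az iz z1 zz; have pi0 := @pi_gt0 R; have q0 := q_gt0; have q1 := q_le1.
have zs := slit_neg iz; have /andP[s1 s2] := sigma_bounds iz.
have zetas : slit (zeta z) := slit_pos (Im_zeta_gt0 iz).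
have rzeta : a + b <= 2 * Re (zeta z).
  have [hc _] := cos_sin_Arg zetas; have n0 := slit_normc zetas.
  have aq : Arg (zeta z) = q * (pi / 4) by rewrite Arg_zeta// az; ring.
  have -> : Re (zeta z) = cos (q * (pi / 4)) * normc (zeta z) by rewrite -aq hc divfK// gt_eqF.
  have h2 : 2^-1 <= cos (q * (pi / 4)).
    have qp : q * (pi / 4) <= pi / 4 by rewrite ler_piMl// divr_ge0// ltW.
    have qp0 : 0 <= q * (pi / 4) by rewrite mulr_ge0 ?divr_ge0 ?(ltW q0) ?(ltW pi0).
    by apply: cos_ge_half; apply/andP; lra.
  have ab0 : 0 < a + b := addr_gt0 ha hb.
  by have h3 := ler_wpM2r (ltW n0) h2; lra.
have sS := sigma_le0 iz rzeta.
have cterm k : normc (rootS z) / 2 <= Re (term k z).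
  have /andP[p0 p1] := ql_bounds k; have /andP[l0 l1] := hl01 k.
  rewrite Re_term//; set psi := _ + _.
  have psiE : psi = (1 - q * l k) * (pi / 4) + sigma z by rewrite /psi az; ring.
  have h1 : 0 <= q * l k * (pi / 4) by rewrite mulr_ge0 ?divr_ge0// ltW.
  have h2 : 0 <= q * (1 - l k) * (pi / 4).
    by rewrite mulr_ge0 ?divr_ge0 ?(ltW pi0)// mulr_ge0 ?subr_ge0// ltW.
  have k5 : 2^-1 <= cos psi.
    apply: cos_ge_half; rewrite psiE; move: s1; rewrite az => s1.
    by apply/andP; lra.
  have n1 : normc (rootS z) <= normc (term k z).
    rewrite [leRHS](normcM (cpow z _)); apply: ler_peMl (normc_ge0 _) _.
    by apply: normc_cpow_ge1; rewrite ?(ltW z1)// subr_le0.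
  by apply: ler_pM => //; rewrite ?normc_ge0 ?invr_ge0.
rewrite gdens_term// ReC_mul ler_wpM2l ?(ltW q0)//.
have t0 k : 0 <= Re ((alpha k)%:C * term k z).
  rewrite ReC_mul mulr_ge0 ?(ltW (halpha k))//; apply: le_trans (cterm k).
  by rewrite divr_ge0 ?normc_ge0.
rewrite (bigD1 kmin)//= ReD.
have h1 : 0 <= Re (\sum_(k < N | k != kmin) (alpha k)%:C * term k z).
  elim/big_ind : _ => [|x1 x2 h1 h2|k _]; [by rewrite Re0|by rewrite ReD addr_ge0|exact: t0].
have h2 : alpha kmin * (normc (rootS z) / 2) <= Re ((alpha kmin)%:C * term kmin z).
  by rewrite ReC_mul ler_wpM2l ?(ltW (halpha kmin)).
lra.
Qed.

Lemma Im_Gh_unbounded (M : R) : exists2 z, Dom z & Im (Gh z) < M.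
Proof.
have A2 : 0 < A / 2 by rewrite divr_gt0 ?A_gt0.
have pi0 := @pi_gt0 R; have q0 := q_gt0; have a0 := halpha kmin.
pose K := 2 * (b - a) * (gbound * wt a * (A / 2)^-1).
pose c := 2 * pi * (q * (alpha kmin / 2)).
have c0 : 0 < c by rewrite /c !mulr_gt0// divr_gt0.
have n1 := normc_rootS_infty ((`|M| + `|K|) / c).
have n2 := normc_zeta_infty (2 * (a + b)).
have m0 : 0 < Num.min 1 (A / 2) by rewrite lt_min ltr01.
have [d d0 hd] := (nbhsC _ _).1 (filterI (filterI n1 n2) (near_normc 0 m0)).
pose rho := d / 2; have rho0 : 0 < rho by rewrite divr_gt0.
pose u : C := ln rho +i* (- (pi / 4)).
have iu : - pi < Im u < pi by apply/andP; rewrite /=; lra.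
have [zs Lz] := cexpK iu; set z := cexp u in zs Lz.
have nz : normc z = rho by rewrite normc_cexp lnK.
have az : Arg z = - (pi / 4) by have := congr1 Im Lz.
have iz : Im z < 0.
  have [_] := cos_sin_Arg zs; rewrite az nz sinN => h.
  have s0 : 0 < sin (pi / 4 : R) by apply: sin_gt0_pi; apply/andP; lra.
  have -> : Im z = - sin (pi / 4) * rho by rewrite h divfK// gt_eqF.
  by rewrite mulNr oppr_lt0 mulr_gt0.
have Dz : Dom z by left; apply/eqP; rewrite lt_eqF.
have zd : normc (z - 0) < d by rewrite subr0 nz /rho; lra.
have [[k1 k2] k3] := hd z zd.
move: k3; rewrite subr0 lt_min => /andP[z1 zA].
have hG := normc_G A2 (away_zero zA); rewrite -/K in hG.
exists z => //; rewrite Im_Gh_down//.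
have hg : c * normc (rootS z) <= 2 * pi * Re (gdens z).
  have -> : c * normc (rootS z) = 2 * pi * (q * (alpha kmin / 2 * normc (rootS z))).
    by rewrite /c; ring.
  apply: ler_wpM2l; first by rewrite mulr_ge0// ltW.
  exact: Re_gdens_ray az iz z1 (k2 Dz).
move: (k1 Dz); rewrite ltr_pdivrMr// => k4.
have g1 := Im_le_normc (G z); have g2 := ler_norm K.
have := ler_norm (- M); rewrite normrN; lra.
Qed.

Lemma smooth_atM f g z : smooth_at f z -> smooth_at g z ->
  smooth_at (fun y => f y * g y) z.
Proof.
move=> hf hg; have [c hc] := smooth_at_cder hf; have [c' hc'] := smooth_at_cder hg.
case: hf => [hf|[iz _]]; last by right; split => //; exists (c * g z + f z * c'); exact: cderM.
case: hg => [hg|[iz _]]; first by left; exact: CnM.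
by right; split => //; exists (c * g z + f z * c'); exact: cderM.
Qed.

Lemma smooth_atD f g z : smooth_at f z -> smooth_at g z ->
  smooth_at (fun y => f y + g y) z.
Proof.
move=> hf hg; have [c hc] := smooth_at_cder hf; have [c' hc'] := smooth_at_cder hg.
case: hf => [hf|[iz _]]; last by right; split => //; exists (c + c'); exact: cderD.
case: hg => [hg|[iz _]]; first by left; exact: CnD.
by right; split => //; exists (c + c'); exact: cderD.
Qed.

Lemma smooth_atV f z : f z != 0 -> smooth_at f z -> smooth_at (fun y => (f y)^-1) z.
Proof.
move=> f0 [hf|[iz [c hc]]]; first by left; exact: CnV.
by right; split => //; exists (- ((f z)^-1 * (f z)^-1) * c); exact: cderV.
Qed.

Lemma smooth_at_Cn f z : Cn 2 f z -> smooth_at f z. Proof. by left. Qed.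

(** * Existence *)

Lemma Im_inv_gt0 z : 0 < Im z -> 0 < - Im (z^-1).
Proof.
move=> h; rewrite ImVn mulNr opprK divr_gt0// exprn_gt0// normc_gt0.
by apply: contraTneq h => ->; rewrite ltxx.
Qed.

(** If the value [w] were not taken, the imaginary part of the inverse of
    [w - Gh] would be harmonic with nonnegative boundary values, and that of [Gh]
    would be bounded below by [Im w]. *)
Lemma Gh_surj w : Im w < 0 -> exists2 z, Dom z & Gh z = w.
Proof.
move=> iw; apply: contrapT => hn.
have nz z : Dom z -> Gh z - w != 0.
  by move=> Dz; rewrite subr_eq0; apply/eqP => h; apply: hn; exists z.
pose v z := - Im ((Gh z - w)^-1).
have w0 : 0 < - Im w by rewrite oppr_gt0.
have vpos z : Im w < Im (Gh z) -> 0 < v z.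
  by move=> h; apply: Im_inv_gt0; rewrite ImD ImN subr_gt0.
have vge : forall z, Dom z -> 0 <= v z.
  apply: max_principle.
  - exact: Dom_open.
  - move=> z Dz; exists (fun y => 'i * (Gh y - w)^-1); split.
      by apply/nbhsC; exists 1 => // y _; rewrite /v !ReImE; ring.
    apply: smooth_atM; first by apply: smooth_at_Cn; exact: Cn_cst.
    apply: smooth_atV; first exact: nz.
    by apply: smooth_atD; [exact: smooth_Gh|apply: smooth_at_Cn; exact: Cn_cst].
  - move=> e De eta eta0; have [->|e0] := eqVneq e 0; last first.
      apply: filterS (Im_Gh_boundary De e0 w0) => y h Dy.
      by apply: lt_trans (vpos _ _); rewrite ?oppr_lt0//; have := h Dy; rewrite opprK.
    apply: filterS3 (Im_Gh_zero w0) (normc_Gh_zero (normc w + eta^-1)) (near_normc 0 A_gt0) => y h1 h2.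
    rewrite subr0 => yA [/eqP|/andP[Ay _]]; last by have := Re_le_normc y; lra.
    rewrite neq_lt => /orP[iy|iy]; last first.
      by apply: lt_trans (vpos _ _); rewrite ?oppr_lt0//; have := h1 iy; rewrite opprK.
    have h3 : eta^-1 < normc (Gh y - w) by have := ler_distc (Gh y) w; have := h2 iy; lra.
    rewrite /v ltrN2; apply: le_lt_trans (Im_le_normc _) _; rewrite normcV.
    by rewrite invf_plt ?posrE//; apply: lt_trans h3; rewrite invr_gt0.
  - move=> eta eta0; have [M M0 hM] := Im_Gh_infty w0; exists M => z Dz zM.
    by apply: lt_trans (vpos _ _); rewrite ?oppr_lt0//; have := hM z Dz zM; rewrite opprK.
have [z Dz] := Im_Gh_unbounded (Im w).
have := vge z Dz; rewrite /v ImVn mulNr opprK ImD ImN => h1 h2.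
have : (Im (Gh z) - Im w) / normc (Gh z - w) ^+ 2 < 0.
  by rewrite ltr_pdivrMr ?mul0r ?subr_lt0// exprn_gt0// normc_gt0 nz.
by rewrite ltNge h1.
Qed.

(** * Growth of the continuation at the boundary *)

Definition Gconst := 2 * (b - a) * (gbound * wt a).

Lemma Gconst_ge0 : 0 <= Gconst.
Proof.
rewrite /Gconst mulr_ge0//; first by rewrite mulr_ge0// subr_ge0 ltW.
by rewrite mulr_ge0 ?gbound_ge0// ltW// wt_gt0.
Qed.

Lemma normc_Gh_off z (c : R) : Im z != 0 -> 0 < c -> away z c ->
  normc (Gh z) <= Gconst * c^-1 + 2 * pi * (q * alphas * (b + 1)) * (1 + (normc z)^-1) ^+ 2.
Proof.
move=> iz c0 zc; have pi0 := @pi_gt0 R; have Dz : Dom z by left; apply/eqP.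
have hG := normc_G c0 zc; rewrite mulrA -/Gconst in hG.
have hg := normc_gdens_le Dz.
have pg : 2 * pi * normc (gdens z) <= 2 * pi * (q * alphas * (b + 1) * (1 + (normc z)^-1) ^+ 2).
  by apply: ler_wpM2l; rewrite // mulr_ge0// ltW.
have g0 : 0 <= 2 * pi * normc (gdens z) by rewrite mulr_ge0 ?normc_ge0// mulr_ge0// ltW.
have [i0|i0] : Im z < 0 \/ 0 < Im z by apply/orP; rewrite -neq_lt.
  rewrite Gh_down//; apply: le_trans (ler_normcB _ _) _.
  rewrite (normcM _ (gdens z)) (normcM 2) normc_ipi normc2; lra.
rewrite Gh_up//; lra.
Qed.

Lemma normc_Gh_bounded (e : R) : e != 0 -> ~~ (A <= e <= B) ->
  exists K : R, \forall y \near (e%:C : C^o), Dom y -> normc (Gh y) <= K.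
Proof.
move=> e0 eAB; have A0 := A_gt0; have AB := A_lt_B.
pose d := Num.max (A - e) (e - B).
have d0 : 0 < d.
  rewrite lt_max !subr_gt0; move: eAB; rewrite negb_and -!ltNge.
  by case/orP => ->; rewrite ?orbT.
have n0 : 0 < `|e| by rewrite normr_gt0.
have m0 : 0 < Num.min (d / 2) (`|e| / 2) by rewrite lt_min !divr_gt0.
pose f (n : R) := Gconst * (d / 2)^-1 + 2 * pi * (q * alphas * (b + 1)) * (1 + n^-1) ^+ 2.
exists (f (`|e| / 2)).
apply: filterS (near_normc e%:C m0) => y; rewrite lt_min => /andP[y1 y2] Dy.
have ye : `|e| / 2 <= normc y.
  have := ler_distc e%:C y; rewrite normc_real normcB; lra.
have yr := normc_Re (y - e%:C); rewrite !ReImE in yr.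
have iy : Im y != 0.
  case: Dy => [/eqP//|/andP[h1 h2]]; exfalso.
  have : `|Re y - e| < d / 2 by apply: le_lt_trans y1.
  rewrite ltr_norml => /andP[h3 h4].
  have : d < d / 2 by rewrite {1}/d gt_max; apply/andP; lra.
  lra.
have aw : away y (d / 2).
  move=> x hx; have /andP[p1 p2] := phi_range hx.
  have : d <= normc (e%:C - (phi x)%:C).
    rewrite -rmorphB normc_real /d ge_max; apply/andP; split.
      by apply: le_trans (_ : phi x - e <= _); [lra|rewrite distrC; exact: ler_norm].
    by apply: le_trans (ler_norm _); lra.
  by have := normc_tri e%:C y (phi x)%:C; rewrite (normcB e%:C y); lra.
apply: le_trans (normc_Gh_off iy _ aw) _; first by rewrite divr_gt0.
rewrite /f lerD2l; apply: ler_wpM2l.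
  by rewrite !mulr_ge0 ?pi_ge0 ?alphas_ge0 ?(ltW q_gt0)// addr_ge0 ?(ltW hb).
have i0 : 0 < (normc y)^-1 by rewrite invr_gt0; apply: lt_le_trans ye; rewrite divr_gt0.
rewrite ler_sqr ?nnegrE ?addr_ge0 ?invr_ge0 ?normc_ge0 ?divr_ge0//.
by rewrite lerD2l lef_pV2 ?posrE ?divr_gt0//; apply: lt_le_trans ye; rewrite divr_gt0.
Qed.

Lemma normc_Gh_infty : exists K M : R, forall z, Dom z -> M < normc z -> normc (Gh z) <= K.
Proof.
have B0 := B_gt0.
exists (Gconst * 1^-1 + 2 * pi * (q * alphas * (b + 1)) * (1 + 1) ^+ 2), (B + 1).
move=> z Dz zM.
have iz : Im z != 0.
  case: Dz => [/eqP//|/andP[h1 h2]]; have A0 := A_gt0.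
  apply/eqP => iz; move: zM; rewrite (real_complex iz) normc_real gtr0_norm; lra.
have aw : away z 1 by move=> x hx; have := @away_infty z x hx; lra.
apply: le_trans (normc_Gh_off iz ltr01 aw) _.
rewrite lerD2l; apply: ler_wpM2l.
  by rewrite !mulr_ge0 ?pi_ge0 ?alphas_ge0 ?(ltW q_gt0)// addr_ge0 ?(ltW hb).
have z1 : 1 < normc z by lra.
have i0 : 0 < (normc z)^-1 by rewrite invr_gt0; lra.
rewrite ler_sqr ?nnegrE ?addr_ge0 ?(ltW i0)// lerD2l invf_le1//; lra.
Qed.

Lemma normc_Gh_zero_le : exists2 K : R, 0 < K &
  \forall y \near ((0 : C) : C^o), Dom y -> normc (Gh y) * normc y ^+ 2 <= K.
Proof.
have A2 : 0 < A / 2 by rewrite divr_gt0 ?A_gt0.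
have m0 : 0 < Num.min 1 (A / 2) by rewrite lt_min ltr01.
pose P := 2 * pi * (q * alphas * (b + 1)).
have P0 : 0 <= P.
  by rewrite !mulr_ge0 ?pi_ge0 ?alphas_ge0 ?(ltW q_gt0)// addr_ge0 ?(ltW hb).
have Q0 : 0 <= Gconst * (A / 2)^-1 by rewrite mulr_ge0 ?Gconst_ge0 ?invr_ge0 ?(ltW A2).
exists (Gconst * (A / 2)^-1 + 4 * P + 1); first lra.
apply: filterS (near_normc 0 m0) => y; rewrite subr0 lt_min => /andP[y1 yA] Dy.
have iy : Im y != 0.
  by case: Dy => [/eqP//|/andP[h1 h2]]; have := Re_le_normc y; lra.
have n0 := slit_normc (Dom_slit Dy).
have := normc_Gh_off iy A2 (away_zero yA); rewrite -/P => h.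
have n2 : normc y ^+ 2 <= 1 by rewrite expr_le1// ?normc_ge0 // ltW.
have n3 : 0 <= normc y ^+ 2 by rewrite exprn_ge0// normc_ge0.
have e : (1 + (normc y)^-1) ^+ 2 * normc y ^+ 2 = (normc y + 1) ^+ 2.
  by field; rewrite gt_eqF.
have e4 : (normc y + 1) ^+ 2 <= 4.
  rewrite expr2 (_ : 4 = 2 * 2); last by ring.
  by rewrite ler_pM ?addr_ge0 ?normc_ge0//; lra.
have h1 := ler_wpM2r n3 h.
have h2 : Gconst * (A / 2)^-1 * normc y ^+ 2 <= Gconst * (A / 2)^-1 by rewrite ler_piMr.
have h3 : P * (1 + (normc y)^-1) ^+ 2 * normc y ^+ 2 <= P * 4.
  by rewrite -mulrA e ler_wpM2l.
lra.
Qed.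

Lemma normc_Gh_zero_up : exists K : R,
  \forall y \near ((0 : C) : C^o), 0 < Im y -> normc (Gh y) <= K.
Proof.
have A2 : 0 < A / 2 by rewrite divr_gt0 ?A_gt0.
exists (Gconst * (A / 2)^-1); apply: filterS (near_normc 0 A2) => y; rewrite subr0 => yA iy.
by rewrite Gh_up// /Gconst -mulrA; exact: normc_G A2 (away_zero yA).
Qed.

(** The sum of two square roots of positive real part, one of them
    real, is at least as large as the other. *)
Lemma normc_csqrtB u (v : R) : slit u -> 0 < v ->
  normc (csqrt u - csqrt v%:C) * normc (csqrt u) <= normc (u - v%:C).
Proof.
move=> us v0; have rs := Re_csqrt_gt0 us; have sv := csqrt_real v0.
have -> : u - v%:C = (csqrt u - csqrt v%:C) * (csqrt u + csqrt v%:C).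
  by rewrite -[in LHS](sqr_csqrt us) -[in LHS](sqr_csqrt (slit_real v0)); ring.
rewrite normcM; apply: ler_wpM2l; first exact: normc_ge0.
rewrite sv -ler_sqr ?nnegrE ?normc_ge0// !sqr_normcE !ReImE addr0.
have s0 : 0 <= Num.sqrt v by exact: sqrtr_ge0.
have : 0 <= Num.sqrt v * Re (csqrt u) by rewrite mulr_ge0// ltW.
have : 0 <= Num.sqrt v ^+ 2 by rewrite exprn_ge0.
rewrite sqrrD; lra.
Qed.

Lemma norm_ln_sqrt (t : R) : 0 < t -> t <= 1 -> `|ln t| * Num.sqrt t <= 2.
Proof.
move=> t0 t1; have s0 : 0 < Num.sqrt t by rewrite sqrtr_gt0.
have e : ln t = - (2 * ln (Num.sqrt t)^-1).
  rewrite lnV ?posrE// -{1}(sqr_sqrtr (ltW t0)) lnXn//; ring.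
have l0 : ln t <= 0 by rewrite ln_le0.
rewrite ler0_norm// e opprK -mulrA.
have := ltW (ln_sublinear (_ : 0 < (Num.sqrt t)^-1)).
rewrite invr_gt0 => /(_ s0) h.
have : ln (Num.sqrt t)^-1 * Num.sqrt t <= (Num.sqrt t)^-1 * Num.sqrt t.
  by apply: ler_wpM2r => //; exact: ltW.
rewrite mulVf ?gt_eqF//; lra.
Qed.

(** At an end of the support the density is a smooth function times the square
    root of a function with a simple zero; the difference quotients of a
    square root are at most of the order of its inverse. *)
Lemma normc_Gh_endpoint (e : R) (m u : C -> C) (c : C) (KL : R) : 0 < e ->
  Cn 1 m e%:C -> Cn 1 u e%:C -> cder u e%:C c -> c != 0 -> u e%:C = 0 ->
  (forall y, Dom y -> slit (u y)) ->
  (forall y, Dom y -> gdens y = m y * csqrt (u y)) ->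
  (forall x, a < x < b -> exists2 v : R, 0 < v & u (phi x)%:C = v%:C) ->
  (\forall y \near (e%:C : C^o), Dom y -> 
     0 < normc (y - e%:C) /\ normc (Lc y) <= `|ln (normc (y - e%:C))| + KL) ->
  exists2 K : R, 0 < K & \forall y \near (e%:C : C^o), Dom y ->
    normc (Gh y) * Num.sqrt (normc (y - e%:C)) <= K.
Proof.
move=> e0 Cm Cu du c0 ue us gE uv hL.
have [Lm Lm0 [dm dm0 hm]] := Cn_lip Cm.
have [Lu Lu0 [du0 du00 hu]] := Cn_lip Cu.
have c2 : 0 < normc c / 2 by rewrite divr_gt0 ?normc_gt0.
have [d1 d10 h1] := (nbhsC _ _).1 ((cder_eps _ _ _).1 du _ c2).
have [d2 d20 h2] := (nbhsC _ _).1 (filterI (ccont_bounded (Cn_ccont Cm)) (ccont_bounded (Cn_ccont Cu))).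
pose d := Num.min (Num.min dm du0) (Num.min d1 d2).
have d0 : 0 < d by rewrite !lt_min dm0 du00 d10 d20.
pose Km := normc (m e%:C) + 1.
have Km0 : 0 < Km by rewrite ltr_wpDl// normc_ge0.
have small y : normc (y - e%:C) < d ->
    [/\ normc (m y) <= Km, normc (u y) <= 1 &
     (normc c / 2) * normc (y - e%:C) <= normc (u y)].
  rewrite !lt_min => /andP[/andP[_ _] /andP[y1 y2]].
  have [k1 k2] := h2 y y2; split => //; first by move: k2; rewrite ue normc0 add0r.
  have := h1 y y1; rewrite ue subr0 => k3.
  have := ler_distc (c * (y - e%:C)) (u y); rewrite normcB normcM; lra.
pose k := Num.sqrt (normc c / 2).
have k0 : 0 < k by rewrite sqrtr_gt0.
have root y : Dom y -> normc (y - e%:C) < d ->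
    k * Num.sqrt (normc (y - e%:C)) <= normc (csqrt (u y)) <= 1.
  move=> Dy yd; have [_ k1 k2] := small y yd; have n0 := normc_ge0 (csqrt (u y)).
  have := normc_csqrt2 (us y Dy) => k3.
  rewrite -[normc (csqrt _)]ger0_norm// -sqrtr_sqr k3 /k -sqrtrM ?(ltW c2)//.
  by rewrite ler_wsqrtr//= -[leRHS]sqrtr1 ler_wsqrtr.
pose C1 := Km * Lu + Lm.
have C10 : 0 < C1 by rewrite addr_gt0// mulr_gt0.
pose C2 := C1 + (Km + gbound) * (d / 2)^-1.
have g0 := gbound_ge0.
have C20 : 0 < C2.
  by rewrite ltr_wpDr// mulr_ge0 ?invr_ge0 ?divr_ge0 ?(ltW d0)// addr_ge0// ltW.
have hQ y x : Dom y -> normc (y - e%:C) < d / 2 -> a < x < b ->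
    normc (Qd y x) * normc (csqrt (u y)) <= C2.
  move=> Dy yd hx.
  have yd' : normc (y - e%:C) < d by lra.
  have [my uy _] := small y yd'; have /andP[_ r1] := root y Dy yd'.
  have r0 := normc_ge0 (csqrt (u y)).
  have [yx|yx] := eqVneq y (phi x)%:C.
    have -> : Qd y x = 0 by rewrite /Qd /kern yx subrr invr0 mulr0.
    by rewrite normc0 mul0r ltW.
  have n0 : 0 < normc (y - (phi x)%:C) by rewrite normc_gt0 subr_eq0.
  have Dx : Dom (phi x)%:C by right; exact: phi_range.
  rewrite /Qd /kern normcM normcV -mulrA mulrCA mulrC ler_pdivrMr//.
  have [xd|xd] := ltrP (normc ((phi x)%:C - e%:C)) d.
    have [v v0 uvx] := uv x hx.
    have [mx ux _] := small _ xd; have /andP[_ rx1] := root _ Dx xd.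
    have -> : gdens y - (greal x)%:C = m y * (csqrt (u y) - csqrt (u (phi x)%:C)) +
       (m y - m (phi x)%:C) * csqrt (u (phi x)%:C).
      by rewrite -gdens_phi// !gE//; ring.
    apply: (@le_trans _ _ (C1 * normc (y - (phi x)%:C))); last first.
      by apply: ler_wpM2r; [exact: ltW|rewrite lerDl mulr_ge0 ?invr_ge0 ?divr_ge0 ?(ltW d0)// addr_ge0// ltW].
    apply: (@le_trans _ _ (normc (m y) * (normc (csqrt (u y) - csqrt (u (phi x)%:C)) * normc (csqrt (u y))) +
       normc (m y - m (phi x)%:C) * normc (csqrt (u (phi x)%:C)) * normc (csqrt (u y)))).
      apply: le_trans (ler_wpM2r r0 (le_normcD _ _)) _.
      rewrite [leLHS]mulrDl; apply: lerD; last by rewrite (normcM (m y - _)).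
      by rewrite (normcM (m y)) mulrA.
    have s1 := normc_csqrtB (us y Dy) v0; rewrite -uvx in s1.
    move: yd' xd; rewrite !lt_min => /andP[/andP[y1 y2] _] /andP[/andP[x1 x2] _].
    have s2 := hu _ _ y2 x2; have s3 := hm _ _ y1 x1.
    rewrite /C1 mulrDl lerD//.
      rewrite -mulrA ler_pM ?mulr_ge0 ?normc_ge0//; exact: le_trans s1 s2.
    apply: le_trans s3; rewrite -mulrA ler_piMr ?normc_ge0//.
    by rewrite -[1]mulr1 ler_pM ?normc_ge0.
  have n1 : d / 2 <= normc (y - (phi x)%:C).
    have := normc_tri (phi x)%:C y e%:C; rewrite (normcB _ y); lra.
  apply: (@le_trans _ _ (Km + gbound)).
    rewrite -[leRHS]mulr1 ler_pM ?normc_ge0//.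
    apply: le_trans (ler_normcB _ _) _; apply: lerD.
      by rewrite gE// normcM -[leRHS]mulr1 ler_pM ?normc_ge0.
    by rewrite normc_real ger0_norm ?greal_ge0// greal_le.
  have : (Km + gbound) * (d / 2)^-1 * (d / 2) <= (Km + gbound) * (d / 2)^-1 * normc (y - (phi x)%:C).
    by apply: ler_wpM2l => //; rewrite mulr_ge0 ?invr_ge0 ?divr_ge0 ?(ltW d0)// addr_ge0// ltW.
  rewrite divfK; last by rewrite gt_eqF// divr_gt0.
  have : 0 <= C1 * normc (y - (phi x)%:C) by rewrite mulr_ge0 ?normc_ge0// ltW.
  rewrite /C2 [X in _ -> _ -> _ <= X]mulrDl; move: (_ / (d / 2) * _) => t; lra.
have wa0 : 0 < wt a by exact: wt_gt0.
pose KQ := 2 * (b - a) * (wt a * C2) / k.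
exists (Km * (2 + `|KL|) + KQ).
  have ba : 0 < b - a by rewrite subr_gt0.
  have t0 : 0 < KQ.
    by apply: divr_gt0 => //; apply: mulr_gt0 (mulr_gt0 _ ba) (mulr_gt0 wa0 C20).
  by rewrite ltr_wpDl// mulr_ge0 ?(ltW Km0)// addr_ge0.
have m0 : 0 < Num.min (d / 2) 1 by rewrite lt_min ltr01 divr_gt0.
apply: filterS2 hL (near_normc e%:C m0) => y hLy; rewrite lt_min => /andP[yd y1] Dy.
have [n0 L1] := hLy Dy; have yd' : normc (y - e%:C) < d by lra.
have [my uy _] := small y yd'; have /andP[r1 r2] := root y Dy yd'.
set s := Num.sqrt (normc (y - e%:C)) in r1 *.
have s0 : 0 < s by rewrite sqrtr_gt0.
have s1 : s <= 1 by rewrite -[leRHS]sqrtr1 ler_wsqrtr// ltW.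
apply: (@le_trans _ _ (normc (gdens y) * (normc (Lc y) * s) +
   normc (cint a b (fun x => (wt x)%:C * Qd y x)) * s)).
  by rewrite mulrA -mulrDl -normcM; apply: ler_wpM2r; [exact: ltW|exact: ler_normcB].
apply: lerD.
  rewrite ler_pM ?normc_ge0 ?mulr_ge0 ?normc_ge0 ?(ltW s0)//.
    by rewrite gE// normcM -[leRHS]mulr1 ler_pM ?normc_ge0.
  have := ler_wpM2r (ltW s0) L1; rewrite mulrDl => h.
  have := norm_ln_sqrt n0 (ltW y1); rewrite -/s => h'.
  have : KL * s <= `|KL|.
    apply: (@le_trans _ _ (`|KL| * s)); first by apply: ler_wpM2r; [exact: ltW|exact: ler_norm].
    by rewrite ler_piMr.
  lra.
rewrite /KQ ler_pdivlMr// -[leLHS]mulrA.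
have ru : normc (csqrt (u y)) != 0.
  by rewrite gt_eqF//; apply: lt_le_trans r1; rewrite mulr_gt0.
set ru1 := normc (csqrt (u y)) in r1 r2 ru *.
have ru0 : 0 < ru1 by rewrite lt_neqAle eq_sym ru normc_ge0.
apply: (@le_trans _ _ (normc (cint a b (fun x => (wt x)%:C * Qd y x)) * ru1)).
  by apply: ler_wpM2l; rewrite ?normc_ge0// mulrC.
rewrite -ler_pdivlMr// -[leRHS]mulrA; apply: (normc_cint_cst hab (bm_wtQd Dy)).
move=> x; rewrite inD => hx; rewrite ler_pdivlMr// normcM normc_real ger0_norm ?wt_ge0//.
rewrite -mulrA ler_pM ?wt_ge0 ?mulr_ge0 ?normc_ge0 ?wt_le//.
exact: hQ.
Qed.

Lemma cder_zeta z : slit z -> exists2 c, cder zeta z c & c != 0.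
Proof.
move=> zs; have h := cder_comp (cderM (cder_cst (- q)%:C _) (cder_Log zs)) (cder_cexp _).
exists (cexp ((- q)%:C * Log z) * (0 * Log z + (- q)%:C * z^-1)) => //.
rewrite mul0r add0r; apply: mulf_neq0; first exact: cexp_neq0.
apply: mulf_neq0; last by rewrite invr_neq0// slit_neq0.
by rewrite -normc_gt0 normc_real normr_gt0 oppr_eq0 gt_eqF ?q_gt0.
Qed.

Lemma endA_zeta : zeta A%:C = b%:C. Proof. exact: zeta_phi hb. Qed.
Lemma endB_zeta : zeta B%:C = a%:C. Proof. exact: zeta_phi ha. Qed.

Lemma normc_Gh_A : exists2 K : R, 0 < K & \forall y \near (A%:C : C^o), Dom y ->
  normc (Gh y) * Num.sqrt (normc (y - A%:C)) <= K.
Proof.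
have As := slit_real A_gt0; have [c dc c0] := cder_zeta As.
have BA : 0 < B - A by rewrite subr_gt0 A_lt_B.
pose m y := q%:C * y^-1 * csqrt (zeta y - a%:C) * gsum y.
have sA : slit (zeta A%:C - a%:C).
  by rewrite endA_zeta -rmorphB; apply: slit_real; rewrite subr_gt0.
apply: (@normc_Gh_endpoint A m (fun y => b%:C - zeta y) (0 - c)
   (normc (Log (B%:C - A%:C)) + 1 + 2 * pi)) => //.
- exact: A_gt0.
- apply: CnM; last exact: Cn_gsum.
  apply: CnM; first by apply: CnM; [exact: Cn_cst|exact: Cn_inv0 (slit_neq0 As)].
  by apply: Cn_comp; [apply: CnB; [exact: Cn_zeta|exact: Cn_cst]|exact: Cn_csqrt].
- by apply: CnB; [exact: Cn_cst|exact: Cn_zeta].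
- by apply: cderB => //; exact: cder_cst.
- by rewrite sub0r oppr_eq0.
- by rewrite endA_zeta subrr.
- by move=> y /zeta_slit[].
- by move=> y Dy; rewrite /gdens /m /rootS /gsum; ring.
- move=> x /andP[ax xb]; exists (b - x); first by rewrite subr_gt0.
  by rewrite zeta_phi ?rmorphB// (lt_trans ha).
have BAs : slit (B%:C - A%:C) by rewrite -rmorphB; exact: slit_real.
have cl : ccont (fun y => Log (B%:C - y)) A%:C.
  apply: ccont_comp; first by apply: ccontB; [exact: ccont_cst|exact: ccont_id].
  exact: ccont_Log.
apply: filterS (ccont_bounded cl) => y hy Dy.
have sy := Dom_slitA Dy; split; first exact: slit_normc.
rewrite /Lc; apply: le_trans (ler_normcB _ _) _.
have := ler_normcB (Log (y - A%:C)) (Log (B%:C - y)).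
have := normc_Log_le (y - A%:C).
rewrite normc_ipi; lra.
Qed.

Lemma normc_Gh_B : exists2 K : R, 0 < K & \forall y \near (B%:C : C^o), Dom y ->
  normc (Gh y) * Num.sqrt (normc (y - B%:C)) <= K.
Proof.
have Bs := slit_real B_gt0; have [c dc c0] := cder_zeta Bs.
have BA : 0 < B - A by rewrite subr_gt0 A_lt_B.
pose m y := q%:C * y^-1 * csqrt (b%:C - zeta y) * gsum y.
have sB : slit (b%:C - zeta B%:C).
  by rewrite endB_zeta -rmorphB; apply: slit_real; rewrite subr_gt0.
apply: (@normc_Gh_endpoint B m (fun y => zeta y - a%:C) (c - 0)
   (normc (Log (B%:C - A%:C)) + 1 + 2 * pi)) => //.
- exact: B_gt0.
- apply: CnM; last exact: Cn_gsum.
  apply: CnM; first by apply: CnM; [exact: Cn_cst|exact: Cn_inv0 (slit_neq0 Bs)].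
  by apply: Cn_comp; [apply: CnB; [exact: Cn_cst|exact: Cn_zeta]|exact: Cn_csqrt].
- by apply: CnB; [exact: Cn_zeta|exact: Cn_cst].
- by apply: cderB => //; exact: cder_cst.
- by rewrite subr0.
- by rewrite endB_zeta subrr.
- by move=> y /zeta_slit[].
- by move=> y Dy; rewrite /gdens /m /rootS /gsum; ring.
- move=> x /andP[ax xb]; exists (x - a); first by rewrite subr_gt0.
  by rewrite zeta_phi ?rmorphB// (lt_trans ha).
have BAs : slit (B%:C - A%:C) by rewrite -rmorphB; exact: slit_real.
have cl : ccont (fun y => Log (y - A%:C)) B%:C.
  apply: ccont_comp; first by apply: ccontB; [exact: ccont_id|exact: ccont_cst].
  exact: ccont_Log.
apply: filterS (ccont_bounded cl) => y hy Dy.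
have sy := Dom_slitB Dy; rewrite normcB; split; first exact: slit_normc.
rewrite /Lc; apply: le_trans (ler_normcB _ _) _.
have := ler_normcB (Log (y - A%:C)) (Log (B%:C - y)).
have := normc_Log_le (B%:C - y).
rewrite normc_ipi; lra.
Qed.

(** * A conformal map of the cut plane onto the upper half-plane *)

Definition mob z := (z - A%:C) / (B%:C - z).
Definition kap := Num.sqrt (A / B).
Definition pp z := csqrt (mob z).
Definition pk z := pp z + 'i * kap%:C.
(** The shift by [kap] sends the lower side of the origin to infinity. *)
Definition xi z := 'i / pk z.

Lemma kap_gt0 : 0 < kap. Proof. by rewrite sqrtr_gt0 divr_gt0 ?A_gt0 ?B_gt0. Qed.

Lemma sqr_kap : kap ^+ 2 = A / B.
Proof. by rewrite sqr_sqrtr// divr_ge0 ?(ltW A_gt0) ?(ltW B_gt0). Qed.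

Lemma Im_mob z : Im (mob z) = (B - A) * Im z / normc (B%:C - z) ^+ 2.
Proof. rewrite /mob ImM ReVn ImVn !ReImE; ring. Qed.

Lemma Dom_neqB z : Dom z -> B%:C - z != 0.
Proof. by move=> /Dom_slitB; exact: slit_neq0. Qed.

Lemma mob_slit z : Dom z -> slit (mob z).
Proof.
move=> Dz; have [iz|iz] := eqVneq (Im z) 0.
  have rz : A < Re z < B by case: Dz => [/eqP|//]; rewrite iz eqxx.
  rewrite /mob (real_complex iz) -!rmorphB -fmorphV -rmorphM.
  by apply: slit_real; case/andP: rz => r1 r2; rewrite divr_gt0 ?subr_gt0.
have nB : 0 < normc (B%:C - z) by rewrite normc_gt0 Dom_neqB.
apply: slit_Im; rewrite Im_mob; apply: mulf_neq0.
  by apply: mulf_neq0 => //; rewrite gt_eqF// subr_gt0 A_lt_B.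
by rewrite invr_neq0// expf_neq0// gt_eqF.
Qed.

Lemma sqr_pp z : Dom z -> pp z ^+ 2 = mob z.
Proof. by move=> /mob_slit; exact: sqr_csqrt. Qed.

Lemma normc_pp2 z : Dom z -> normc (pp z) ^+ 2 = normc (mob z).
Proof. by move=> /mob_slit; exact: normc_csqrt2. Qed.

Lemma Re_pp_gt0 z : Dom z -> 0 < Re (pp z).
Proof. by move=> /mob_slit; exact: Re_csqrt_gt0. Qed.

Lemma Re_pk z : Re (pk z) = Re (pp z).
Proof. rewrite /pk !ReImE; ring. Qed.

Lemma Im_pk z : Im (pk z) = Im (pp z) + kap.
Proof. rewrite /pk !ReImE; ring. Qed.

Lemma pk_neq0 z : Dom z -> pk z != 0.
Proof. by move=> /Re_pp_gt0; rewrite -Re_pk; apply: contraTneq => ->; rewrite ltxx. Qed.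

Lemma Im_xi z : Im (xi z) = Re (pp z) / normc (pk z) ^+ 2.
Proof. rewrite /xi ImM ReVn Re_pk !ReImE; ring. Qed.

Lemma Im_xi_gt0 z : Dom z -> 0 < Im (xi z).
Proof.
by move=> Dz; rewrite Im_xi divr_gt0 ?Re_pp_gt0// exprn_gt0// normc_gt0 pk_neq0.
Qed.

Lemma normc_xi z : normc (xi z) = (normc (pk z))^-1.
Proof. by rewrite normcM normc_i normcV mul1r. Qed.

Lemma pk_mul z : Dom z -> pk z * (pp z - 'i * kap%:C) = mob z + (kap ^+ 2)%:C.
Proof.
move=> Dz; rewrite -sqr_pp// rmorphXn /pk.
have ii : ('i : C) * 'i = -1 by apply: complexP; rewrite !ReImE; ring.
transitivity (pp z ^+ 2 - 'i * 'i * (kap%:C) ^+ 2); first by ring.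
by rewrite ii; ring.
Qed.

Lemma mob_kap z : B%:C - z != 0 ->
  mob z + (kap ^+ 2)%:C = ((B - A) / B)%:C * (z / (B%:C - z)).
Proof.
move=> zB; have B0 : B%:C != 0 :> C by exact: slit_neq0 (slit_real B_gt0).
by rewrite sqr_kap /mob !rmorphM !fmorphV rmorphB; field; rewrite B0 zB.
Qed.

Lemma Im_xi_le z : Dom z ->
  Im (xi z) * normc (mob z + (kap ^+ 2)%:C) ^+ 2 <= Re (pp z) * (normc (pp z) + kap) ^+ 2.
Proof.
move=> Dz; have k0 := kap_gt0; have n0 : 0 < normc (pk z) by rewrite normc_gt0 pk_neq0.
have h : normc (mob z + (kap ^+ 2)%:C) <= normc (pk z) * (normc (pp z) + kap).
  rewrite -pk_mul// normcM; apply: ler_wpM2l; first exact: normc_ge0.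
  apply: le_trans (ler_normcB _ _) _; rewrite lerD2l normcM normc_i mul1r normc_real.
  by rewrite gtr0_norm.
rewrite Im_xi mulrAC ler_pdivrMr ?exprn_gt0// -mulrA -exprMn mulrC [leRHS]mulrC [_ * normc (pk z)]mulrC.
apply: ler_wpM2r; first exact: ltW (Re_pp_gt0 Dz).
by rewrite ler_sqr ?nnegrE ?normc_ge0 ?mulr_ge0 ?addr_ge0 ?normc_ge0 ?(ltW k0).
Qed.

Lemma Re_pp_sqr z : Dom z -> 2 * Re (pp z) ^+ 2 = normc (mob z) + Re (mob z).
Proof. by move=> Dz; rewrite Re_sqrt_sqr sqr_pp. Qed.

Lemma Re_pp_small z (u d eps : R) : Dom z -> u <= 0 -> normc (mob z - u%:C) < d ->
  d <= eps ^+ 2 -> 0 < eps -> Re (pp z) < eps.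
Proof.
move=> Dz u0 zd de e0; rewrite -ltr_sqr ?nnegrE ?(ltW e0) ?(ltW (Re_pp_gt0 Dz))//.
have := Re_pp_sqr Dz; have := ler_distc (mob z) u%:C; rewrite normc_real ler0_norm//.
have := Re_le_normc (mob z - u%:C); rewrite ReD ReN ReC; lra.
Qed.

(** The point [u = - kap ^+ 2], the image of the origin, is the only point of
    the cut over which one side is sent to infinity. *)
Lemma Im_xi_small (u eps : R) : u <= 0 -> u + kap ^+ 2 != 0 -> 0 < eps ->
  exists2 d : R, 0 < d & forall z, Dom z -> normc (mob z - u%:C) < d -> Im (xi z) < eps.
Proof.
move=> u0 uk e0; have k0 := kap_gt0.
pose H := `|u + kap ^+ 2|; have H0 : 0 < H by rewrite normr_gt0.
pose K := (2 - u + kap) ^+ 2; have K0 : 0 < K by rewrite exprn_gt0//; lra.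
pose e1 := eps * (H / 2) ^+ 2 / (2 * K).
have H2 : 0 < (H / 2) ^+ 2 by rewrite exprn_gt0// divr_gt0.
have e10 : 0 < e1 by apply: divr_gt0; apply: mulr_gt0.
exists (Num.min (Num.min 1 (H / 2)) (e1 ^+ 2)).
  by rewrite !lt_min ltr01 divr_gt0//= exprn_gt0.
move=> z Dz; rewrite !lt_min => /andP[/andP[z1 z2] z3].
have r1 := Re_pp_small Dz u0 z3 (lexx _) e10.
have p0 := Re_pp_gt0 Dz; have n0 := normc_ge0 (pp z).
have m1 : normc (mob z) <= 1 - u.
  by have := ler_distc (mob z) u%:C; rewrite normc_real ler0_norm//; lra.
have p2 : normc (pp z) <= 2 - u.
  have u2 : 0 <= 2 - u by lra.
  rewrite -ler_sqr ?nnegrE// normc_pp2//; apply: le_trans m1 _.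
  have : 0 <= u ^+ 2 by rewrite sqr_ge0.
  rewrite !expr2; lra.
have H3 : H / 2 <= normc (mob z + (kap ^+ 2)%:C).
  have := ler_distc (u%:C + (kap ^+ 2)%:C) (u%:C - mob z).
  rewrite -rmorphD normc_real -/H (normcB u%:C).
  have -> : (u + kap ^+ 2)%:C - (u%:C - mob z) = mob z + (kap ^+ 2)%:C by rewrite rmorphD; ring.
  lra.
have x0 := Im_xi_gt0 Dz.
have L : Im (xi z) * (H / 2) ^+ 2 <= e1 * K.
  apply: (@le_trans _ _ (Im (xi z) * normc (mob z + (kap ^+ 2)%:C) ^+ 2)).
    apply: ler_wpM2l; first exact: ltW.
    by rewrite ler_sqr ?nnegrE ?normc_ge0 ?divr_ge0 ?(ltW H0).
  apply: le_trans (Im_xi_le Dz) _; rewrite ler_pM ?(ltW p0) ?(ltW r1) ?sqr_ge0//.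
  rewrite ler_sqr ?nnegrE ?addr_ge0 ?(ltW k0)//; lra.
have e1K : e1 * K = eps / 2 * (H / 2) ^+ 2 by rewrite /e1; field; rewrite gt_eqF.
by move: L; rewrite e1K ler_pM2r// => L; lra.
Qed.

Lemma ccont_mob z : B%:C - z != 0 -> ccont mob z.
Proof.
move=> zB; apply: ccontM; first by apply: ccontB; [exact: ccont_id|exact: ccont_cst].
by apply: ccontV => //; apply: ccontB; [exact: ccont_cst|exact: ccont_id].
Qed.

Lemma Im_xi_boundary (e eps : R) : ~~ (A < e < B) -> e != 0 -> e != B -> 0 < eps ->
  \forall y \near (e%:C : C^o), Dom y -> Im (xi y) < eps.
Proof.
move=> eAB e0 eB eps0; have AB := A_lt_B.
have eB' : B - e != 0 by rewrite subr_eq0 eq_sym.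
have eBC : B%:C - e%:C != 0 :> C by rewrite -rmorphB -normc_gt0 normc_real normr_gt0.
have mobe : mob e%:C = ((e - A) / (B - e))%:C.
  by rewrite /mob -!rmorphB -fmorphV -rmorphM.
have u0 : (e - A) / (B - e) <= 0.
  have [h|h] := lerP e A.
    by rewrite mulr_le0_ge0 ?subr_le0// invr_ge0 subr_ge0; lra.
  have h' : B <= e by move: eAB; rewrite h /= -leNgt.
  rewrite mulr_ge0_le0 ?subr_ge0 ?(ltW h)// invr_le0 subr_le0//.
have uk : (e - A) / (B - e) + kap ^+ 2 != 0.
  have B0 : B != 0 by rewrite gt_eqF// B_gt0.
  have -> : (e - A) / (B - e) + kap ^+ 2 = e * (B - A) / (B * (B - e)).
    by rewrite sqr_kap; field; rewrite B0 eB'.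
  apply: mulf_neq0; first by apply: mulf_neq0; rewrite // subr_eq0 gt_eqF.
  by rewrite invr_neq0// mulf_neq0.
have [d d0 hd] := Im_xi_small u0 uk eps0.
have /climP := ccont_mob eBC; rewrite mobe => /(_ d d0).
by apply: filterS => y h Dy; exact: hd.
Qed.

Lemma Im_xi_infty (eps : R) : 0 < eps ->
  exists M : R, forall z, Dom z -> M < normc z -> Im (xi z) < eps.
Proof.
move=> eps0; have AB := A_lt_B; have B0 := B_gt0.
have N1 : -1 <= 0 :> R by lra.
have uk : -1 + kap ^+ 2 != 0.
  have h : A / B < 1 by rewrite ltr_pdivrMr// mul1r.
  by rewrite sqr_kap lt_eqF//; lra.
have [d d0 hd] := Im_xi_small N1 uk eps0.
exists (B + (B - A) / d) => z Dz zM; apply: hd => //.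
have zB := Dom_neqB Dz.
have -> : mob z - (-1)%:C = (B - A)%:C / (B%:C - z).
  by rewrite /mob rmorphN rmorph1 rmorphB; field.
have BA : 0 < B - A by rewrite subr_gt0.
have nB : 0 < normc (B%:C - z) by rewrite normc_gt0.
rewrite normcM normcV normc_real gtr0_norm// ltr_pdivrMr// mulrC -ltr_pdivrMr//.
by have := ler_distc z B%:C; rewrite normc_real gtr0_norm// normcB; lra.
Qed.

Lemma normc_B_ge z : normc z < B / 2 -> B / 2 < normc (B%:C - z).
Proof. by have := ler_distc B%:C z; rewrite normc_real gtr0_norm ?B_gt0//; lra. Qed.

Lemma Im_pp_sign z : Dom z -> 0 < Im z * Im (pp z) \/ Im z = 0.
Proof.
move=> Dz; have [iz|iz] := eqVneq (Im z) 0; [by right|left].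
have p0 := Re_pp_gt0 Dz; have AB := A_lt_B.
have e : 2 * Re (pp z) * Im (pp z) = (B - A) * Im z / normc (B%:C - z) ^+ 2.
  by rewrite -Im_mob -sqr_pp// expr2 ImM; ring.
have nB : 0 < normc (B%:C - z) by rewrite normc_gt0 Dom_neqB.
have : 0 < Im z * (2 * Re (pp z) * Im (pp z)).
  rewrite e; have -> : Im z * ((B - A) * Im z / normc (B%:C - z) ^+ 2) =
     Im z ^+ 2 * ((B - A) / normc (B%:C - z) ^+ 2) by ring.
  by apply: mulr_gt0; rewrite ?exprn_even_gt0// divr_gt0 ?exprn_gt0 ?subr_gt0.
by rewrite mulrCA pmulr_rgt0// mulr_gt0.
Qed.

Lemma Im_xi_zero_up (eps : R) : 0 < eps ->
  \forall y \near ((0 : C) : C^o), 0 < Im y -> Im (xi y) < eps.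
Proof.
move=> eps0; have k0 := kap_gt0; have B0 := B_gt0.
have e0 : 0 < eps * kap ^+ 2 by rewrite mulr_gt0// exprn_gt0.
have zB : B%:C - 0 != 0 :> C by rewrite subr0; exact: slit_neq0 (slit_real B0).
have m0 : mob 0 = (- kap ^+ 2)%:C.
  apply/eqP; rewrite -subr_eq0 -rmorphN opprK; apply/eqP.
  by rewrite mob_kap// mul0r mulr0.
have d0 : 0 < (eps * kap ^+ 2) ^+ 2 by rewrite exprn_gt0.
have /climP := ccont_mob zB; rewrite m0 => /(_ _ d0).
apply: filterS => y yd iy; have Dy : Dom y by left; apply/eqP; rewrite gt_eqF.
have kn : - kap ^+ 2 <= 0 by rewrite oppr_le0 sqr_ge0.
have := Re_pp_small Dy kn yd (lexx _) e0 => h.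
have ip : 0 < Im (pp y).
  by case: (Im_pp_sign Dy) => [|h']; [rewrite pmulr_rgt0|move: iy; rewrite h' ltxx].
have kp : kap <= normc (pk y).
  by apply: le_trans (Im_le_normc _); rewrite Im_pk; lra.
have n0 : 0 < normc (pk y) by rewrite (lt_le_trans k0).
rewrite Im_xi ltr_pdivrMr ?exprn_gt0//; apply: lt_le_trans h _.
apply: ler_wpM2l; first exact: ltW.
by rewrite ler_sqr ?nnegrE ?(ltW k0) ?(ltW n0).
Qed.

Lemma Im_xi_A : exists2 K : R, 0 < K &
  \forall y \near (A%:C : C^o), Dom y -> Im (xi y) <= K * Num.sqrt (normc (y - A%:C)).
Proof.
have k0 := kap_gt0; have AB := A_lt_B; have BA : 0 < B - A by rewrite subr_gt0.
have zB : B%:C - A%:C != 0 :> C by rewrite -rmorphB; exact: slit_neq0 (slit_real BA).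
have m0 : mob A%:C = 0 by rewrite /mob subrr mul0r.
have kk : 0 < kap ^+ 2 / 2 by rewrite divr_gt0// exprn_gt0.
have d0 : 0 < Num.min 1 (kap ^+ 2 / 2) by rewrite lt_min ltr01.
have b2 : 0 < (B - A) / 2 by rewrite divr_gt0.
pose k1 := Num.sqrt ((B - A) / 2)^-1.
have k10 : 0 < k1 by rewrite sqrtr_gt0 invr_gt0.
have k2 : 0 < (1 + kap) ^+ 2 by rewrite exprn_gt0//; lra.
have k3 : 0 < (kap ^+ 2 / 2) ^+ 2 by rewrite exprn_gt0.
exists (k1 * (1 + kap) ^+ 2 / (kap ^+ 2 / 2) ^+ 2).
  by apply: divr_gt0 => //; apply: mulr_gt0.
have /climP := ccont_mob zB; rewrite m0 => /(_ _ d0) cm.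
apply: filterS2 cm (near_normc A%:C b2) => y; rewrite subr0 lt_min => /andP[m1 m2] yA Dy.
have yB : (B - A) / 2 <= normc (B%:C - y).
  have := normc_tri B%:C y A%:C; rewrite -rmorphB normc_real gtr0_norm//; lra.
have n0 := normc_ge0 (pp y).
have p1 : normc (pp y) <= 1.
  by rewrite -(@ler_sqr R) ?nnegrE// normc_pp2// expr1n ltW.
have ps : normc (pp y) <= k1 * Num.sqrt (normc (y - A%:C)).
  rewrite /k1 -sqrtrM ?invr_ge0 ?(ltW b2)// -[leLHS]ger0_norm// -sqrtr_sqr normc_pp2//.
  apply: ler_wsqrtr; rewrite /mob normcM normcV mulrC.
  by apply: ler_wpM2r; rewrite ?normc_ge0// lef_pV2 ?posrE// (lt_le_trans b2).
have mk : kap ^+ 2 / 2 <= normc (mob y + (kap ^+ 2)%:C).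
  have := ler_distc (kap ^+ 2)%:C (- mob y); rewrite opprK normcN normc_real.
  by rewrite ger0_norm ?sqr_ge0// [mob y + _]addrC; lra.
rewrite mulrAC ler_pdivlMr//.
apply: (@le_trans _ _ (Im (xi y) * normc (mob y + (kap ^+ 2)%:C) ^+ 2)).
  apply: ler_wpM2l; first exact: ltW (Im_xi_gt0 Dy).
  by rewrite ler_sqr ?nnegrE ?normc_ge0 ?(ltW kk).
apply: le_trans (Im_xi_le Dy) _; rewrite mulrAC.
rewrite ler_pM ?(ltW (Re_pp_gt0 Dy)) ?sqr_ge0 ?(le_trans (Re_le_normc _))//.
rewrite ler_sqr ?nnegrE ?addr_ge0 ?(ltW k0)//; lra.
Qed.

Lemma Im_xi_B : exists2 K : R, 0 < K &
  \forall y \near (B%:C : C^o), Dom y -> Im (xi y) <= K * Num.sqrt (normc (y - B%:C)).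
Proof.
have k0 := kap_gt0; have AB := A_lt_B; have BA : 0 < B - A by rewrite subr_gt0.
have b2 : 0 < (B - A) / 2 by rewrite divr_gt0.
pose k1 := Num.sqrt ((B - A) / 2).
have k10 : 0 < k1 by rewrite sqrtr_gt0.
exists (2 / k1); first by rewrite divr_gt0.
have s0 : 0 < (k1 / (2 * kap)) ^+ 2 by rewrite exprn_gt0// divr_gt0// mulr_gt0.
apply: filterS2 (near_normc B%:C b2) (near_normc B%:C s0) => y y1 y2 Dy.
have yB : 0 < normc (y - B%:C) by rewrite normcB normc_gt0 Dom_neqB.
have yA : (B - A) / 2 <= normc (y - A%:C).
  have := normc_tri B%:C y A%:C; rewrite -rmorphB normc_real gtr0_norm// (normcB B%:C); lra.
set s := Num.sqrt (normc (y - B%:C)).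
have sp : 0 < s by rewrite sqrtr_gt0.
have s2 : s < k1 / (2 * kap).
  have e : k1 / (2 * kap) = Num.sqrt ((k1 / (2 * kap)) ^+ 2).
    by rewrite sqrtr_sqr ger0_norm// divr_ge0 ?mulr_ge0 ?(ltW k0) ?(ltW k10).
  by rewrite e ltr_sqrt.
have ps : k1 <= normc (pp y) * s.
  rewrite /k1 -[normc (pp y)]ger0_norm ?normc_ge0// -sqrtr_sqr normc_pp2// /s -sqrtrM ?normc_ge0//.
  apply: ler_wsqrtr; rewrite /mob normcM normcV (normcB B%:C) divfK ?gt_eqF//.
have p2 : 2 * kap <= normc (pp y).
  move: s2; rewrite ltr_pdivlMr ?mulr_gt0// => s3.
  have : s * (2 * kap) <= s * normc (pp y) by rewrite [s * normc _]mulrC; lra.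
  by rewrite ler_pM2l.
have kp : normc (pp y) / 2 <= normc (pk y).
  have := ler_distc (pp y) (- ('i * kap%:C)); rewrite opprK normcN normcM normc_i normc_real mul1r gtr0_norm//.
  rewrite -/(pk y); lra.
have pk0 : 0 < normc (pk y) by rewrite normc_gt0 pk_neq0.
apply: le_trans (Im_le_normc _) _; rewrite normc_xi.
rewrite mulrAC ler_pdivlMr// mulrC ler_pdivrMr//.
apply: le_trans ps _; rewrite -mulrA mulrCA mulrC.
by apply: ler_wpM2l; [exact: ltW|lra].
Qed.

Definition xi_inv z := let u := ('i / z - 'i * kap%:C) ^+ 2 in (A%:C + B%:C * u) / (1 + u).

Lemma xi_pp z : Dom z -> 'i / xi z - 'i * kap%:C = pp z.
Proof.
move=> Dz; have k := pk_neq0 Dz.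
have i0 : ('i : C) != 0 by rewrite -normc_gt0 normc_i.
by rewrite /xi invf_div mulrCA divff// mulr1 /pk addrK.
Qed.

Lemma mob1_neq0 z : Dom z -> 1 + mob z != 0.
Proof.
move=> Dz; have zB := Dom_neqB Dz.
have -> : 1 + mob z = (B - A)%:C / (B%:C - z) by rewrite /mob rmorphB; field.
rewrite mulf_neq0 ?invr_neq0//; apply: slit_neq0; apply: slit_real.
by rewrite subr_gt0 A_lt_B.
Qed.

Lemma xiK z : Dom z -> xi_inv (xi z) = z.
Proof.
move=> Dz; have zB := Dom_neqB Dz; have m1 := mob1_neq0 Dz.
rewrite /xi_inv /= xi_pp// sqr_pp//; apply/eqP; rewrite -subr_eq0.
have -> : (A%:C + B%:C * mob z) / (1 + mob z) - z =
  (A%:C + B%:C * mob z - z * (1 + mob z)) / (1 + mob z) by field.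
have -> : A%:C + B%:C * mob z - z * (1 + mob z) = 0 by rewrite /mob; field.
by rewrite mul0r.
Qed.

Lemma xi_neq0 z : Dom z -> xi z != 0.
Proof. by move=> /Im_xi_gt0; apply: contraTneq => ->; rewrite ltxx. Qed.

Lemma Cn_xi_inv n z : Dom z -> Cn n xi_inv (xi z).
Proof.
move=> Dz; have cu : Cn n (fun y => ('i / y - 'i * kap%:C) ^+ 2) (xi z).
  have c1 : Cn n (fun y => 'i / y - 'i * kap%:C) (xi z).
    apply: CnB; last exact: Cn_cst.
    by apply: CnM; [exact: Cn_cst|exact: Cn_inv0 (xi_neq0 Dz)].
  exact: (CnM c1 c1).
apply: CnM; first by apply: CnD; [exact: Cn_cst|apply: CnM; [exact: Cn_cst|]].
apply: CnV; last by apply: CnD; [exact: Cn_cst|].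
by rewrite xi_pp// sqr_pp// mob1_neq0.
Qed.

Lemma Cn_xi n z : Dom z -> Cn n xi z.
Proof.
move=> Dz; apply: CnM; first exact: Cn_cst.
apply: CnV; first exact: pk_neq0.
apply: CnD; last exact: Cn_cst.
apply: Cn_comp; last exact: Cn_csqrt (mob_slit Dz).
apply: CnM; first by apply: CnB; [exact: Cn_id|exact: Cn_cst].
by apply: CnV; [exact: Dom_neqB|apply: CnB; [exact: Cn_cst|exact: Cn_id]].
Qed.

(** A quantitative injectivity: [xi] has a smooth left inverse. *)
Lemma xi_lip z : Dom z -> exists2 L : R, 0 < L & \forall y \near (z : C^o), Dom y ->
  normc (y - z) <= L * normc (xi y - xi z).
Proof.
move=> Dz; have [L L0 [d d0 hL]] := Cn_lip (Cn_xi_inv 1 Dz).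
exists L => //; have /climP /(_ _ d0) := Cn_ccont (Cn_xi 0 Dz).
apply: filterS => y yd Dy; rewrite -[y in X in X <= _](xiK Dy) -[z in X in X <= _](xiK Dz).
by apply: hL; rewrite ?subrr ?normc0.
Qed.

(** * Uniqueness *)

(** The denominator is real on the boundary of the half-plane, where the linear
    term of the numerator replaces [- Im w] by zero. *)
Definition Vf (x0 w x g : C) : R :=
  Im ((g - w + (- Im w / Im x0)%:C * (x - x0)) / ((x - x0) * (x - conjc x0))).

(** The imaginary part of the denominator is of the order of [Im x], so that the
    real part of [g] only enters multiplied by [Im x]. *)
Lemma Vf_ge (x0 w : C) : 0 < Im x0 -> Im w < 0 -> exists2 K : R, 0 < K &
  forall (x g : C) (tau : R), 0 < Im x -> Im x <= Im x0 / 2 -> 0 <= tau -> - tau <= Im g ->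
  - (K * (tau + Im x * (1 + normc g))) <= Vf x0 w x g.
Proof.
move=> y0 w0; pose Y := Im x0; have Y0 : 0 < Y := y0.
pose c := - Im w / Y; have c0 : 0 < c by rewrite divr_gt0// oppr_gt0.
have cY : c * Y = - Im w by rewrite /c divfK// gt_eqF.
pose k1 := 4 / (3 * Y ^+ 2).
have k10 : 0 < k1 by rewrite divr_gt0// mulr_gt0// exprn_gt0.
have k1E : k1 * (3 / 4 * Y ^+ 2) = 1 by rewrite /k1; field; rewrite gt_eqF.
pose W := 1 + normc w; have W0 : 0 < W by rewrite ltr_wpDr ?normc_ge0.
pose k2 := k1 / Y; have k20 : 0 < k2 by rewrite divr_gt0.
have k2E : k2 * Y = k1 by rewrite /k2 divfK// gt_eqF.
have p1 : 0 < k2 * W by apply: mulr_gt0.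
have p2 : 0 < c * k1 by apply: mulr_gt0.
exists (k1 + 2 * k2 * W + 2 * c * k1).
  lra.
move=> x g tau; pose t := Im x; rewrite -/t -/Y => t0 tY tau0 hg.
pose X := Re x - Re x0.
rewrite /Vf -/Y -/c; set n := g - w + _; set P := (x - x0) * _.
have ReP : Re P = X ^+ 2 + Y ^+ 2 - t ^+ 2 by rewrite /P !ReImE /X /Y /t; ring.
have ImP : Im P = 2 * t * X by rewrite /P !ReImE /X /t; ring.
have Imn : Im n = Im g + c * t.
  have -> : Im n = Im g - Im w + c * t - c * Y by rewrite /n !ReImE /t /Y; ring.
  by rewrite cY; ring.
have Ren : Re n = Re (g - w) + c * X by rewrite /n !ReImE /X; ring.
have t2 : t ^+ 2 <= Y ^+ 2 / 4.
  have -> : Y ^+ 2 / 4 = (Y / 2) ^+ 2 by field.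
  by rewrite ler_sqr ?nnegrE ?divr_ge0 ?(ltW t0) ?(ltW Y0).
have X2 : 0 <= X ^+ 2 by rewrite sqr_ge0.
have Y2 : 0 < Y ^+ 2 by rewrite exprn_gt0.
have Q : X ^+ 2 + 3 / 4 * Y ^+ 2 <= Re P by rewrite ReP; lra.
have P0 : 0 < Re P by apply: lt_le_trans Q; rewrite ltr_wpDl// mulr_gt0.
pose N2 := normc P ^+ 2.
have N2E : N2 = Re P ^+ 2 + Im P ^+ 2 := sqr_normcE P.
have PN : Re P ^+ 2 <= N2 by rewrite N2E lerDl sqr_ge0.
have N0 : 0 < N2 by apply: lt_le_trans PN; rewrite exprn_gt0.
have f1 : Re P <= k1 * N2.
  apply: (@le_trans _ _ (k1 * Re P ^+ 2)); last by apply: ler_wpM2l; [exact: ltW|].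
  have : k1 * (3 / 4 * Y ^+ 2 * Re P) <= k1 * (Re P * Re P).
    apply: ler_wpM2l; first exact: ltW.
    by apply: ler_wpM2r; [exact: ltW|lra].
  by rewrite mulrA k1E mul1r -expr2.
have f2 : X ^+ 2 <= k1 * N2 by apply: le_trans f1; lra.
have f3 : `|X| <= k2 * N2.
  rewrite -(ler_pM2r Y0) mulrAC k2E; apply: le_trans f1; apply: le_trans Q.
  have : 0 <= (`|X| - Y / 2) ^+ 2 by rewrite sqr_ge0.
  have : `|X| ^+ 2 = X ^+ 2 by rewrite real_normK ?num_real.
  move=> e; rewrite sqrrB e; have : (Y / 2) ^+ 2 = Y ^+ 2 / 4 by field.
  move=> ->; lra.
pose s := 1 + normc g; have s1 : 1 <= s by rewrite lerDl normc_ge0.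
have s0 : 0 < s by lra.
have gw : `|Re (g - w)| <= W * s.
  apply: le_trans (normc_Re _) _; apply: le_trans (ler_normcB _ _) _.
  have : 0 <= normc g * normc w by rewrite mulr_ge0 ?normc_ge0.
  rewrite /W /s; lra.
have VE : Im (n / P) = (Im n * Re P - Re n * Im P) / N2.
  by rewrite ImM ReVn ImVn -/N2; ring.
rewrite VE ler_pdivlMr// Imn Ren ImP -/s.
have a1 : - tau * Re P <= Im g * Re P by apply: ler_wpM2r; [exact: ltW|].
have a2 : tau * Re P <= tau * (k1 * N2) by apply: ler_wpM2l.
have a3 : Re (g - w) * X <= W * s * (k2 * N2).
  apply: le_trans (ler_norm _) _; rewrite normrM.
  by apply: ler_pM => //; rewrite normr_ge0.
have a3' : t * (Re (g - w) * X) <= t * (W * s * (k2 * N2)).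
  by apply: ler_wpM2l => //; exact: ltW.
have a4 : c * (t * X ^+ 2) <= c * (t * (k1 * N2)).
  by apply: ler_wpM2l; [exact: ltW|apply: ler_wpM2l => //; exact: ltW].
have a5 : 0 <= c * t * Re P := mulr_ge0 (mulr_ge0 (ltW c0) (ltW t0)) (ltW P0).
have b1 : 0 <= (2 * k2 * W + 2 * c * k1) * (tau * N2).
  by apply: mulr_ge0; [lra|exact: mulr_ge0 (ltW N0)].
have b2 : 0 <= k1 * (t * s * N2).
  by apply: mulr_ge0 (ltW k10) (mulr_ge0 (mulr_ge0 (ltW t0) (ltW s0)) (ltW N0)).
have b3 : 0 <= 2 * c * k1 * (t * (s - 1) * N2).
  apply: mulr_ge0; first lra.
  by apply: mulr_ge0 (ltW N0); apply: mulr_ge0; [exact: ltW|rewrite subr_ge0].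
have -> : (Im g + c * t) * Re P - (Re (g - w) + c * X) * (2 * t * X) =
  Im g * Re P + c * t * Re P - 2 * (t * (Re (g - w) * X)) - 2 * (c * (t * X ^+ 2)) by ring.
have -> : - ((k1 + 2 * k2 * W + 2 * c * k1) * (tau + t * s)) * N2 =
  - (tau * (k1 * N2)) - 2 * (t * (W * s * (k2 * N2))) - 2 * (c * (t * (k1 * N2)))
  - (2 * k2 * W + 2 * c * k1) * (tau * N2) - k1 * (t * s * N2)
  - 2 * c * k1 * (t * (s - 1) * N2) by ring.
lra.
Qed.

Lemma Vf_small (x0 w : C) (M eta : R) : 0 < Im x0 -> Im w < 0 -> 0 < eta ->
  exists2 d : R, 0 < d & forall x g : C, 0 < Im x -> Im x < d -> normc g <= M ->
    - d < Im g -> - eta < Vf x0 w x g.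
Proof.
move=> y0 w0 eta0; have [K K0 hK] := Vf_ge y0 w0.
pose S := 2 * (K * (2 + `|M|)).
have S0 : 0 < S by rewrite mulr_gt0// mulr_gt0// ltr_wpDr.
exists (Num.min (Im x0 / 2) (eta / S)); first by rewrite lt_min !divr_gt0.
move=> x g t0; rewrite lt_min => /andP[t1 t2] gM; set d := Num.min _ _ => hg.
have d0 : 0 < d by rewrite lt_min !divr_gt0.
have dS : d <= eta / S by rewrite ge_min lexx orbT.
have := hK x g d t0 (ltW t1) (ltW d0) (ltW hg); apply: lt_le_trans; rewrite ltrN2.
apply: (@le_lt_trans _ _ (K * (eta / S + eta / S * (1 + `|M|)))).
  apply: ler_wpM2l; first exact: ltW.
  apply: lerD => //; apply: ler_pM; rewrite ?(ltW t0) ?(ltW t2) ?addr_ge0 ?normc_ge0//.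
  by rewrite lerD2l (le_trans gM)// ler_norm.
have -> : K * (eta / S + eta / S * (1 + `|M|)) = eta / 2.
  rewrite /S; move: `|M| (normr_ge0 M) => m m0; field.
  by apply/andP; split; rewrite gt_eqF//; lra.
lra.
Qed.

Lemma Vf_bounded (x0 w : C) (M : R) : 0 < Im x0 -> Im w < 0 ->
  exists K : R, forall x g : C, 0 < Im x -> Im x <= Im x0 / 2 -> Im x * normc g <= M ->
    - 1 <= Im g -> - K <= Vf x0 w x g.
Proof.
move=> y0 w0; have [K K0 hK] := Vf_ge y0 w0.
exists (K * (1 + (Im x0 / 2 + M))) => x g t0 t1 gM hg.
apply: le_trans (hK x g 1 t0 t1 ler01 hg); rewrite lerN2.
apply: ler_wpM2l; first exact: ltW.
by rewrite lerD2l mulrDr mulr1 lerD.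
Qed.

Section Barrier.
Variables (z0 w : C).
Hypothesis Dz0 : Dom z0.
Hypothesis hw : Im w < 0.
Local Notation x0 := (xi z0).
Local Notation V := (fun z => Vf x0 w (xi z) (Gh z)).

Lemma y0 : 0 < Im x0. Proof. exact: Im_xi_gt0. Qed.

Lemma V_infty (eta : R) : 0 < eta ->
  exists M : R, forall z, Dom z -> M < normc z -> - eta < V z.
Proof.
move=> eta0; have [KG [MG hG]] := normc_Gh_infty.
have [d d0 hd] := Vf_small KG y0 hw eta0.
have [M1 h1] := Im_xi_infty d0; have [M2 _ h2] := Im_Gh_infty d0.
exists (Num.max MG (Num.max M1 M2)) => z Dz; rewrite !gt_max => /and3P[k1 k2 k3].
by apply: hd; [exact: Im_xi_gt0|exact: h1|exact: hG|exact: h2].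
Qed.

Lemma V_regular (e eta : R) : ~~ (A <= e <= B) -> e != 0 -> 0 < eta ->
  \forall y \near (e%:C : C^o), Dom y -> - eta < V y.
Proof.
move=> eAB e0 eta0; have AB := A_lt_B.
have eAB' : ~~ (A < e < B) by apply: contra eAB => /andP[/ltW -> /ltW ->].
have eB : e != B by apply: contraNneq eAB => ->; rewrite lexx ltW.
have [KG hG] := normc_Gh_bounded e0 eAB.
have [d d0 hd] := Vf_small KG y0 hw eta0.
have De : ~ Dom e%:C by move=> [|] //; rewrite ReC; exact/negP.
have e0' : e%:C != 0 :> C by rewrite -normc_gt0 normc_real normr_gt0.
apply: filterS3 hG (Im_xi_boundary eAB' e0 eB d0) (Im_Gh_boundary De e0' d0) => y k1 k2 k3 Dy.
by apply: hd; [exact: Im_xi_gt0|exact: k2|exact: k1|exact: k3].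
Qed.

Lemma V_endpoint (e : R) : e != 0 -> ~~ (A < e < B) ->
  (exists2 K : R, 0 < K & \forall y \near (e%:C : C^o), Dom y ->
     normc (Gh y) * Num.sqrt (normc (y - e%:C)) <= K) ->
  (exists2 K : R, 0 < K & \forall y \near (e%:C : C^o), Dom y ->
     Im (xi y) <= K * Num.sqrt (normc (y - e%:C))) ->
  exists M : R, \forall y \near (e%:C : C^o), Dom y -> - M <= V y.
Proof.
move=> e0 eAB [K1 K10 h1] [K2 K20 h2].
have De : ~ Dom e%:C by move=> [|] //; rewrite ReC; exact/negP.
have e0' : e%:C != 0 :> C by rewrite -normc_gt0 normc_real normr_gt0.
have [M hM] := Vf_bounded (K2 * K1) y0 hw; exists M.
pose r1 := Im x0 / 2 / K2.
have r10 : 0 < r1 by rewrite divr_gt0// divr_gt0// y0.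
have r20 : 0 < r1 ^+ 2 by rewrite exprn_gt0.
apply: filterS3 (filterI h1 h2) (near_normc e%:C r20) (Im_Gh_boundary De e0' ltr01) => y [k1 k2] k3 k4 Dy.
set s := Num.sqrt (normc (y - e%:C)) in k1 k2.
have s0 : 0 <= s := sqrtr_ge0 _.
have sr : s <= r1.
  by rewrite -[leRHS]gtr0_norm// -sqrtr_sqr ler_wsqrtr// ltW.
have t0 := Im_xi_gt0 Dy.
apply: hM => //; last exact: ltW (k4 Dy).
  apply: le_trans (k2 Dy) _; rewrite mulrC -ler_pdivlMr//.
apply: (@le_trans _ _ (K2 * s * normc (Gh y))).
  by apply: ler_wpM2r; [exact: normc_ge0|exact: k2].
by rewrite -mulrA; apply: ler_wpM2l; [exact: ltW|rewrite mulrC; exact: k1].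
Qed.

(** Below the origin the pole of order two of [xi ^+ 2] compensates the growth
    of [Gh]. *)
Lemma V_zero_down : exists M : R, \forall y \near ((0 : C) : C^o), Im y < 0 -> - M <= V y.
Proof.
have k0 := kap_gt0; have B0 := B_gt0; have AB := A_lt_B.
have BA : 0 < B - A by rewrite subr_gt0.
have [KG KG0 hG] := normc_Gh_zero_le.
pose k' := (B - A) / B * (B / 2)^-1 / kap.
have k'0 : 0 < k' by rewrite !divr_gt0// invr_gt0.
have Y0 := y0; pose c := - Im w / Im x0; have c0 : 0 < c by rewrite divr_gt0// oppr_gt0.
pose R0 := 1 + 2 * normc x0; have R00 : 0 < R0 by rewrite ltr_wpDr// mulr_ge0 ?normc_ge0.
pose T := KG * k' ^+ 2 + normc w + c * (1 + normc x0).
exists (4 * T).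
have m0 : 0 < Num.min (B / 2) (k' * R0)^-1 by rewrite lt_min invr_gt0; apply/andP; split; [rewrite divr_gt0|exact: mulr_gt0].
apply: filterS2 hG (near_normc 0 m0) => y hGy; rewrite subr0 lt_min => /andP[yB yk] iy.
have Dy : Dom y by left; apply/eqP; rewrite lt_eqF.
have n0 := slit_normc (slit_neg iy).
have nB := normc_B_ge yB.
have pk0 : 0 < normc (pk y) by rewrite normc_gt0 pk_neq0.
have pkk : normc (pk y) <= k' * normc y.
  have e := congr1 (@normc R) (pk_mul Dy).
  rewrite mob_kap ?Dom_neqB// normcM normcM normc_real in e.
  have ip : Im (pp y) < 0.
    by case: (Im_pp_sign Dy) => [|h]; [rewrite nmulr_rgt0|move: iy; rewrite h ltxx].
  have kp : kap <= normc (pp y - 'i * kap%:C).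
    have := Im_ge_normc (pp y - 'i * kap%:C); rewrite !ReImE; lra.
  have k1 : normc (pk y) * kap <= normc (pk y) * normc (pp y - 'i * kap%:C).
    by apply: ler_wpM2l => //; exact: ltW.
  have k2 : normc (y / (B%:C - y)) <= normc y * (B / 2)^-1.
    rewrite normcM normcV; apply: ler_wpM2l; first exact: ltW.
    by rewrite lef_pV2 ?posrE ?(ltW nB)// ?divr_gt0// (lt_trans _ nB)// divr_gt0.
  rewrite /k' mulrAC ler_pdivlMr//; apply: le_trans k1 _; rewrite e gtr0_norm ?divr_gt0//.
  rewrite -[leRHS]mulrA; apply: ler_wpM2l; first by rewrite divr_ge0 ?ltW.
  by rewrite [leRHS]mulrC.
set X := xi y.
have X0 : 0 < normc X by rewrite normc_xi invr_gt0.
have Xy : 1 <= k' * (normc y * normc X).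
  by rewrite normc_xi mulrA ler_pdivlMr// mul1r.
have XR : R0 <= normc X.
  have kR : 0 < k' * R0 := mulr_gt0 k'0 R00.
  have h : normc y * (k' * R0) <= 1.
    by have := ltW yk; rewrite -[(k' * R0)^-1]mul1r ler_pdivlMr.
  have : R0 * (k' * normc y) <= normc X * (k' * normc y).
    by apply: (@le_trans _ _ 1); lra.
  by rewrite ler_pM2r// mulr_gt0.
have x0n := normc_ge0 x0.
have X1 : 1 <= normc X by rewrite (le_trans _ XR)// lerDl mulr_ge0.
have X2 : normc x0 <= normc X / 2 by move: XR; rewrite /R0; lra.
have XX : normc X <= normc X ^+ 2 by rewrite expr2 ler_peMl// ltW.
have gX : normc (Gh y) <= KG * k' ^+ 2 * normc X ^+ 2.
  have h : 1 <= k' ^+ 2 * (normc y * normc X) ^+ 2.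
    by rewrite -exprMn exprn_ege1.
  have h2 := ler_wpM2l (normc_ge0 (Gh y)) h; rewrite mulr1 in h2.
  apply: le_trans h2 _.
  have -> : normc (Gh y) * (k' ^+ 2 * (normc y * normc X) ^+ 2) =
    (normc (Gh y) * normc y ^+ 2) * (k' ^+ 2 * normc X ^+ 2) by ring.
  rewrite -[leRHS]mulrA; apply: ler_wpM2r; last exact: hGy.
  by rewrite mulr_ge0 ?sqr_ge0.
set n := Gh y - w + c%:C * (X - x0).
have nn : normc n <= T * normc X ^+ 2.
  apply: le_trans (le_normcD _ _) _; rewrite normcM normc_real gtr0_norm//.
  have h1 := ler_normcB (Gh y) w; have h2 := ler_normcB X x0.
  have h3 : c * normc (X - x0) <= c * ((1 + normc x0) * normc X ^+ 2).
    apply: ler_wpM2l; first exact: ltW.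
    apply: le_trans h2 _; rewrite mulrDl mul1r lerD// ler_peMr//.
    exact: le_trans XX.
  have h4 : normc w <= normc w * normc X ^+ 2.
    by rewrite ler_peMr ?normc_ge0//; exact: le_trans XX.
  rewrite /T; lra.
set P := (X - x0) * (X - conjc x0).
have PX : (normc X / 2) ^+ 2 <= normc P.
  have h1 := ler_distc X x0; have h2 := ler_distc X (conjc x0); rewrite normc_conj in h2.
  by rewrite /P (normcM (X - x0)) expr2; apply: ler_pM; rewrite ?divr_ge0 ?(ltW X0)//; lra.
have P0 : 0 < normc P by apply: lt_le_trans PX; rewrite exprn_gt0// divr_gt0.
apply: le_trans (Im_ge_normc _); rewrite lerN2 -/c -/n -/P normcM normcV ler_pdivrMr//.
apply: le_trans nn _; have T0 : 0 <= T.
  have t1 : 0 <= KG * k' ^+ 2 := mulr_ge0 (ltW KG0) (sqr_ge0 _).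
  have t2 : 0 <= c * (1 + normc x0) by apply: mulr_ge0; [exact: ltW|lra].
  by have := normc_ge0 w; rewrite /T; lra.
have -> : T * normc X ^+ 2 = 4 * T * (normc X / 2) ^+ 2 by field.
by apply: ler_wpM2l => //; rewrite mulr_ge0.
Qed.

Lemma V_zero : exists M : R, \forall y \near ((0 : C) : C^o), Dom y -> - M <= V y.
Proof.
have [M1 h1] := V_zero_down; have [KG hG] := normc_Gh_zero_up.
have [d d0 hd] := Vf_small KG y0 hw ltr01.
exists (Num.max M1 1).
apply: filterS3 (filterI h1 (Im_Gh_zero d0)) (filterI hG (Im_xi_zero_up d0)) (near_normc 0 A_gt0).
move=> y [k1 k2] [k3 k4]; rewrite subr0 => yA Dy.
case: (Dy) => [/eqP|/andP[Ay _]]; last by have := Re_le_normc y; lra.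
rewrite neq_lt => /orP[iy|iy].
  by apply: le_trans (k1 iy); rewrite lerN2 le_max lexx.
apply: (@le_trans _ _ (- 1)); first by rewrite lerN2 le_max lexx orbT.
apply: ltW; apply: hd; [exact: Im_xi_gt0|exact: k4|exact: k3|exact: k2].
Qed.

Lemma xiJ_ge z : Dom z -> Im x0 <= normc (xi z - conjc x0).
Proof.
move=> Dz; have t0 := Im_xi_gt0 Dz.
by apply: le_trans (Im_le_normc _); rewrite ImD ImN ImJ; lra.
Qed.

Lemma xiJ_neq0 z : Dom z -> xi z - conjc x0 != 0.
Proof. by move=> Dz; rewrite -normc_gt0 (lt_le_trans y0)// xiJ_ge. Qed.

Lemma xi_neq z : Dom z -> z <> z0 -> xi z - x0 != 0.
Proof.
move=> Dz zz; rewrite subr_eq0; apply/eqP => h; apply: zz.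
by rewrite -(xiK Dz) h xiK.
Qed.

Hypothesis hGw : Gh z0 = w.

Lemma V_pole : exists M : R, \forall y \near (z0 : C^o), Dom y -> y <> z0 -> - M <= V y.
Proof.
have [L L0 hL] := xi_lip Dz0.
have [c1 hc1] := smooth_at_cder (smooth_Gh Dz0).
have Y0 := y0; pose c := - Im w / Im x0; have c0 : 0 < c by rewrite divr_gt0// oppr_gt0.
exists (((1 + normc c1) * L + c) / Im x0).
apply: filterS2 hL ((cder_eps _ _ _).1 hc1 1 ltr01) => y k1 k2 Dy yz.
have k3 := k1 Dy; rewrite hGw mul1r in k2.
have X0 : 0 < normc (xi y - x0) by rewrite normc_gt0 xi_neq.
have J0 := xiJ_ge Dy; have J1 : 0 < normc (xi y - conjc x0) := lt_le_trans y0 J0.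
apply: le_trans (Im_ge_normc _); rewrite lerN2 normcM normcV normcM.
have h1 : normc (Gh y - w) <= (1 + normc c1) * (L * normc (xi y - x0)).
  apply: (@le_trans _ _ ((1 + normc c1) * normc (y - z0))); last first.
    by apply: ler_wpM2l => //; rewrite addr_ge0 ?normc_ge0.
  have := ler_distc (Gh y - w) (c1 * (y - z0)); rewrite normcM; lra.
have h2 : normc (Gh y - w + c%:C * (xi y - x0)) <= ((1 + normc c1) * L + c) * normc (xi y - x0).
  apply: le_trans (le_normcD _ _) _; rewrite normcM normc_real gtr0_norm//.
  by rewrite [leRHS]mulrDl lerD// -mulrA.
rewrite ler_pdivrMr ?mulr_gt0//; apply: le_trans h2 _.
rewrite mulrAC ler_pdivlMr//.
have S0 : 0 <= ((1 + normc c1) * L + c) * normc (xi y - x0).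
  by rewrite mulr_ge0 ?normc_ge0// addr_ge0 ?(ltW c0)// mulr_ge0 ?(ltW L0)// addr_ge0 ?normc_ge0.
by have := ler_wpM2l S0 J0; rewrite !mulrA.
Qed.

Definition hq z := (xi z - x0) / (xi z - conjc x0).
(** A positive harmonic function that is infinite at the origin, at the ends of
    the support and at [z0]. *)
Definition barrier z := Re (cpow z (- 4^-1)) + Re (cpow (z - A%:C) (- 4^-1)) +
  Re (cpow (B%:C - z) (- 4^-1)) - ln (normc (hq z)).

Lemma cpow4_ge z : slit z -> normc z `^ (- 4^-1) / 2 <= Re (cpow z (- 4^-1)).
Proof.
move=> zs; rewrite Re_cpow//; apply: ler_wpM2l; first exact: powR_ge0.
by have /andP[h1 h2] := Arg_bounds z; apply: cos_ge_half; apply/andP; lra.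
Qed.

Lemma cpow4_ge0 z : slit z -> 0 <= Re (cpow z (- 4^-1)).
Proof. by move=> zs; apply: le_trans (cpow4_ge zs); rewrite divr_ge0 ?powR_ge0. Qed.

Lemma cpow4_infty (M : R) : exists2 d : R, 0 < d &
  forall z, slit z -> normc z < d -> M < Re (cpow z (- 4^-1)).
Proof.
pose S := 2 * `|M| + 1; have S0 : 0 < S by rewrite ltr_wpDl// mulr_ge0.
exists (S `^ (- 4)); first exact: powR_gt0.
move=> z zs zd; apply: lt_le_trans (cpow4_ge zs).
have : S < normc z `^ (- 4^-1).
  have -> : S = (S `^ (- 4)) `^ (- 4^-1).
    by rewrite -powRrM mulrNN divff// powRr1// ltW.
  by rewrite ltr_powRN ?slit_normc//; lra.
have := ler_norm M; rewrite /S; lra.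
Qed.

Lemma normc_hq_le1 z : Dom z -> normc (hq z) <= 1.
Proof.
move=> Dz; have J0 := xiJ_ge Dz; have J1 : 0 < normc (xi z - conjc x0) := lt_le_trans y0 J0.
rewrite normcM normcV ler_pdivrMr// mul1r -ler_sqr ?nnegrE ?normc_ge0//.
rewrite !sqr_normcE !(ReD, ImD, ReN, ImN, ReJ, ImJ).
have : 0 <= Im (xi z) * Im x0 by rewrite mulr_ge0 ?(ltW y0) ?(ltW (Im_xi_gt0 Dz)).
rewrite !expr2; lra.
Qed.

Lemma barrier_ge z : Dom z ->
  [/\ Re (cpow z (- 4^-1)) <= barrier z, Re (cpow (z - A%:C) (- 4^-1)) <= barrier z,
      Re (cpow (B%:C - z) (- 4^-1)) <= barrier z & - ln (normc (hq z)) <= barrier z].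
Proof.
move=> Dz; have l0 : ln (normc (hq z)) <= 0 by apply: ln_le0; exact: normc_hq_le1.
have := cpow4_ge0 (Dom_slit Dz); have := cpow4_ge0 (Dom_slitA Dz).
have := cpow4_ge0 (Dom_slitB Dz); rewrite /barrier => h1 h2 h3.
by split; lra.
Qed.

Lemma barrier_infty e (M : R) : e = 0 \/ e = A%:C \/ e = B%:C \/ e = z0 ->
  \forall y \near (e : C^o), Dom y -> y <> z0 -> M < barrier y.
Proof.
have [d d0 hd] := cpow4_infty M.
case=> [->|[->|[->|->]]].
- apply: filterS (near_normc 0 d0) => y; rewrite subr0 => yd Dy _.
  have [h _ _ _] := barrier_ge Dy; apply: lt_le_trans h.
  by apply: hd => //; exact: Dom_slit.
- apply: filterS (near_normc A%:C d0) => y yd Dy _.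
  have [_ h _ _] := barrier_ge Dy; apply: lt_le_trans h.
  by apply: hd => //; exact: Dom_slitA.
- apply: filterS (near_normc B%:C d0) => y yd Dy _.
  have [_ _ h _] := barrier_ge Dy; apply: lt_le_trans h.
  by apply: hd; [exact: Dom_slitB|rewrite normcB].
have e0 : 0 < expR (- M) * Im x0 := mulr_gt0 (expR_gt0 _) y0.
have /climP /(_ _ e0) := Cn_ccont (Cn_xi 0 Dz0).
apply: filterS => y yd Dy yz; have [_ _ _ h] := barrier_ge Dy; apply: lt_le_trans h.
have J0 := xiJ_ge Dy; have J1 : 0 < normc (xi y - conjc x0) := lt_le_trans y0 J0.
have h0 : 0 < normc (hq y) by rewrite normc_gt0 mulf_neq0 ?invr_neq0 ?xi_neq ?xiJ_neq0.
rewrite ltrNr -[- M]expRK ltr_ln ?posrE ?expR_gt0//.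
rewrite normcM normcV ltr_pdivrMr//; apply: lt_le_trans yd _.
by apply: ler_wpM2l => //; exact: expR_ge0.
Qed.

(** The logarithm of the modulus of [hq] is locally the real part of a branch of
    the logarithm, normalised at [z] to avoid the cut. *)
Lemma harmonic_V_barrier (eps : R) z : Dom z -> z <> z0 ->
  harmonic_at (fun y => V y + eps * barrier y) z.
Proof.
move=> Dz zz; pose c := - Im w / Im x0.
have q0 : hq z != 0 by rewrite mulf_neq0 ?invr_neq0 ?xi_neq ?xiJ_neq0.
have Cxi := Cn_xi 2 Dz; have Cc u : Cn 2 (fun=> u) z := Cn_cst 2 u z.
have Chq : Cn 2 hq z.
  by apply: CnM; [exact: CnB|apply: CnV; [exact: xiJ_neq0|exact: CnB]].
have s1 : slit (hq z / hq z) by rewrite divff//; apply/slitP; right; rewrite Re1.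
have Ck : Cn 2 (fun y => hq y / hq z) z by exact: CnM.
pose f1 y := (Gh y - w + c%:C * (xi y - x0)) / ((xi y - x0) * (xi y - conjc x0)).
pose f2 y := cpow y (- 4^-1) + cpow (y - A%:C) (- 4^-1) + cpow (B%:C - y) (- 4^-1) -
   (Log (hq y / hq z) + (ln (normc (hq z)))%:C).
exists (fun y => - 'i * f1 y + eps%:C * f2 y); split.
  have ns : \forall y \near (z : C^o), slit (hq y / hq z).
    exact: (climE (Cn_ccont Ck)) (slit_near s1).
  apply: filterS ns => y sy.
  have y0' : 0 < normc (hq y / hq z) := slit_normc sy.
  have z0' : 0 < normc (hq z) by rewrite normc_gt0.
  have yq : 0 < normc (hq y).
    by move: y0'; rewrite normcM normcV pmulr_lgt0// invr_gt0.
  have lq : ln (normc (hq y)) = Re (Log (hq y / hq z)) + ln (normc (hq z)).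
    rewrite -[Re _]/(ln (normc (hq y / hq z))) (normcM (hq y)) normcV.
    by rewrite ln_div ?posrE// subrK.
  rewrite ReD ReC_mul /barrier lq /f2 !(ReD, ReN) ReC /f1.
  have -> : Re (- 'i * ((Gh y - w + c%:C * (xi y - x0)) / ((xi y - x0) * (xi y - conjc x0)))) =
    V y by rewrite /Vf -/c ReM ReN ImN Rei Imi; ring.
  by [].
have Cf2 : Cn 2 f2 z.
  have cA : Cn 2 (fun y => y - A%:C) z by apply: CnB; [exact: Cn_id|].
  have cB : Cn 2 (fun y => B%:C - y) z by apply: CnB; [|exact: Cn_id].
  apply: CnB.
    apply: CnD; last by apply: (@Cn_comp R 2 (fun u => cpow u _) (fun y => B%:C - y) z cB); exact: Cn_cpow (Dom_slitB Dz).
    apply: CnD; first exact: Cn_cpow (Dom_slit Dz).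
    by apply: (@Cn_comp R 2 (fun u => cpow u _) (fun y => y - A%:C) z cA); exact: Cn_cpow (Dom_slitA Dz).
  by apply: CnD => //; apply: (@Cn_comp R 2 (@Log R) (fun y => hq y / hq z) z Ck); exact: Cn_Log s1.
apply: smooth_atD; last by apply: smooth_at_Cn; exact: CnM.
apply: smooth_atM; first exact: smooth_at_Cn.
apply: smooth_atM.
  apply: smooth_atD; first by apply: smooth_atD; [exact: smooth_Gh|exact: smooth_at_Cn].
  by apply: smooth_at_Cn; apply: CnM => //; exact: CnB.
apply: smooth_atV; first by rewrite mulf_neq0 ?xi_neq ?xiJ_neq0.
by apply: smooth_at_Cn; apply: CnM; exact: CnB.
Qed.

(** On the boundary [(xi - x0) * (xi - conjc x0)] is positive and the
    imaginary part of the numerator of [V] is that of [Gh]. *)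
Lemma V_ge0 z : Dom z -> z <> z0 -> 0 <= V z.
Proof.
move=> Dz zz.
have key (eps : R) : 0 < eps -> 0 <= V z + eps * barrier z.
  move=> eps0; pose U y := Dom y /\ y <> z0.
  have bar0 y : U y -> 0 <= eps * barrier y.
    move=> [Dy _]; rewrite mulr_ge0 ?(ltW eps0)//.
    have [h _ _ _] := barrier_ge Dy; apply: le_trans h; exact: cpow4_ge0 (Dom_slit Dy).
  have blow e (M eta : R) : e = 0 \/ e = A%:C \/ e = B%:C \/ e = z0 -> 0 < eta ->
      (\forall y \near (e : C^o), Dom y -> y <> z0 -> - M <= V y) ->
      \forall y \near (e : C^o), U y -> - eta < V y + eps * barrier y.
    move=> he eta0 hM.
    apply: filterS2 hM (barrier_infty (M / eps) he) => y h1 h2 [Dy yz].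
    have := h1 Dy yz; have := h2 Dy yz; rewrite ltr_pdivrMr// mulrC; lra.
  apply: (@max_principle R U (fun y => V y + eps * barrier y)) => //.
  - move=> y [Dy yz]; have n0 : 0 < normc (y - z0) by rewrite normc_gt0 subr_eq0; exact/eqP.
    apply: filterS2 (Dom_open Dy) (near_normc y n0) => t Dt ty; split => // tz.
    by move: ty; rewrite tz normcB ltxx.
  - by move=> y [Dy yz]; exact: harmonic_V_barrier.
  - move=> e Ue eta eta0; have [De|De] := pselect (Dom e).
      have -> : e = z0 by apply: contrapT => h; exact: Ue.
      by have [M hM] := V_pole; apply: (blow _ M) => //; right; right; right.
    have [ie re] := not_Dom De; have eE := real_complex ie.
    have A0 : A != 0 by rewrite gt_eqF// A_gt0.
    have B0 : B != 0 by rewrite gt_eqF// B_gt0.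
    have [e0|e0] := eqVneq (Re e) 0.
      have -> : e = 0 by rewrite eE e0.
      have [M hM] := V_zero; apply: (blow _ M) => //; first by left.
      by apply: filterS hM => y h Dy _; exact: h.
    have [eA|eA] := eqVneq (Re e) A.
      rewrite eE eA; have A1 : ~~ (A < A < B) by rewrite ltxx.
      have [M hM] := V_endpoint A0 A1 normc_Gh_A Im_xi_A.
      apply: (blow _ M) => //; first by right; left.
      by apply: filterS hM => y h Dy _; exact: h.
    have [eB|eB] := eqVneq (Re e) B.
      rewrite eE eB; have B1 : ~~ (A < B < B) by rewrite ltxx andbF.
      have [M hM] := V_endpoint B0 B1 normc_Gh_B Im_xi_B.
      apply: (blow _ M) => //; first by right; right; left.
      by apply: filterS hM => y h Dy _; exact: h.
    have re' : ~~ (A <= Re e <= B).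
      apply: contra re => /andP[h1 h2]; rewrite !lt_neqAle h1 h2 eB eq_sym.
      by rewrite eA.
    rewrite eE; apply: filterS (V_regular re' e0 eta0) => y h [Dy yz].
    by have := h Dy; have := bar0 y (conj Dy yz); lra.
  - move=> eta eta0; have [M hM] := V_infty eta0; exists M => y Uy yM.
    by have := hM y Uy.1 yM; have := bar0 y Uy; lra.
rewrite leNgt; apply/negP => V0.
have b0 : 0 <= barrier z.
  have [h _ _ _] := barrier_ge Dz; apply: le_trans h; exact: cpow4_ge0 (Dom_slit Dz).
have b1 : 0 < barrier z + 1 by lra.
have e0 : 0 < - V z / (2 * (barrier z + 1)) by rewrite divr_gt0 ?oppr_gt0 ?mulr_gt0.
have := key _ e0; set v := V z in V0 *.
have : - v / (2 * (barrier z + 1)) * barrier z <= - v / 2.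
  rewrite mulrAC ler_pdivrMr ?mulr_gt0//.
  have -> : - v / 2 * (2 * (barrier z + 1)) = - v * barrier z - v by field.
  lra.
lra.
Qed.

(** At another solution [V] would reduce to the imaginary part of a positive multiple of
    the inverse of [xi z - conjc x0], which is negative. *)
Lemma Gh_uniq z : Dom z -> Gh z = w -> z = z0.
Proof.
move=> Dz hz; apply: contrapT => zz; have := V_ge0 Dz zz.
have n0 := xi_neq Dz zz; have nJ := xiJ_neq0 Dz.
rewrite /Vf hz subrr add0r.
have -> : (- Im w / Im x0)%:C * (xi z - x0) / ((xi z - x0) * (xi z - conjc x0)) =
  (- Im w / Im x0)%:C * (xi z - conjc x0)^-1.
  by rewrite invfM mulrA mulfK.
rewrite ImC_mul ImVn; apply/negP; rewrite -ltNge pmulr_rlt0 ?divr_gt0 ?oppr_gt0 ?y0//.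
rewrite pmulr_llt0 ?invr_gt0 ?exprn_gt0 ?normc_gt0// ImD ImN ImJ.
have := Im_xi_gt0 Dz; have := y0; lra.
Qed.

(** If the derivative vanished, [V] would tend to the same negative value
    at [z0]. *)
Lemma Gh_cder_neq0 c1 : cder Gh z0 c1 -> c1 != 0.
Proof.
move=> hc; apply/eqP => c10; rewrite {}c10 in hc.
have [L L0 hL] := xi_lip Dz0.
have Y0 := y0; pose c := - Im w / Im x0; have c0 : 0 < c by rewrite divr_gt0// oppr_gt0.
(* a bound on the imaginary part of [c / (xi - conjc x0)] near [z0] *)
have Ccst : ccont (fun y => c%:C * (xi y - conjc x0)^-1) z0.
  apply: ccontM; first exact: ccont_cst.
  apply: ccontV; first exact: xiJ_neq0.
  by apply: ccontB; [exact: Cn_ccont (Cn_xi 0 Dz0)|exact: ccont_cst].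
have l0 : Im (c%:C * (x0 - conjc x0)^-1) = - (c / (2 * Im x0)).
  rewrite ImC_mul ImV ReD ReN ReJ ImD ImN ImJ subrr expr0n/= add0r opprK.
  by move: Y0; move: (Im x0) => Y Y0; field; rewrite !gt_eqF ?addr_gt0.
pose K := c / (2 * Im x0); rewrite -/K in l0.
have K0 : 0 < K by apply: divr_gt0 => //; apply: mulr_gt0.
have m0 : 0 < K / 2 by apply: divr_gt0.
have e0 : 0 < K / 4 * Im x0 / L.
  by apply: divr_gt0 => //; apply: mulr_gt0 => //; apply: divr_gt0.
have /climP /(_ _ m0) n1 := Ccst.
have [d d0 hd] := (nbhsC _ _).1 (filterI (filterI n1 hL)
   (filterI (Dom_open Dz0) ((cder_eps _ _ _).1 hc _ e0))).
pose y := z0 + (d / 2)%:C.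
have yz : normc (y - z0) = d / 2 by rewrite addrC addKr normc_real ger0_norm// divr_ge0// ltW.
have yd : normc (y - z0) < d by rewrite yz; lra.
have [[k1 k2] [Dy k4]] := hd y yd; have {}k2 := k2 Dy.
have yz0 : y <> z0.
  by move=> h; move: yz; rewrite h subrr normc0; lra.
have X0 : 0 < normc (xi y - x0) by rewrite normc_gt0 xi_neq.
have J0 := xiJ_ge Dy; have J1 : 0 < normc (xi y - conjc x0) := lt_le_trans y0 J0.
have := V_ge0 Dy yz0; rewrite /Vf -/c mulrDl.
have -> : c%:C * (xi y - x0) / ((xi y - x0) * (xi y - conjc x0)) =
  c%:C * (xi y - conjc x0)^-1.
  by rewrite invfM mulrA mulfK// xi_neq.
rewrite ImD; apply/negP; rewrite -ltNge.
have h1 : Im (c%:C * (xi y - conjc x0)^-1) < - (K / 2).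
  have := Im_le_normc (c%:C * (xi y - conjc x0)^-1 - c%:C * (x0 - conjc x0)^-1).
  rewrite ImD ImN l0; lra.
have h2 : Im ((Gh y - w) / ((xi y - x0) * (xi y - conjc x0))) <= K / 4.
  apply: le_trans (Im_le_normc _) _; rewrite normcM normcV normcM ler_pdivrMr ?mulr_gt0//.
  rewrite mul0r subr0 hGw in k4; apply: le_trans k4 _.
  apply: (@le_trans _ _ (K / 4 * Im x0 / L * (L * normc (xi y - x0)))).
    by apply: ler_wpM2l => //; exact: ltW.
  rewrite mulrA divfK ?gt_eqF// -[leLHS]mulrA; apply: ler_wpM2l.
    by apply: divr_ge0 => //; exact: ltW.
  by rewrite mulrC; apply: ler_wpM2l => //; exact: ltW.
lra.
Qed.

End Barrier.

(** * The inverse function *)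

Definition Ginv w : C := xget 0 [set z | Dom z /\ Gh z = w].

Lemma GinvP w : Im w < 0 -> Dom (Ginv w) /\ Gh (Ginv w) = w.
Proof.
move=> iw; rewrite /Ginv; case: xgetP => [z _ []//|h].
by have [z Dz zw] := Gh_surj iw; case: (h z).
Qed.

Lemma Ginv_eq w z : Im w < 0 -> Dom z -> Gh z = w -> Ginv w = z.
Proof.
by move=> iw Dz zw; have [DF Fw] := GinvP iw; exact: (Gh_uniq Dz iw zw DF Fw).
Qed.

(** As the derivative of [Gh] at the solution is nonzero, [Gh - w] is bounded below on
    small circles around it, and the discs contain the solutions for all the values
    near [w]. *)
Lemma ccont_Ginv w : Im w < 0 -> ccont Ginv w.
Proof.
move=> iw; have [DF Fw] := GinvP iw; set z0 := Ginv w in DF Fw *.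
have [c hc] := smooth_at_cder (smooth_Gh DF).
have c0 : 0 < normc c by rewrite normc_gt0; exact: Gh_cder_neq0 DF iw Fw c hc.
have c2 : 0 < normc c / 2 by rewrite divr_gt0.
apply/climP => e e0.
have [d d0 hd] := (nbhsC _ _).1 (filterI (Dom_open DF) ((cder_eps _ _ _).1 hc _ c2)).
pose rho := Num.min (d / 2) (e / 2).
have rho0 : 0 < rho by rewrite lt_min !divr_gt0.
have rd : rho < d by rewrite gt_min; apply/orP; left; lra.
have re : rho < e by rewrite gt_min; apply/orP; right; lra.
pose m := normc c / 4 * rho.
have m0 : 0 < m by apply: mulr_gt0 => //; apply: divr_gt0.
apply: filterS2 (near_normc w m0) (near_Im_lt0 iw) => w' ww iw'.
have [z zr zw] : exists2 z, normc (z - z0) < rho & Gh z = w'.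
  apply: (@attained_in_ball _ Gh z0 rho m) => //.
  - by move=> z zr; apply: smooth_Gh; have [] := hd z (le_lt_trans zr rd).
  - move=> z zr; have zd : normc (z - z0) < d by rewrite zr.
    have [_] := hd z zd; rewrite Fw zr => h1.
    have := ler_distc (c * (z - z0)) (Gh z - w).
    rewrite (normcB (c * _)) normcM zr => h2.
    have h3 := normc_tri (Gh z) w' w; rewrite (normcB _ w) in ww *.
    move: h3 ww; rewrite (normcB w w') /m; lra.
  - by rewrite Fw normcB.
have Dz : Dom z by have [] := hd z (lt_trans zr rd).
by rewrite (Ginv_eq iw' Dz zw); exact: lt_trans zr re.
Qed.

Lemma cder_Ginv w : Im w < 0 -> exists c, cder Ginv w c.
Proof.
move=> iw; have [DF Fw] := GinvP iw.
have [c hc] := smooth_at_cder (smooth_Gh DF).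
have c0 : c != 0 := Gh_cder_neq0 DF iw Fw hc.
exists c^-1; apply: cder_inverse (ccont_Ginv iw) hc c0 _.
by apply: filterS (near_Im_lt0 iw) => y iy; have [] := GinvP iy.
Qed.

Lemma univalent_Ginv : univalent_on (@lower_half_plane R) Ginv.
Proof.
split=> [w iw|w w' /set_mem iw /set_mem iw' e].
  by have [c] := cder_Ginv iw; exact: cder_derivable.
by have [_ <-] := GinvP iw; have [_ <-] := GinvP iw'; rewrite e.
Qed.

Lemma G_inj z z' : 0 < Im z -> 0 < Im z' -> G z = G z' -> z = z'.
Proof.
move=> iz iz' e; have iG := Im_G_lt0 iz'.
have Dz : Dom z by left; apply/eqP; rewrite gt_eqF.
have Dz' : Dom z' by left; apply/eqP; rewrite gt_eqF.
by apply: (Gh_uniq Dz' iG) => //; rewrite Gh_up.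
Qed.

(** * The Cauchy transform at infinity *)

Definition Cinf := 2 * Gconst * B.

Lemma Cinf_ge0 : 0 <= Cinf.
Proof. by rewrite mulr_ge0 ?(ltW B_gt0)// mulr_ge0 ?Gconst_ge0. Qed.

Lemma cint_dens : cint a b (fun x => (dens x)%:C) = 1.
Proof.
apply: complexP => /=; first exact: Rintegral_dens.
rewrite -[RHS](mul0r (\int[lebesgue_measure]_(x in D) 0)) -RintegralZl//; last first.
  by apply: (@bounded_integrable _ _ _ hab _ 0) => // t _; rewrite normr0.
by apply: eq_Rintegral => x _; rewrite mul0r.
Qed.

(** The total mass being 1, the error is the integral of [phi x] divided by
    [z * (z - phi x)]. *)
Lemma G_infty z : 0 < Im z -> 2 * B <= normc z -> normc (G z - z^-1) <= Cinf / normc z ^+ 2.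
Proof.
move=> iz zB; have B0 := B_gt0; have z0 : 0 < normc z by lra.
have i0 : 0 < `|Im z| by rewrite normr_gt0 gt_eqF.
have zn : z != 0 by rewrite -normc_gt0.
have z2 : 0 < normc z / 2 by rewrite divr_gt0.
have aw : away z (normc z / 2) by move=> x hx; have := @away_infty z x hx; lra.
have bk := bm_densK z2 aw; have bd := bm_dens.
have -> : G z - z^-1 = cint a b (fun x => (dens x)%:C * kern z x - z^-1 * (dens x)%:C).
  rewrite cintB// ?cintZ// ?cint_dens ?mulr1//.
  exact: bmM (bm_cst _ _ _) bd.
have -> : Cinf / normc z ^+ 2 =
    2 * (b - a) * (gbound * wt a * (B * (normc z / 2)^-1 * (normc z)^-1)).
  by rewrite /Cinf /Gconst; move: (wt a) => wa; field; rewrite gt_eqF.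
apply: normc_cint_cst => //.
  by apply: bmB => //; exact: bmM (bm_cst _ _ _) bd.
move=> x; rewrite inD => hx; have k0 := away_neq0 z2 aw hx.
have -> : (dens x)%:C * kern z x - z^-1 * (dens x)%:C =
   (dens x)%:C * ((phi x)%:C * kern z x * z^-1).
  by rewrite /kern; field; rewrite k0 zn.
rewrite normcM normc_real ger0_norm ?dens_ge0//.
apply: ler_pM; rewrite ?dens_ge0 ?normc_ge0 ?dens_le//.
rewrite normcM normcV; apply: ler_wpM2r; first by rewrite invr_ge0 normc_ge0.
rewrite normcM normc_real ger0_norm ?powR_ge0//.
apply: ler_pM; rewrite ?powR_ge0 ?normc_ge0 ?phi_le//.
exact: normc_kern z2 aw hx.
Qed.

Definition delta0 := Num.min (4^-1) (Num.min (4 * B)^-1 (20 * (Cinf + 1))^-1).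

Lemma delta0_gt0 : 0 < delta0.
Proof.
have := Cinf_ge0; have := B_gt0 => B0 C0.
by rewrite !lt_min !invr_gt0 !mulr_gt0//; lra.
Qed.

(** Near infinity [G] is close to the inverse function, so that it takes the
    value [w] close to [w^-1]. *)
Lemma Lambda_covered w : Im w < 0 -> 2 * `|Re w| < - Im w -> - (delta0 / 2) < Im w ->
  exists2 z, [/\ 0 < Im z, 2^-1 * `|Re z| < Im z & 1 < Im z] & G z = w.
Proof.
move=> iw rw dw; have C0 := Cinf_ge0; have B0 := B_gt0.
pose s := - Im w; have s0 : 0 < s by rewrite oppr_gt0.
pose n := normc w; have n0 : 0 < n.
  by rewrite normc_gt0; apply: contraTneq iw => ->; rewrite ltxx.
have ns : n < 3 / 2 * s.
  have := normc_leD w; rewrite (ltr0_norm iw) -/n -/s; move: rw; rewrite -/s; lra.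
have sn : s <= n by have := Im_ge_normc w; rewrite -/n /s; lra.
have nd : n < delta0 by move: dw ns; rewrite /s; lra.
have [d1 d2 d3] : [/\ n < 4^-1, n * (4 * B) < 1 & n * (20 * (Cinf + 1)) < 1].
  move: nd; rewrite !lt_min => /and3P[k1 k2 k3]; split => //.
    by rewrite -ltr_pdivlMr ?mulr_gt0// mul1r.
  by rewrite -ltr_pdivlMr ?mul1r// mulr_gt0//; lra.
have wn : w != 0 by rewrite -normc_gt0.
pose rho := (4 * n)^-1; have rho0 : 0 < rho by rewrite invr_gt0 mulr_gt0.
have ni : 0 < n^-1 by rewrite invr_gt0.
have rhoE : rho = n^-1 / 4 by rewrite /rho invfM mulrC.
have zE z : normc (z - w^-1) <= rho -> [/\ 3 / 4 * n^-1 <= normc z, normc z <= 5 / 4 * n^-1,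
    5 / 12 * n^-1 <= Im z & `|Re z| <= 3 / 4 * n^-1].
  move=> zr; have := ler_distc w^-1 z; have := ler_distc z w^-1.
  rewrite (normcB w^-1) normcV -/n rhoE in zr * => h1 h2.
  have h3 := normc_Re (z - w^-1); have h4 := Im_ge_normc (z - w^-1).
  have iE : Im w^-1 = s * n^-1 * n^-1 by rewrite ImVn -/n /s; field; rewrite gt_eqF.
  have rE : Re w^-1 = Re w * n^-1 * n^-1 by rewrite ReVn -/n; field; rewrite gt_eqF.
  have i1 : 2 / 3 * n^-1 <= Im w^-1.
    rewrite iE; apply: ler_wpM2r; first exact: ltW.
    by rewrite ler_pdivlMr//; lra.
  have r1 : `|Re w^-1| <= 2^-1 * n^-1.
    rewrite rE !normrM (gtr0_norm ni); apply: ler_wpM2r; first exact: ltW.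
    by rewrite ler_pdivrMr//; move: rw; rewrite -/s; lra.
  move: h3 h4; rewrite ReD ReN ImD ImN => h3 h4; split; [lra|lra|lra|].
  have := ler_normD (Re z - Re w^-1) (Re w^-1); rewrite subrK; lra.
have zB z : normc (z - w^-1) <= rho -> 2 * B <= normc z.
  move=> /zE[h _ _ _]; apply: le_trans h; rewrite ler_pdivlMr//; lra.
have zI z : normc (z - w^-1) <= rho -> 0 < Im z.
  by move=> /zE[_ _ h _]; apply: lt_le_trans h; rewrite mulr_gt0.
have GE z : normc (z - w^-1) <= rho -> normc (G z - z^-1) <= 16 / 9 * (Cinf * n ^+ 2).
  move=> zr; apply: le_trans (G_infty (zI z zr) (zB z zr)) _.
  have [h _ _ _] := zE z zr.
  have q0 : 0 < 3 / 4 * n^-1 by rewrite mulr_gt0.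
  have q1 : 0 < normc z := lt_le_trans q0 h.
  have -> : 16 / 9 * (Cinf * n ^+ 2) = Cinf / (3 / 4 * n^-1) ^+ 2.
    by field; rewrite gt_eqF.
  apply: ler_wpM2l => //; rewrite lef_pV2 ?posrE ?exprn_gt0//.
  by rewrite ler_sqr ?nnegrE ?(ltW q0) ?(ltW q1).
have Cn1 : Cinf * n ^+ 2 <= n / 20.
  have : n * (n * (20 * (Cinf + 1))) <= n * 1.
    by apply: ler_wpM2l; exact: ltW.
  have : 0 <= n ^+ 2 by rewrite sqr_ge0.
  rewrite !expr2; lra.
have [z zr zw] : exists2 z, normc (z - w^-1) < rho & G z = w.
  apply: (@attained_in_ball _ G w^-1 rho (n / 10)) => //.
  - move=> z zr; left; apply: (@Cn_G z `|Im z|); last exact: away_Im.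
    by rewrite normr_gt0 gt_eqF// zI.
  - move=> z zr; have zr' : normc (z - w^-1) <= rho by rewrite zr.
    have [h1 h2 h3 _] := zE z zr'.
    have q0 : 0 < normc z by apply: lt_le_trans h1; rewrite mulr_gt0.
    have zn : z != 0 by rewrite -normc_gt0.
    have k1 : normc (z^-1 - w) = rho * n / normc z.
      rewrite -zr -(normcB w^-1) (_ : z^-1 - w = (w^-1 - z) * w / z); last by field; rewrite zn wn.
      by rewrite normcM normcM normcV.
    have k2 : n / 5 <= normc (z^-1 - w).
      rewrite k1 /rho ler_pdivlMr//.
      have -> : (4 * n)^-1 * n = 4^-1 by field; rewrite gt_eqF.
      have : n / 5 * normc z <= n / 5 * (5 / 4 * n^-1).
        by apply: ler_wpM2l => //; rewrite divr_ge0 ?(ltW n0).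
      have -> : n / 5 * (5 / 4 * n^-1) = 4^-1 by field; rewrite gt_eqF.
      by [].
    have := GE z zr'; have := normc_tri z^-1 (G z) w; rewrite (normcB z^-1 (G z)); lra.
  - have zr : normc (w^-1 - w^-1) <= rho by rewrite subrr normc0 ltW.
    by have := GE _ zr; rewrite invrK; lra.
have [_ _ h3 h4] := zE z (ltW zr).
exists z => //.
have n4 : 4 < n^-1 by rewrite -[4]invrK ltf_pV2 ?posrE ?invr_gt0.
by split; lra.
Qed.

(** * The distribution of the power *)

Section Distribution.
Context d (T : measurableType d) (P : probability T R) (X : {RV P >-> R}).
Hypothesis hX : forall E : set R, measurable E ->
  distribution P X E = gpfp a b alpha l E.

Lemma Rintegral_pow_distribution (h : R -> R) (K : R) :
  measurable_fun setT h -> (forall x, `|h x| <= K) ->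
  \int[distribution P (pow_RV X r)]_(x in setT) h x =
  \int[lebesgue_measure]_(x in D) (dens x * h (phi x)).
Proof.
move=> mh hK.
have mphi : measurable_fun setT phi := measurable_powR r.
have mhp : measurable_fun setT (h \o phi) by exact: measurableT_comp.
have mX : measurable_fun setT (X : T -> measurableTypeR R) := @measurable_funPT _ _ _ _ X.
(* The same function, with values in the measurable space that carries the
   Lebesgue measure. *)
pose Y : {mfun T >-> measurableTypeR R} := HB.pack (X : T -> measurableTypeR R)
  (isMeasurableFun.Build _ _ T (measurableTypeR R) (X : T -> measurableTypeR R) mX).
have ih (Z : {mfun T >-> R}) (g : R -> R) : measurable_fun setT g -> (forall x, `|g x| <= K) ->
    P.-integrable setT ((EFin \o g) \o Z).
  move=> mg gK; rewrite (_ : _ \o _ = EFin \o (g \o Z))//.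
  apply: measurable_bounded_integrable => //; first exact: fin_num_fun_lty.
    exact: measurableT_comp.
  exists K; split; first by rewrite num_real.
  by move=> M KM x _; apply: le_trans (gK _) (ltW KM).
transitivity (\int[distribution P Y]_(x in setT) (h \o phi) x).
  congr fine.
  rewrite [LHS](@integral_pushforward _ _ _ _ _ (pow_RV X r) _ P setT (EFin \o h))//; last 2 first.
  - exact/measurable_EFinP.
  - exact: ih.
  rewrite [RHS](@integral_pushforward _ _ _ _ _ Y _ P setT (EFin \o (h \o phi)))//.
  - exact/measurable_EFinP.
  - exact: (ih X _ mhp (fun x => hK (phi x))).
transitivity (\int[lebesgue_measure]_(x in setT) ((h \o phi) x * gpfp_pdf a b alpha l x)).
  apply: (@Rintegral_density _ _ _ (@lebesgue_measure R) (distribution P Y) _ _ K) => //.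
  - exact: gpfp_pdf_ge0.
  - exact: measurable_gpfp_pdf.
  - by move=> x; exact: hK.
rewrite [RHS]Rintegral_mkcond; apply: eq_Rintegral => x _.
rewrite patchE; case: ifPn => [/set_mem|/negP hx].
  by rewrite inD => hx; rewrite gpfp_pdfE// mulrC.
rewrite gpfp_pdf0 ?mulr0//; apply/negP => hx'; apply: hx.
by apply: mem_set; rewrite inD.
Qed.

Lemma normc_resolvent_le z (x : R) : Im z != 0 -> normc ((z - x%:C)^-1) <= `|Im z|^-1.
Proof.
move=> iz; have i0 : 0 < `|Im z| by rewrite normr_gt0.
have h : `|Im z| <= normc (z - x%:C).
  by have := normc_Im (z - x%:C); rewrite !ReImE subr0.
by rewrite normcV lef_pV2 ?posrE// (lt_le_trans i0).
Qed.

Lemma clim_resolvent z (x : R) : Im z != 0 ->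
  clim (nbhs x) (fun t : R => (z - t%:C)^-1) ((z - x%:C)^-1).
Proof.
move=> iz; apply: climV.
  by apply: contraNneq iz => h; have := congr1 Im h; rewrite !ReImE subr0 => ->.
by apply: climB; [exact: clim_cst|apply: clim_real; exact: cvg_id].
Qed.

Lemma cauchy_transformE z : Im z != 0 ->
  cauchy_transform (distribution P (pow_RV X r)) z = G z.
Proof.
move=> iz; rewrite /cauchy_transform /G /cint; congr Complex.
  rewrite (@Rintegral_pow_distribution _ `|Im z|^-1).
  - by apply: eq_Rintegral => x _; rewrite ReC_mul.
  - by apply: continuous_measurable_fun => x; apply: clim_Re; exact: clim_resolvent.
  - by move=> x; apply: le_trans (normc_Re _) (normc_resolvent_le _ iz).
rewrite (@Rintegral_pow_distribution _ `|Im z|^-1).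
- by apply: eq_Rintegral => x _; rewrite ImC_mul.
- by apply: continuous_measurable_fun => x; apply: clim_Im; exact: clim_resolvent.
- by move=> x; apply: le_trans (normc_Im _) (normc_resolvent_le _ iz).
Qed.

Lemma pow_distribution_UI : class_UI (distribution P (pow_RV X r)).
Proof.
have d0 : 0 < delta0 / 2 by rewrite divr_gt0 ?delta0_gt0.
have cov w : Lambda_dom 2 (delta0 / 2) w ->
    exists2 z, Gamma_dom 2^-1 1 z & G z = w.
  by move=> [h1 h2 h3]; exact: Lambda_covered.
exists 2, 2^-1, 1, (delta0 / 2); split; first split.
- by split.
- split; last first.
    move=> w /cov[z Gz zw]; exists z => //; rewrite cauchy_transformE//.
    by case: Gz => h _ _; rewrite gt_eqF.
  split=> [z [iz _ _]|z z' /set_mem[iz _ _] /set_mem[iz' _ _]]; last first.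
    by rewrite !cauchy_transformE ?gt_eqF//; exact: G_inj.
  have i0 : 0 < `|Im z| by rewrite normr_gt0 gt_eqF.
  have [c hc] := Cn_cder (Cn_G i0 (@away_Im z)).
  apply: (@cder_derivable _ _ _ c); apply: cder_near hc.
  apply: filterS (near_Im_gt0 iz) => y iy; rewrite cauchy_transformE//.
  by rewrite gt_eqF.
exists Ginv; split; first exact: univalent_Ginv.
move=> w Lw; have [z Gz zw] := cov w Lw; case: (Lw) => iw _ _.
have iz : 0 < Im z by case: Gz.
have -> : Ginv w = z.
  by apply: Ginv_eq => //; [left; apply/eqP; rewrite gt_eqF|rewrite Gh_up].
by split=> //; rewrite cauchy_transformE// gt_eqF.
Qed.

End Distribution.

End Setup.

Theorem corollary4p2 (R : realType) (a b : R) (N : nat) (l alpha : 'I_N -> R)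
  (ha : 0 < a) (hab : a < b)
  (hl01 : forall k, 0 <= l k <= 1)
  (hl : forall i j : 'I_N, (i < j)%N -> l i < l j)
  (halpha : forall k, 0 < alpha k)
  (hint : (\int[lebesgue_measure]_(x in `]a, b[)
             (gpfp_pdf a b alpha l x)%:E)%E = 1%E)
  (d : measure_display) (T : measurableType d) (P : probability T R)
  (X : {RV P >-> R})
  (hX : forall A : set R, measurable A ->
          distribution P X A = gpfp a b alpha l A)
  (r : R) (hr : r <= -1) :
  class_UI (distribution P (pow_RV X r)).
Proof. exact: (pow_distribution_UI ha hab hl01 halpha hr hint hl hX). Qed.
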